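(* Let $K$ be a field. The relation types that occur for AS-Ore extensions over $K$ in $5$ variables with $4$ degree one generators are exactly $$(2,2,2,2,2),\qquad (2,2,2,2,2,3),\qquad (2,2,2,2,2,3,3).$$ Moreover, among universal enveloping algebras of $5$-dimensional $\mathbb{N}$-graded Lie algebras over $K$ that are generated in degree one with $4$ degree one generators, there is none with relation type $(2,2,2,2,2,3)$, while there exist ones with relation type $(2,2,2,2,2)$ and ones with relation type $(2,2,2,2,2,3,3)$.
   Context: Let $K$ be a field. For a ring $R$, a ring endomorphism $\sigma$ of $R$ and a $\sigma$-derivation $\delta$ of $R$ (i.e. $\delta$ is additive and $\delta(r_1r_2)=\sigma(r_1)\delta(r_2)+\delta(r_1)r_2$), the Ore extension $R[x,\sigma,\delta]$ is the ring whose elements are written uniquely as $\sum_{i=0}^m a_ix^i$ with $a_i\in R$, with multiplication satisfying $xr=\sigma(r)x+\delta(r)$ for $r\in R$. A graded iterated Ore extension over $K$ in $n$ variables is a $K$-algebra (so $K$ is central) $A=K[x_1][x_2,\sigma_2,\delta_2]\cdots[x_n,\sigma_n,\delta_n]$ obtained by iterating this construction, where $\sigma_j$ and $\delta_j$ are a ($K$-linear) endomorphism and a ($K$-linear) $\sigma_j$-derivation of $K_{(j-1)}:=K[x_1][x_2,\sigma_2,\delta_2]\cdots[x_{j-1},\sigma_{j-1},\delta_{j-1}]$, together with integers $\deg(x_i)\ge 1$ such that for all $j>i$, $\sigma_j(x_i)$ is homogeneous of degree $\deg(x_i)$ and $\delta_j(x_i)$ is homogeneous of degree $\deg(x_j)+\deg(x_i)$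 (with $0$ homogeneous of every degree). Such $A$ is $\mathbb{N}$-graded and connected. An AS-Ore extension is a graded iterated Ore extension in which every $\sigma_j$ is injective and which is generated in degree one as a $K$-algebra. Its number of degree one generators is $b=\dim_K A_1$. ''Dimension 5'' in this setting means five variables. An $\mathbb{N}$-graded Lie algebra is a finite-dimensional Lie algebra over $K$ with a $K$-basis $x_1,\dots,x_n$ whose elements are assigned positive integer degrees such that $[x_j,x_i]$ is a linear combination of basis elements of degree $\deg(x_j)+\deg(x_i)$; its universal enveloping algebra is then $\mathbb{N}$-graded and connected. ''Generated in degree one'' means generated as a $K$-algebra by its degree one piece, and the number of degree one generators is the dimension of that piece. Relation type: for a connected graded $K$-algebra $A$ generated in degree one, write $A\cong K\langle y_1,\dots,y_b\rangle/I$ with all $y_i$ of degree one, $b=\dim_K A_1$, and $I$ a homogeneous two-sided ideal. The relation type of $A$ is the list $(a_1,\dots,a_n)$, $a_1\le\cdots\le a_n$, of the degrees of the elements of a minimal homogeneous generating set of $I$ (independent of choices). *)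

(* Defs.v *)
From HB Require Import structures.
From mathcomp Require Import all_boot all_order all_algebra.
From mathcomp Require Import finmap monalg.

Set Implicit Arguments.
Unset Strict Implicit.
Unset Printing Implicit Defensive.

Import GRing.Theory.
Local Open Scope ring_scope.

Inductive lin_span (K : fieldType) (V : lmodType K) (P : V -> Prop) :
  V -> Prop :=
| lin_span0 : lin_span P 0
| lin_spanD (c : K) (u v : V) :
    P u -> lin_span P v -> lin_span P (c *: u + v).

(* For a subspace P of V. *)
Definition has_dim (K : fieldType) (V : lmodType K) (P : V -> Prop) (b : nat) :
  Prop :=
  exists e : 'I_b -> V,
    (forall i, P (e i)) /\
    (forall v, P v -> exists! c : {ffun 'I_b -> K}, v = \sum_i c i *: e i).

(* Each element of xs is a generator together with its degree; a word is a
   finite sequence of such pairs. *)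
Definition word_val (K : fieldType) (A : algType K) (w : seq (A * nat)) : A :=
  \prod_(v <- w) v.1.

Definition word_deg (K : fieldType) (A : algType K) (w : seq (A * nat)) : nat :=
  (\sum_(v <- w) v.2)%N.

(* The component of degree m of the grading of the algebra generated by xs for
   which every generator has its assigned degree: the span of all words of
   weight m in the generators.  In a graded iterated Ore extension the
   homogeneity conditions on sigma_j and delta_j make this the span of the
   ordered monomials of weight m. *)
Definition gr (K : fieldType) (A : algType K) (xs : seq (A * nat)) (m : nat) :
  A -> Prop :=
  lin_span (fun a : A => exists w : seq (A * nat),
    [/\ {subset w <= xs}, word_deg w = m & a = word_val w]).

Definition generated_in_degree_one (K : fieldType) (A : algType K)
    (xs : seq (A * nat)) : Prop :=
  forall a : A, lin_span (fun p : A => exists s : seq A,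
    (forall y, y \in s -> gr xs 1 y) /\ p = \prod_(y <- s) y) a.

Definition skew_derivation (K : fieldType) (R : algType K)
    (sigma : {lrmorphism R -> R}) (delta : {linear R -> R}) : Prop :=
  forall r1 r2, delta (r1 * r2) = sigma r1 * delta r2 + delta r1 * r2.

(* S, with the embedding iota : R -> S and the element x, is R[x, sigma, delta];
   finite expressions sum_i a_i x^i are indexed by p : {poly R}, which is used
   only as the finite sequence of its coefficients. *)
Definition ore_extension (K : fieldType) (R S : algType K)
    (sigma : {lrmorphism R -> R}) (delta : {linear R -> R})
    (iota : {lrmorphism R -> S}) (x : S) : Prop :=
  [/\ skew_derivation sigma delta,
      forall s : S, exists! p : {poly R},
        s = \sum_(i < size p) iota p`_i * x ^+ i
    & forall r : R, x * iota r = iota (sigma r) * x + iota (delta r)].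

(* A is a graded iterated Ore extension all of whose sigma_j are injective, with
   variables and degrees xs (first variable first).  The tower starts from the
   K-algebra K itself: there sigma is forced to be the identity and delta to be
   zero, so that the first step gives the polynomial ring K[x_1]. *)
Inductive graded_iterated_ore_inj (K : fieldType) :
  forall A : algType K, seq (A * nat) -> Prop :=
| graded_iterated_ore_inj0 : @graded_iterated_ore_inj K K^o [::]
| graded_iterated_ore_injS (R S : algType K) (xs : seq (R * nat))
    (sigma : {lrmorphism R -> R}) (delta : {linear R -> R})
    (iota : {lrmorphism R -> S}) (x : S) (d : nat) :
    graded_iterated_ore_inj xs ->
    ore_extension sigma delta iota x ->
    injective sigma ->
    (0 < d)%N ->
    (forall y e, (y, e) \in xs ->
       gr xs e (sigma y) /\ gr xs (d + e) (delta y)) ->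
    graded_iterated_ore_inj (rcons [seq (iota v.1, v.2) | v <- xs] (x, d)).

Definition as_ore_extension (K : fieldType) (A : algType K)
    (xs : seq (A * nat)) : Prop :=
  graded_iterated_ore_inj xs /\ generated_in_degree_one xs.

Definition is_lie_bracket (K : fieldType) (L : vectType K)
    (br : L -> L -> L) : Prop :=
  [/\ forall x, linear (br x),
      forall y, linear (br^~ y),
      forall x, br x x = 0
    & forall x y z, br x (br y z) + br y (br z x) + br z (br x y) = 0].

Definition is_graded_lie (K : fieldType) (L : vectType K) (br : L -> L -> L)
    (n : nat) (e : n.-tuple L) (d : n.-tuple nat) : Prop :=
  [/\ is_lie_bracket br,
      basis_of fullv e,
      forall i : 'I_n, (0 < tnth d i)%N
    & forall i j : 'I_n, br (tnth e j) (tnth e i) \in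
        <<[seq tnth e k | k <- enum 'I_n
                        & tnth d k == (tnth d j + tnth d i)%N]>>%VS].

Definition lie_to_assoc (K : fieldType) (L : vectType K) (br : L -> L -> L)
    (B : algType K) (f : {linear L -> B}) : Prop :=
  forall x y, f (br x y) = f x * f y - f y * f x.

Definition is_enveloping_algebra (K : fieldType) (L : vectType K)
    (br : L -> L -> L) (U : algType K) (iota : {linear L -> U}) : Prop :=
  lie_to_assoc br iota /\
  forall (B : algType K) (f : {linear L -> B}), lie_to_assoc br f ->
    exists g : {lrmorphism U -> B}, (forall x, g (iota x) = f x) /\
      (forall h : {lrmorphism U -> B}, (forall x, h (iota x) = f x) -> h =1 g).

Definition free_alg (K : fieldType) (b : nat) : lalgType K :=
  {malg K[{fmonom 'I_b}]}.

Definition free_var (K : fieldType) (b : nat) (i : 'I_b) : free_alg K b :=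
  << fmu i >>.

(* Zero is homogeneous of every degree. *)
Definition free_homog (K : fieldType) (b m : nat) (f : free_alg K b) : bool :=
  all (fun w : {fmonom 'I_b} => fdeg w == m) (msupp f).

Definition two_sided_ideal (K : fieldType) (F : lalgType K) (G : seq F) :
  F -> Prop :=
  lin_span (fun a : F => exists u g v, g \in G /\ a = u * g * v).

Definition generates_ideal (K : fieldType) (F : lalgType K) (G : seq F)
    (I : F -> Prop) : Prop :=
  forall f, I f <-> two_sided_ideal G f.

Definition minimal_generating_set (K : fieldType) (F : lalgType K) (G : seq F)
    (I : F -> Prop) : Prop :=
  [/\ uniq G,
      generates_ideal G I
    & forall H : seq F, {subset H <= G} -> generates_ideal H I ->
        {subset G <= H}].

(* A, graded by gr xs, has relation type l. *)
Definition has_relation_type (K : fieldType) (A : algType K)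
    (xs : seq (A * nat)) (l : seq nat) : Prop :=
  exists (b : nat) (pi : {lrmorphism free_alg K b -> A}) (G : seq (free_alg K b)),
    [/\ has_dim (gr xs 1) b,
        forall i, gr xs 1 (pi (free_var K i)),
        forall a, exists f, pi f = a,
        minimal_generating_set G (fun f => pi f = 0)
      & all2 (fun m g => free_homog m g) l G && sorted leq l].

Definition as_ore_relation_type (K : fieldType) (n b : nat) (l : seq nat) :
  Prop :=
  exists (A : algType K) (xs : seq (A * nat)),
    [/\ as_ore_extension xs, size xs = n, has_dim (gr xs 1) b
      & has_relation_type xs l].

Definition enveloping_relation_type (K : fieldType) (n b : nat) (l : seq nat) :
  Prop :=
  exists (L : vectType K) (br : L -> L -> L)
         (e : n.-tuple L) (d : n.-tuple nat)
         (U : algType K) (iota : {linear L -> U}),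
    let xs := zip (map iota e) d in
    [/\ is_graded_lie br e d, is_enveloping_algebra br iota,
        generated_in_degree_one xs, has_dim (gr xs 1) b
      & has_relation_type xs l].

(* Main.v *)
From HB Require Import structures.
From mathcomp Require Import all_boot all_order all_algebra.
From mathcomp Require Import finmap monalg.
From mathcomp Require Import boolp.
From mathcomp Require Import zify ring.
Require Import Defs.
From mathcomp Require Import all_boot all_order all_algebra.

(** Upper bound. Let A be an AS-Ore extension in five variables with dim A_1 = 4.
    Four variables have degree one. If none of the variables had degree two, no
    product of degree one elements could involve a variable of degree three or
    more ([tower_no_degree_2]); so the fifth variable has degree two. The ordered
    monomials form a basis, whence dim A_2 = 11 and dim A_3 = 24. The commutation
    rules of the variables have degree at most three and generate the kernel of
    the map from the free algebra onto A ([tower_section], [kernel_generated]);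
    hence all minimal relations have degree two or three. Let V = A_1 and let R
    be the space of quadratic relations inside V tensor V. Its dimension is
    16 - 11 = 5, and the number of cubic relations in a minimal set is
    (64 - 24) - dim (VR + RV), which equals dim (VR and RV intersected) since
    VR and RV have dimension 20 each ([relation_count]).

    The heart of the matter is that this intersection has dimension at most two
    ([dim_cubic_overlap]). The order in which the degree one variables are
    adjoined gives a flag in V, and the commutation rules, the injectivity of the
    maps sigma_j and the absence of zero divisors restrict R with respect to it
    ([tower_flag], [tower_domain]). Filtering R and the intersection along the
    flag leaves three possible lists of dimensions, and each of them gives at most
    two.

    Existence. For s with s^2 = 1 and b with b (1 + s) = 0, consider the algebra
    with generators x1, x2, x3, x4 of degree one, z of degree two, and relations
      x2 x1 = s x1 x2 + z,    x4 x3 = x3 x4 + a z + b x1^2,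
    all other pairs of generators commuting. It is an iterated Ore extension
    ([example_family]). After elimination of z, what remains are the five
    quadratic relations and the commutation of z with x1 and x2. For
    (s, a, b) = (1, 1, 0) the latter follows from the quadratic relations, for
    (-1, 0, 1) one cubic relation is needed and for (1, 0, 0) two are. That the
    resulting sets of relations are minimal is seen on one word of each relation
    that is not hit by the ideal of the other relations ([marked_minimal]).

    Lie algebras. A five-dimensional graded Lie algebra generated by four elements
    of degree one is given by a nonzero alternating form on V with values in a line
    of degree two ([lie_form]). A symplectic basis shows that its enveloping algebra
    is the above algebra with (s, a, b) = (1, 1, 0) or (1, 0, 0), according to the
    rank of the form ([lie_type_of_example]), and both occur ([std_enveloping]).
    Their relation types are distinct from the one with exactly one cubic
    relation. *)

Set Implicit Arguments.
Unset Strict Implicit.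
Unset Printing Implicit Defensive.

Import GRing.Theory.
Local Open Scope ring_scope.

(** * Subspaces, dimensions and graded pieces *)

Section Subspaces.
Variables (K : fieldType) (V : lmodType K).
Implicit Types P Q : V -> Prop.

Definition is_subspace Q := Q 0 /\ forall (c : K) u v, Q u -> Q v -> Q (c *: u + v).

Lemma subspaceD Q u v : is_subspace Q -> Q u -> Q v -> Q (u + v).
Proof. by case=> _ Ql Qu Qv; rewrite -[u]scale1r; apply: Ql. Qed.

Lemma subspaceZ Q c u : is_subspace Q -> Q u -> Q (c *: u).
Proof. by case=> Q0 Ql Qu; rewrite -[_ *: _]addr0; apply: Ql. Qed.

Lemma subspaceN Q u : is_subspace Q -> Q u -> Q (- u).
Proof. by move=> sQ Qu; rewrite -scaleN1r; apply: subspaceZ. Qed.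

Lemma subspaceB Q u v : is_subspace Q -> Q u -> Q v -> Q (u - v).
Proof. by move=> sQ Qu Qv; apply: subspaceD => //; apply: subspaceN. Qed.

Lemma subspace_sum Q (I : Type) (r : seq I) (S : pred I) (F : I -> V) :
  is_subspace Q -> (forall i, S i -> Q (F i)) -> Q (\sum_(i <- r | S i) F i).
Proof.
move=> sQ QF; elim/big_rec: _ => [|i v Si Qv]; first by case: sQ.
by apply: subspaceD => //; apply: QF.
Qed.

Lemma lin_span_subspace P : is_subspace (lin_span P).
Proof.
split=> [|c u v Pu Pv]; first exact: lin_span0.
elim: Pu => [|d x y Px _ IH]; first by rewrite scaler0 add0r.
by rewrite scalerDr scalerA -addrA; apply: lin_spanD.
Qed.

Lemma lin_span_id P u : P u -> lin_span P u.
Proof.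
by move=> Pu; rewrite -[u]scale1r -[_ *: _]addr0; apply/lin_spanD/lin_span0.
Qed.

Lemma lin_span_min P Q : is_subspace Q -> (forall u, P u -> Q u) ->
  forall v, lin_span P v -> Q v.
Proof.
by move=> [Q0 Ql] PQ v; elim=> // c x y Px _ Qy; apply: Ql => //; apply: PQ.
Qed.

Lemma has_dim_ext P Q b : (forall v, P v <-> Q v) -> has_dim P b -> has_dim Q b.
Proof.
move=> PQ [e [Pe he]]; exists e; split=> [i|v Qv]; first exact/(PQ _).1.
exact/he/(PQ v).2.
Qed.

(** Unique coordinates become a coordinate map with values in row vectors, so
    that dimensions can be compared by matrix algebra. *)
Lemma has_dim_coord P b : has_dim P b ->
  exists (e : 'I_b -> V) (co : V -> 'rV[K]_b),
    [/\ forall i, P (e i),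
        forall v, P v -> v = \sum_i co v 0 i *: e i
      & is_subspace P ->
        forall c : 'rV_b, co (\sum_i c 0 i *: e i) = c].
Proof.
case=> e [Pe he].
have key v : exists c : 'rV[K]_b, P v -> v = \sum_i c 0 i *: e i.
  case: (pselect (P v)) => [/he[c [vE _]]|nPv]; last by exists 0.
  by exists (\row_i c i) => _; rewrite vE; apply: eq_bigr => i _; rewrite mxE.
pose co v := projT1 (cid (key v)).
exists e, co; split=> // [v Pv|sP c]; first by rewrite /co; case: cid => c /= ->.
rewrite /co; case: cid => d /= hd;
have Pc : P (\sum_i c 0 i *: e i).
  by apply: subspace_sum => // i _; apply: subspaceZ.
have [c0 [_ uniq_c]] := he _ Pc.
have c0E (r : 'rV_b) : \sum_i c 0 i *: e i = \sum_i r 0 i *: e i ->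
    c0 = [ffun i => r 0 i].
  by move=> rE; apply: uniq_c; rewrite rE; apply: eq_bigr => i _; rewrite ffunE.
apply/rowP => i.
have := c0E _ (erefl _); rewrite (c0E _ (hd Pc)) => /ffunP/(_ i).
by rewrite !ffunE.
Qed.

(** Expressing each basis in the other one gives matrices with [M *m N = 1],
    and such an [M] is at most as high as wide. *)
Lemma has_dim_leq P b b' : is_subspace P -> has_dim P b -> has_dim P b' ->
  (b <= b')%N.
Proof.
move=> sP /has_dim_coord[e [co [Pe he hco]]] /has_dim_coord[e' [co' [Pe' he' hco']]].
pose M := \matrix_(i < b) co' (e i); pose N := \matrix_(i < b') co (e' i).
apply: (@mulmx1_min K b b' M N); apply/row_matrixP => i; rewrite row_mul.
have eE : e i = \sum_k (row i M *m N) 0 k *: e k.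
  rewrite {1}(he' _ (Pe i)) [in LHS](eq_bigr (fun j => \sum_k (M i j * N j k) *: e k)).
    rewrite exchange_big; apply: eq_bigr => k _ /=.
    by rewrite mxE scaler_suml; apply: eq_bigr => j _; rewrite [row _ _ _ _]mxE.
  move=> j _; rewrite {1}(he _ (Pe' j)) scaler_sumr; apply: eq_bigr => k _.
  by rewrite scalerA !mxE.
rewrite -(hco sP (row i M *m N)) -eE -[RHS](hco sP); congr co.
rewrite (bigD1 i) //= big1 ?addr0 => [|k ki]; rewrite !mxE ?eqxx ?scale1r //.
by rewrite eq_sym (negPf ki) scale0r.
Qed.

Lemma has_dim_unique P b b' : is_subspace P -> has_dim P b -> has_dim P b' -> b = b'.
Proof.
by move=> sP hb hb'; apply/eqP; rewrite eqn_leq !(has_dim_leq sP).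
Qed.

Lemma has_dim0 : has_dim (fun v : V => v = 0) 0.
Proof.
exists (fun=> 0); split=> // v ->; exists [ffun=> 0]; split; first by rewrite big_ord0.
by move=> c _; apply/ffunP => -[].
Qed.

Lemma has_dimD P Q b c : is_subspace P -> is_subspace Q ->
  (forall u, P u -> Q u -> u = 0) -> has_dim P b -> has_dim Q c ->
  has_dim (fun v => exists u w, [/\ P u, Q w & v = u + w]) (b + c).
Proof.
move=> sP sQ PQ0 [e [Pe he]] [f [Qf hf]].
pose g (i : 'I_(b + c)) := match split i with inl j => e j | inr j => f j end.
have P0 : P 0 by case: sP.
have Q0 : Q 0 by case: sQ.
exists g; split=> [i|v [u [w [Pu Qw ->]]]].
  rewrite /g; case: split => j; first by exists (e j), 0; rewrite addr0; split.
  by exists 0, (f j); rewrite add0r; split.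
have [cu [uE uu]] := he _ Pu; have [cw [wE uw]] := hf _ Qw.
have gl j : g (lshift c j) = e j by rewrite /g (unsplitK (inl _ j)).
have gr j : g (rshift b j) = f j by rewrite /g (unsplitK (inr _ j)).
exists [ffun i => match split i with inl j => cu j | inr j => cw j end]; split.
  rewrite big_split_ord {1}uE {1}wE; congr (_ + _); apply: eq_bigr => j _.
    by rewrite ffunE gl (unsplitK (inl _ j)).
  by rewrite ffunE gr (unsplitK (inr _ j)).
move=> d; rewrite big_split_ord /= => dE.
set u' := \sum_i d (lshift c i) *: e i.
have E1 : \sum_i d (lshift c i) *: g (lshift c i) = u'.
  by apply: eq_bigr => i _; rewrite gl.
set w' := \sum_i d (rshift b i) *: f i.
have E2 : \sum_i d (rshift b i) *: g (rshift b i) = w'.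
  by apply: eq_bigr => i _; rewrite gr.
rewrite E1 E2 in dE.
have Pu' : P u' by apply: subspace_sum => // i _; apply: subspaceZ.
have Qw' : Q w' by apply: subspace_sum => // i _; apply: subspaceZ.
have uw0 : u - u' = 0.
  apply: PQ0; first exact: subspaceB.
  suff -> : u - u' = w' - w by apply: subspaceB.
  by apply/eqP; rewrite subr_eq addrAC eq_sym subr_eq addrC dE eq_sym addrC.
have uu' : u = u' by apply/eqP; rewrite -subr_eq0 uw0.
have ww' : w = w' by apply: (addrI u); rewrite dE uu'.
have cuE := uu [ffun i => d (lshift c i)].
have cwE := uw [ffun i => d (rshift b i)].
apply/ffunP => i; rewrite ffunE.
case: (splitP i) => j ij.
  rewrite cuE ?ffunE; first by congr (d _); apply: val_inj.
  by rewrite uu'; apply: eq_bigr => k _; rewrite ffunE.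
rewrite cwE ?ffunE; first by congr (d _); apply: val_inj.
by rewrite ww'; apply: eq_bigr => k _; rewrite ffunE.
Qed.

Lemma has_dim_map (W : lmodType K) (f : {linear V -> W}) P b : injective f ->
  has_dim P b -> has_dim (fun w => exists2 v, P v & w = f v) b.
Proof.
move=> finj [e [Pe he]]; exists (fun i => f (e i)); split=> [i|w [v Pv ->]].
  by exists (e i).
have [c [vE uc]] := he _ Pv; exists c; split.
  by rewrite {1}vE linear_sum; apply: eq_bigr => i _; rewrite linearZ.
move=> d dE; apply: uc; apply: finj; rewrite dE linear_sum.
by apply: eq_bigr => i _; rewrite linearZ.
Qed.

(** Rank-nullity for a map onto a subspace that is given by a predicate inside
    a possibly infinite-dimensional space. *)
Lemma ker_dim (T : vectType K) (f : {linear T -> V}) P b : is_subspace P ->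
  has_dim P b -> (forall t, P (f t)) -> (forall v, P v -> exists t, f t = v) ->
  exists Kf : {vspace T},
    (forall t, (t \in Kf) = (f t == 0)) /\ (\dim Kf + b = dim T)%N.
Proof.
move=> sP /has_dim_coord[e [co [Pe he hco]]] Pf fS; have {}hco := hco sP.
have coL c u v : P u -> P v -> co (c *: u + v) = c *: co u + co v.
  move=> Pu Pv; rewrite -[RHS]hco; congr co.
  rewrite {1}(he u Pu) {1}(he v Pv) scaler_sumr -big_split; apply: eq_bigr => i _.
  by rewrite !mxE scalerDl scalerA.
have glin : linear (fun t => co (f t)).
  by move=> c t u; rewrite linearP coL.
pose gl : {linear T -> 'rV[K]_b} :=
  HB.pack (fun t => co (f t)) (GRing.isLinear.Build _ _ _ _ (fun t => co (f t)) glin).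
have glE t : linfun gl t = co (f t) by rewrite lfunE.
exists (lker (linfun gl)); split=> [t|].
  rewrite memv_ker glE; apply/eqP/eqP => [c0|->].
    by rewrite (he _ (Pf t)) c0; apply: big1 => i _; rewrite mxE scale0r.
  by have := hco 0; rewrite big1 // => i _; rewrite mxE scale0r.
have := limg_ker_dim (linfun gl) fullv; rewrite capfv dimvf => <-; congr addn.
suff -> : limg (linfun gl) = fullv by rewrite dimvf /dim /= mul1n.
apply/eqP; rewrite eqEsubv subvf; apply/subvP => c _.
have [t ft] : exists t, f t = \sum_i c 0 i *: e i.
  by apply: fS; apply: subspace_sum => // i _; apply: subspaceZ.
by apply/memv_imgP; exists t; rewrite ?memvf // glE ft hco.
Qed.

End Subspaces.

Lemma lin_span_map (K : fieldType) (V W : lmodType K) (f : {linear V -> W})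
    (P : V -> Prop) (Q : W -> Prop) :
  (forall u, P u -> lin_span Q (f u)) -> forall v, lin_span P v -> lin_span Q (f v).
Proof.
move=> PQ v; elim=> [|c x y Px _ Qy]; first by rewrite linear0; apply: lin_span0.
by rewrite linearP; apply: (lin_span_subspace Q).2 => //; apply: PQ.
Qed.

Lemma subspace_preim (K : fieldType) (V W : lmodType K) (f : {linear V -> W})
    (Q : W -> Prop) : is_subspace Q -> is_subspace (fun v => Q (f v)).
Proof.
case=> Q0 Ql; split=> [|c u v Qu Qv]; first by rewrite linear0.
by rewrite linearP; apply: Ql.
Qed.

Lemma subspace_mull (K : fieldType) (A : algType K) (Q : A -> Prop) a :
  is_subspace Q -> is_subspace (fun u => Q (a * u)).
Proof.
case=> Q0 Ql; split=> [|c u v Qu Qv]; first by rewrite mulr0.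
by rewrite mulrDr -scalerAr; apply: Ql.
Qed.

Lemma subspace_mulr (K : fieldType) (A : algType K) (Q : A -> Prop) a :
  is_subspace Q -> is_subspace (fun u => Q (u * a)).
Proof.
case=> Q0 Ql; split=> [|c u v Qu Qv]; first by rewrite mul0r.
by rewrite mulrDl -scalerAl; apply: Ql.
Qed.

Lemma subspace_eq (K : fieldType) (V W : lmodType K) (f g : {linear V -> W}) :
  is_subspace (fun u => f u = g u).
Proof. by split=> [|c u v fu fv]; rewrite ?linear0 // !linearP /= fu fv. Qed.

Lemma subspace_image (K : fieldType) (V W : lmodType K) (f : {linear V -> W}) :
  is_subspace (fun w => exists v, f v = w).
Proof.
split=> [|c _ _ [u <-] [v <-]]; first by exists 0; rewrite linear0.
by exists (c *: u + v); rewrite linearP.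
Qed.

Lemma linear_of (K : fieldType) (V W : lmodType K) (f : V -> W) :
  linear f -> exists g : {linear V -> W}, g =1 f.
Proof.
move=> fl; pose g : {linear V -> W} := HB.pack f (GRing.isLinear.Build _ _ _ _ f fl).
by exists g.
Qed.

Section LinearCombinations.
Variables (K : fieldType) (V : lmodType K) (n : nat) (x : 'I_n -> V).

Definition lincomb (r : 'rV[K]_n) : V := \sum_i r 0 i *: x i.

Lemma lincomb_linear : linear lincomb.
Proof.
move=> c u v; rewrite /lincomb scaler_sumr -big_split; apply: eq_bigr => i _.
by rewrite !mxE scalerDl scalerA.
Qed.
HB.instance Definition _ := GRing.isLinear.Build K 'rV[K]_n V *:%R lincomb lincomb_linear.

Lemma lincomb_delta i : lincomb (delta_mx 0 i) = x i.
Proof.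
rewrite /lincomb (bigD1 i) //= big1 ?addr0 => [|j nj]; rewrite mxE ?eqxx ?scale1r //.
by rewrite (negPf nj) andbF scale0r.
Qed.
End LinearCombinations.

Section Graded.
Variables (K : fieldType) (A : algType K).
Implicit Types (xs ys : seq (A * nat)).

Lemma gr_subspace xs m : is_subspace (gr xs m).
Proof. exact: lin_span_subspace. Qed.

Lemma gr_word xs w : {subset w <= xs} -> gr xs (word_deg w) (word_val w).
Proof. by move=> wxs; apply: lin_span_id; exists w. Qed.

Lemma gr1 xs : gr xs 0 1.
Proof.
have := @gr_word xs [::]; rewrite /word_deg /word_val !big_nil; apply.
by move=> x.
Qed.

Lemma gr_gen xs y e : (y, e) \in xs -> gr xs e y.
Proof.
move=> yxs; have := @gr_word xs [:: (y, e)].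
rewrite /word_deg /word_val !big_seq1; apply.
by move=> x; rewrite inE => /eqP->.
Qed.

Lemma grM xs m n a b : gr xs m a -> gr xs n b -> gr xs (m + n) (a * b).
Proof.
move=> ga gb; move: a ga.
apply: lin_span_min => [|u [w [wxs <- ->]]].
  exact/subspace_mulr/gr_subspace.
move: b gb; apply: lin_span_min => [|v [z [zxs <- ->]]].
  exact/subspace_mull/gr_subspace.
rewrite /word_val /word_deg -!big_cat; apply: gr_word => x.
by rewrite mem_cat => /orP[/wxs|/zxs].
Qed.

Lemma grX xs m n a : gr xs m a -> gr xs (n * m) (a ^+ n).
Proof.
by move=> ga; elim: n => [|n IH]; [exact: gr1 | rewrite exprS mulSn; apply: grM].
Qed.

Lemma gr_ind xs (Q : nat -> A -> Prop) : (forall m, is_subspace (Q m)) ->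
  Q 0%N 1 ->
  (forall y e m a, (y, e) \in xs -> gr xs m a -> Q m a -> Q (e + m)%N (y * a)) ->
  forall m a, gr xs m a -> Q m a.
Proof.
move=> sQ Q1 Qm m; apply: lin_span_min => // u [w [wxs <- ->]].
elim: w wxs => [|[y e] w IH] wxs; first by rewrite /word_deg /word_val !big_nil.
rewrite /word_deg /word_val !big_cons; apply: Qm.
- by apply: wxs; rewrite mem_head.
- by apply: gr_word => x xw; apply: wxs; rewrite inE xw orbT.
- by apply: IH => x xw; apply: wxs; rewrite inE xw orbT.
Qed.

End Graded.

Lemma gr_map (K : fieldType) (A B : algType K) (f : {lrmorphism A -> B})
    (xs : seq (A * nat)) (ys : seq (B * nat)) m a :
  (forall y e, (y, e) \in xs -> gr ys e (f y)) -> gr xs m a -> gr ys m (f a).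
Proof.
move=> fxs; move: m a; apply: gr_ind.
- by move=> m; apply/(@subspace_preim _ _ _ f)/gr_subspace.
- by rewrite rmorph1; apply: gr1.
by move=> y e m a yxs _ IH; rewrite rmorphM; apply: grM => //; apply: fxs.
Qed.

(** * Ideals and Ore extensions *)

Section Ideals.
Variables (K : fieldType) (F : algType K).

Definition is_subalgebra (Q : F -> Prop) :=
  [/\ is_subspace Q, Q 1 & forall a b, Q a -> Q b -> Q (a * b)].

Definition is_ideal (I : F -> Prop) :=
  [/\ is_subspace I, forall a u, I u -> I (a * u) & forall a u, I u -> I (u * a)].

Lemma subalgebra_equalizer (B : algType K) (f g : {lrmorphism F -> B}) :
  is_subalgebra (fun u => f u = g u).
Proof.
split; [exact: (@subspace_eq _ _ _ f g) | by rewrite !rmorph1 |].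
by move=> a b fa fb; rewrite !rmorphM /= fa fb.
Qed.

Lemma subalgebra_image (B : algType K) (f : {lrmorphism B -> F}) :
  is_subalgebra (fun u => exists v, f v = u).
Proof.
split; [exact: (@subspace_image _ _ _ f) | by exists 1; rewrite rmorph1 |].
by move=> _ _ [u <-] [v <-]; exists (u * v); rewrite rmorphM.
Qed.

Lemma kernel_ideal (B : algType K) (f : {lrmorphism F -> B}) : is_ideal (fun u => f u = 0).
Proof.
split=> [|a u fu|a u fu]; last 2 first.
- by rewrite rmorphM /= fu mulr0.
- by rewrite rmorphM /= fu mul0r.
by split=> [|c u v fu fv]; rewrite ?linear0 // linearP /= fu fv scaler0 addr0.
Qed.

Lemma zero_ideal : is_ideal (fun u : F => u = 0).
Proof.
split=> [|a _ ->|a _ ->]; rewrite ?mulr0 ?mul0r //.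
by split=> // c _ _ -> ->; rewrite scaler0 addr0.
Qed.

Variable I : F -> Prop.
Hypothesis idI : is_ideal I.

(** Congruence modulo [I]. A linear map into [F] that is multiplicative modulo
    [I] plays the role of an algebra map into the quotient of [F] by [I], a
    ring that is never formed. *)
Definition eqI u v := I (u - v).

Let sI : is_subspace I. Proof. by case: idI. Qed.

Lemma eqI_refl u : eqI u u.
Proof. by rewrite /eqI subrr; case: sI. Qed.

Lemma eqI_sym u v : eqI u v -> eqI v u.
Proof. by move=> uv; rewrite /eqI -opprB; apply: subspaceN. Qed.

Lemma eqI_trans v u w : eqI u v -> eqI v w -> eqI u w.
Proof.
move=> uv vw; rewrite /eqI; have := subspaceD sI uv vw.
by rewrite addrA subrK.
Qed.

Lemma eqID u v u' v' : eqI u v -> eqI u' v' -> eqI (u + u') (v + v').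
Proof. by move=> uv uv'; rewrite /eqI opprD addrACA; apply: subspaceD. Qed.

Lemma eqIZ c u v : eqI u v -> eqI (c *: u) (c *: v).
Proof. by move=> uv; rewrite /eqI -scalerBr; apply: subspaceZ. Qed.

Lemma eqIMl a u v : eqI u v -> eqI (a * u) (a * v).
Proof. by move=> uv; rewrite /eqI -mulrBr; case: idI => _ + _; apply. Qed.

Lemma eqIMr a u v : eqI u v -> eqI (u * a) (v * a).
Proof. by move=> uv; rewrite /eqI -mulrBl; case: idI => _ _; apply. Qed.

Lemma eqIM u v u' v' : eqI u v -> eqI u' v' -> eqI (u * u') (v * v').
Proof. by move=> uv uv'; apply: (eqI_trans (eqIMr u' uv)); apply: eqIMl. Qed.

End Ideals.

Lemma subalgebra_preim (K : fieldType) (A B : algType K) (f : {lrmorphism A -> B}) Q :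
  is_subalgebra Q -> is_subalgebra (fun u => Q (f u)).
Proof.
case=> sQ Q1 QM; split; [exact: (@subspace_preim _ _ _ f) | by rewrite rmorph1 |].
by move=> a b Qa Qb; rewrite rmorphM; apply: QM.
Qed.

Section OreExtension.
Variables (K : fieldType) (R S : algType K).
Variables (sigma : {lrmorphism R -> R}) (delta : {linear R -> R}).
Variables (iota : {lrmorphism R -> S}) (x : S).
Hypothesis ore : ore_extension sigma delta iota x.

Implicit Types (p q : {poly R}).

Definition ore_eval p := \sum_(i < size p) iota p`_i * x ^+ i.

Lemma ore_eval_wide p n : (size p <= n)%N ->
  ore_eval p = \sum_(i < n) iota p`_i * x ^+ i.
Proof.
move=> pn; rewrite /ore_eval -!(big_mkord xpredT (fun i => iota p`_i * x ^+ i)).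
rewrite [RHS](big_cat_nat (n := size p)) //= [X in _ + X]big_nat_cond.
rewrite [X in _ + X]big1 ?addr0 // => i /andP[/andP[pi _] _].
by rewrite nth_default // rmorph0 mul0r.
Qed.

Lemma ore_evalP (c : K) p q : ore_eval (c%:A *: p + q) = c *: ore_eval p + ore_eval q.
Proof.
have le_p : (size p <= maxn (size p) (size q))%N by rewrite leq_maxl.
have le_q : (size q <= maxn (size p) (size q))%N by rewrite leq_maxr.
rewrite (ore_eval_wide le_p) (ore_eval_wide le_q) (@ore_eval_wide _ (maxn (size p) (size q))).
  rewrite scaler_sumr -big_split; apply: eq_bigr => i _.
  by rewrite coefD coefZ mulr_algl linearP mulrDl scalerAl.
apply: (leq_trans (size_polyD _ _)); rewrite geq_max le_q andbT.
exact: leq_trans (size_scale_leq _ _) le_p.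
Qed.

Lemma ore_eval0 : ore_eval 0 = 0.
Proof. by rewrite /ore_eval size_poly0 big_ord0. Qed.

Lemma ore_evalD p q : ore_eval (p + q) = ore_eval p + ore_eval q.
Proof. by have := ore_evalP 1 p q; rewrite !scale1r. Qed.

Lemma ore_eval_sum (J : Type) (r : seq J) (f : J -> {poly R}) :
  ore_eval (\sum_(i <- r) f i) = \sum_(i <- r) ore_eval (f i).
Proof.
elim: r => [|i r IH]; first by rewrite !big_nil ore_eval0.
by rewrite !big_cons ore_evalD IH.
Qed.

Lemma ore_eval_monom a n : ore_eval (a *: 'X^n) = iota a * x ^+ n.
Proof.
rewrite (@ore_eval_wide _ n.+1); last first.
  by apply: (leq_trans (size_scale_leq _ _)); rewrite size_polyXn.
rewrite big_ord_recr /= big1 ?add0r => [|i _]; rewrite coefZ coefXn.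
  by rewrite eqxx mulr1.
by rewrite ltn_eqF // mulr0 rmorph0 mul0r.
Qed.

Lemma ore_evalC a : ore_eval a%:P = iota a.
Proof. by have := ore_eval_monom a 0; rewrite expr0 mulr1 alg_polyC. Qed.

Lemma ore_eval_inj : injective ore_eval.
Proof.
move=> p q pq; case: ore => _ /(_ (ore_eval p))[r [_ ur]] _.
by rewrite -(ur p) // -(ur q).
Qed.

Lemma ore_eval_surj s : exists p, s == ore_eval p.
Proof. by case: ore => _ /(_ s)[p [sE _]] _; exists p; apply/eqP. Qed.

Definition ore_coef s : {poly R} := xchoose (ore_eval_surj s).

Lemma ore_coefK s : ore_eval (ore_coef s) = s.
Proof. by have /eqP := xchooseP (ore_eval_surj s). Qed.

Lemma ore_evalK p : ore_coef (ore_eval p) = p.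
Proof. by apply: ore_eval_inj; rewrite ore_coefK. Qed.

Lemma ore_coefP (c : K) s t : ore_coef (c *: s + t) = c%:A *: ore_coef s + ore_coef t.
Proof. by apply: ore_eval_inj; rewrite ore_coefK ore_evalP !ore_coefK. Qed.

Lemma ore_iota_inj : injective iota.
Proof.
by move=> a b; rewrite -!ore_evalC => /ore_eval_inj; apply: polyC_inj.
Qed.

Lemma ore_mul_iota r p : iota r * ore_eval p = ore_eval (r *: p).
Proof.
rewrite (@ore_eval_wide (r *: p) (size p)) ?size_scale_leq // mulr_sumr.
by apply: eq_bigr => i _; rewrite coefZ rmorphM mulrA.
Qed.

(** The coefficients of [x * s] as a function of those of [s]. *)
Definition ore_shift p := map_poly sigma p * 'X + map_poly delta p.

Lemma coef_ore_shift p i :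
  (ore_shift p)`_i = (if i is j.+1 then sigma p`_j else 0) + delta p`_i.
Proof.
rewrite coefD coefMX; case: i => [|i] /=; rewrite ?coef_map_id0 ?rmorph0 ?linear0 //.
Qed.

Lemma ore_mul_x p : x * ore_eval p = ore_eval (ore_shift p).
Proof.
rewrite (@ore_eval_wide (ore_shift p) (size p).+1); last first.
  rewrite /ore_shift; apply: (leq_trans (size_polyD _ _)); rewrite geq_max; apply/andP; split.
    have [->|nz] := eqVneq (map_poly sigma p) 0; first by rewrite mul0r size_poly0.
    by rewrite size_mulX // ltnS size_poly.
  by apply: leq_trans (size_poly _ _) _.
rewrite (@ore_eval_wide p (size p).+1) //.
have xr : forall r, x * iota r = iota (sigma r) * x + iota (delta r) by case: ore.
rewrite mulr_sumr (eq_bigr (fun i : 'I_(size p).+1 =>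
   iota (sigma p`_i) * x ^+ i.+1 + iota (delta p`_i) * x ^+ i)); last first.
  by move=> i _; rewrite mulrA xr mulrDl -mulrA -exprS.
rewrite big_split /= big_ord_recr /= (nth_default _ (leqnn _)) rmorph0 rmorph0.
rewrite mul0r addr0.
rewrite [RHS](eq_bigr (fun i : 'I_(size p).+1 =>
  iota (if i : nat is j.+1 then sigma p`_j else 0) * x ^+ i
    + iota (delta p`_i) * x ^+ i)); last first.
  by move=> i _; rewrite coef_ore_shift rmorphD mulrDl.
rewrite [RHS]big_split /=; congr (_ + _).
by rewrite [RHS]big_ord_recl /= rmorph0 mul0r add0r.
Qed.

Lemma ore_ind (Q : S -> Prop) : is_subspace Q ->
  (forall r n, Q (iota r * x ^+ n)) -> forall s, Q s.
Proof. by move=> sQ Qm s; rewrite -(ore_coefK s); apply: subspace_sum. Qed.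

Lemma ore_subalgebra_ind (Q : S -> Prop) : is_subalgebra Q ->
  (forall r, Q (iota r)) -> Q x -> forall s, Q s.
Proof.
case=> sQ Q1 QM Qi Qx; apply: ore_ind => // r n; apply: (QM) => //.
by elim: n => [|n IH]; rewrite ?expr0 // exprS; apply: QM.
Qed.

Lemma ore_deltaM r1 r2 : delta (r1 * r2) = sigma r1 * delta r2 + delta r1 * r2.
Proof. by case: ore. Qed.

Lemma ore_delta1 : delta 1 = 0.
Proof.
have := ore_deltaM 1 1; rewrite rmorph1 !mulr1 mul1r => /eqP.
by rewrite -subr_eq0 opprD addrA subrr sub0r oppr_eq0 => /eqP.
Qed.

Section Lift.
Variables (F : algType K) (I : F -> Prop).
Hypothesis idI : is_ideal I.
Variables (f : {linear R -> F}) (y : F).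
Hypothesis f1 : f 1 = 1.
Hypothesis fM : forall a b : R, eqI I (f (a * b)) (f a * f b).

(** The commutation rule of [x] with [r], transported along [f] with [x]
    replaced by [y]. *)
Definition ore_compatible r := eqI I (y * f r) (f (sigma r) * y + f (delta r)).

(** The skew Leibniz rule of [delta] is what makes the commutation rule pass
    to products; hence it has to be checked on algebra generators only. *)
Lemma ore_compatible_subalgebra : is_subalgebra ore_compatible.
Proof.
split; first split.
- by rewrite /ore_compatible !linear0 mulr0 mul0r addr0; apply: eqI_refl.
- move=> c u v cu cv; rewrite /ore_compatible !linearP mulrDr -scalerAr mulrDl -scalerAl.
  by rewrite addrACA -scalerDr; apply: eqID => //; apply: eqIZ.
- rewrite /ore_compatible rmorph1 f1 ore_delta1 linear0 mulr1 mul1r addr0.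
  exact: eqI_refl.
move=> a b ca cb; rewrite /ore_compatible.
apply: (eqI_trans idI (v := y * (f a * f b))); first exact: eqIMl.
rewrite mulrA.
apply: (eqI_trans idI (v := (f (sigma a) * y + f (delta a)) * f b)); first exact: eqIMr.
rewrite mulrDl -mulrA.
apply: (eqI_trans idI (v := f (sigma a) * (f (sigma b) * y + f (delta b)) + f (delta a) * f b)).
  by apply: eqID => //; [apply: eqIMl | apply: eqI_refl].
rewrite mulrDr mulrA -addrA ore_deltaM linearD rmorphM; apply: eqID => //.
  by apply: eqIMr => //; apply: eqI_sym.
by apply: eqID => //; apply: eqI_sym.
Qed.

Hypothesis compat : forall r, ore_compatible r.

Definition ore_lift_fun s := \sum_(i < size (ore_coef s)) f (ore_coef s)`_i * y ^+ i.

Lemma ore_lift_wide s n : (size (ore_coef s) <= n)%N ->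
  ore_lift_fun s = \sum_(i < n) f (ore_coef s)`_i * y ^+ i.
Proof.
move=> pn; rewrite /ore_lift_fun.
rewrite -!(big_mkord xpredT (fun i => f (ore_coef s)`_i * y ^+ i)).
rewrite [RHS](big_cat_nat (n := size (ore_coef s))) //= [X in _ + X]big_nat_cond.
rewrite [X in _ + X]big1 ?addr0 // => i /andP[/andP[pi _] _].
by rewrite nth_default // linear0 mul0r.
Qed.

Lemma ore_lift_linear : linear ore_lift_fun.
Proof.
move=> c s t.
set n := maxn (size (ore_coef s)) (size (ore_coef t)).
have le_s : (size (ore_coef s) <= n)%N by rewrite leq_maxl.
have le_t : (size (ore_coef t) <= n)%N by rewrite leq_maxr.
rewrite (ore_lift_wide le_s) (ore_lift_wide le_t) (@ore_lift_wide _ n).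
  rewrite scaler_sumr -big_split; apply: eq_bigr => i _.
  by rewrite ore_coefP coefD coefZ mulr_algl linearP mulrDl scalerAl.
rewrite ore_coefP.
apply: (leq_trans (size_polyD _ _)); rewrite geq_max le_t andbT.
exact: leq_trans (size_scale_leq _ _) le_s.
Qed.

Lemma ore_lift_monom r n : ore_lift_fun (iota r * x ^+ n) = f r * y ^+ n.
Proof.
have cE : ore_coef (iota r * x ^+ n) = r *: 'X^n by rewrite -ore_eval_monom ore_evalK.
rewrite (@ore_lift_wide _ n.+1); last first.
  by rewrite cE; apply: (leq_trans (size_scale_leq _ _)); rewrite size_polyXn.
rewrite cE big_ord_recr /= big1 ?add0r => [|i _]; rewrite coefZ coefXn.
  by rewrite eqxx mulr1.
by rewrite ltn_eqF // mulr0 linear0 mul0r.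
Qed.

(** Universal property of an Ore extension for maps that are multiplicative
    modulo an ideal. The normal form [iota r * x ^+ n] leaves no choice for
    [g]; multiplicativity is checked for a left factor [iota r], then [x],
    then a power of [x]. *)
Lemma ore_lift : exists g : {linear S -> F},
  [/\ forall r n, g (iota r * x ^+ n) = f r * y ^+ n,
      forall r, g (iota r) = f r, g x = y
    & forall a b : S, eqI I (g (a * b)) (g a * g b)].
Proof.
pose g : {linear S -> F} :=
  HB.pack ore_lift_fun (GRing.isLinear.Build _ _ _ _ ore_lift_fun ore_lift_linear).
have gm r n : g (iota r * x ^+ n) = f r * y ^+ n by apply: ore_lift_monom.
exists g; split=> // [r||a b].
- by have := gm r 0; rewrite !expr0 !mulr1.
- by have := gm 1 1; rewrite f1 rmorph1 !mul1r !expr1.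
have xr : forall r, x * iota r = iota (sigma r) * x + iota (delta r) by case: ore.
have step_r r t : eqI I (g (iota r * t)) (f r * g t).
  move: t; apply: ore_ind => [|s n].
    split=> [|c u v hu hv]; first by rewrite mulr0 linear0 mulr0; apply: eqI_refl.
    rewrite mulrDr -scalerAr !linearP mulrDr -scalerAr.
    by apply: eqID => //; apply: eqIZ.
  by rewrite mulrA -rmorphM !gm mulrA; apply: eqIMr.
have step_x t : eqI I (g (x * t)) (y * g t).
  move: t; apply: ore_ind => [|s n].
    split=> [|c u v hu hv]; first by rewrite mulr0 linear0 mulr0; apply: eqI_refl.
    rewrite mulrDr -scalerAr !linearP mulrDr -scalerAr.
    by apply: eqID => //; apply: eqIZ.
  rewrite mulrA xr mulrDl -mulrA -exprS linearD !gm mulrA exprS mulrA -mulrDl.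
  by apply: eqIMr => //; apply: eqI_sym => //; apply: compat.
have step_xn n t : eqI I (g (x ^+ n * t)) (y ^+ n * g t).
  elim: n t => [|n IH] t; first by rewrite !expr0 !mul1r; apply: eqI_refl.
  rewrite !exprS -!mulrA; apply: (eqI_trans idI (step_x _)).
  exact: eqIMl.
move: a; apply: ore_ind => [|r n].
  split=> [|c u v hu hv]; first by rewrite mul0r linear0 mul0r; apply: eqI_refl.
  rewrite mulrDl -scalerAl !linearP mulrDl -scalerAl.
  by apply: eqID => //; apply: eqIZ.
rewrite gm -!mulrA; apply: (eqI_trans idI (step_r _ _)).
exact: eqIMl.
Qed.

End Lift.

End OreExtension.

Section OreStep.
Variables (K : fieldType) (R S : algType K).
Variables (sigma : {lrmorphism R -> R}) (delta : {linear R -> R}).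
Variables (iota : {lrmorphism R -> S}) (x : S).
Hypothesis ore : ore_extension sigma delta iota x.

Let coefs := ore_coef ore.

Lemma ore_coef_iota r : coefs (iota r) = r%:P.
Proof. by rewrite -(ore_evalC iota x) /coefs ore_evalK. Qed.

Lemma ore_coef_monom r n : coefs (iota r * x ^+ n) = r *: 'X^n.
Proof. by rewrite -ore_eval_monom /coefs ore_evalK. Qed.

Lemma ore_coef_mul_iota r s : coefs (iota r * s) = r *: coefs s.
Proof. by rewrite -{1}(ore_coefK ore s) ore_mul_iota /coefs ore_evalK. Qed.

Lemma ore_coef_mul_x s : coefs (x * s) = ore_shift sigma delta (coefs s).
Proof. by rewrite -{1}(ore_coefK ore s) (ore_mul_x ore) /coefs ore_evalK. Qed.

Lemma ore_coef_linear i (c : K) s t :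
  (coefs (c *: s + t))`_i = c *: (coefs s)`_i + (coefs t)`_i.
Proof. by rewrite /coefs ore_coefP coefD coefZ mulr_algl. Qed.

Lemma ore_coef0 : coefs 0 = 0.
Proof. by rewrite -(rmorph0 iota) ore_coef_iota polyC0. Qed.

Lemma ore_coefD i s t : (coefs (s + t))`_i = (coefs s)`_i + (coefs t)`_i.
Proof. by rewrite -[s]scale1r ore_coef_linear !scale1r. Qed.

Lemma ore_coefZ i (c : K) s : (coefs (c *: s))`_i = c *: (coefs s)`_i.
Proof. by rewrite -[c *: s]addr0 ore_coef_linear ore_coef0 coef0 addr0. Qed.

Lemma ore_coef_x : coefs x = 'X.
Proof. by have := ore_coef_monom 1 1; rewrite rmorph1 mul1r expr1 scale1r. Qed.

Lemma ore_coef_sum i (J : Type) (r : seq J) (f : J -> S) :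
  (coefs (\sum_(j <- r) f j))`_i = \sum_(j <- r) (coefs (f j))`_i.
Proof.
elim: r => [|j r IH]; first by rewrite !big_nil ore_coef0 coef0.
by rewrite !big_cons -[f j]scale1r ore_coef_linear IH !scale1r.
Qed.

Lemma ore_coef_inj : injective coefs.
Proof. by move=> s t st; rewrite -(ore_coefK ore s) -(ore_coefK ore t) -/coefs st. Qed.

Lemma iter_ore_shift_lead n (q : {poly R}) m : (forall j, (m < j)%N -> q`_j = 0) ->
  (iter n (ore_shift sigma delta) q)`_(n + m) = iter n sigma q`_m /\
  forall j, (n + m < j)%N -> (iter n (ore_shift sigma delta) q)`_j = 0.
Proof.
move=> qm; elim: n => [|n [IH1 IH2]] //=; split=> [|j nmj].
  by rewrite coef_ore_shift addSn IH1 IH2 // linear0 addr0.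
rewrite coef_ore_shift IH2 ?linear0 ?addr0; last by lia.
by case: j nmj => [|j] // nmj; rewrite IH2 ?rmorph0 //; lia.
Qed.

Lemma ore_eval_mul (p q : {poly R}) : ore_eval iota x p * ore_eval iota x q =
  ore_eval iota x (\sum_(i < size p) p`_i *: iter i (ore_shift sigma delta) q).
Proof.
rewrite ore_eval_sum [in LHS]/ore_eval mulr_suml; apply: eq_bigr => i _.
rewrite -ore_mul_iota -mulrA; congr (_ * _).
by elim: (i : nat) => [|n IH]; rewrite ?expr0 ?mul1r // exprS -mulrA IH (ore_mul_x ore).
Qed.

(** The leading coefficient of a product is the leading coefficient of the
    first factor times an image, under a power of the injective map [sigma],
    of the leading coefficient of the second. *)
Lemma ore_domain : injective sigma ->
  (forall a b : R, a * b = 0 -> a = 0 \/ b = 0) ->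
  forall a b : S, a * b = 0 -> a = 0 \/ b = 0.
Proof.
move=> sinj domR a b.
rewrite -(ore_coefK ore a) -(ore_coefK ore b); set p := ore_coef ore a; set q := ore_coef ore b.
rewrite ore_eval_mul -(ore_eval0 iota x) => /(ore_eval_inj ore) /polyP pq0.
have [->|p0] := eqVneq p 0; first by left.
have [->|q0] := eqVneq q 0; first by right.
exfalso.
have := pq0 ((size p).-1 + (size q).-1)%N.
have qm j : ((size q).-1 < j)%N -> q`_j = 0.
  by move=> qj; rewrite nth_default //; apply: leq_trans (leqSpred _) qj.
have sp : (0 < size p)%N by rewrite size_poly_gt0.
rewrite coef0 coef_sum -(prednK sp) big_ord_recr /= big1 => [|i _]; last first.
  rewrite coefZ (iter_ore_shift_lead i qm).2 ?mulr0 // ltn_add2r.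
  exact: ltn_ord.
rewrite add0r coefZ (iter_ore_shift_lead _ qm).1 => /domR[].
  by move/eqP; rewrite -lead_coefE lead_coef_eq0 (negPf p0).
move=> sq0; have : q`_(size q).-1 = 0.
  elim: (size p).-1 sq0 => //= n IH sq0.
  by apply: IH; apply: sinj; rewrite sq0 rmorph0.
by move/eqP; rewrite -lead_coefE lead_coef_eq0 (negPf q0).
Qed.

Section Graded.
Variables (xs : seq (R * nat)) (d : nat).
Hypothesis dxs : forall y e, (y, e) \in xs -> gr xs e (sigma y) /\ gr xs (d + e) (delta y).
Let ys := rcons [seq (iota v.1, v.2) | v <- xs] (x, d).

Lemma gr_iota m a : gr xs m a -> gr ys m (iota a).
Proof.
apply: gr_map => y e yxs; apply: gr_gen.
by rewrite mem_rcons inE; apply/orP; right; apply/mapP; exists (y, e).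
Qed.

Lemma gr_sigma m a : gr xs m a -> gr xs m (sigma a).
Proof. by apply: gr_map => y e /dxs[]. Qed.

Lemma gr_delta m a : gr xs m a -> gr xs (d + m) (delta a).
Proof.
move: m a; apply: gr_ind => [m||y e m a yxs ga IH].
- exact/(@subspace_preim _ _ _ delta)/gr_subspace.
- by rewrite (ore_delta1 ore); apply: lin_span0.
have [sy dy] := dxs yxs; rewrite (ore_deltaM ore); apply: subspaceD.
- exact: gr_subspace.
- by rewrite addnCA; apply: grM.
- by rewrite addnA; apply: grM.
Qed.

(** Since [sigma] is homogeneous of degree 0 and [delta] of degree [d], left
    multiplication by a generator preserves the right-hand condition; so the
    words of weight [m] span no more than the ordered monomials do. *)
Lemma ore_gr m s : gr ys m s <->
  forall k, if (k * d <= m)%N then gr xs (m - k * d) (coefs s)`_k else (coefs s)`_k = 0.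
Proof.
split=> [|sk].
  move: m s; apply: gr_ind => [m||y e m s yys _ IH].
  - split=> [k|c u v hu hv k]; first by rewrite ore_coef0 coef0; case: ifP => // _; apply: lin_span0.
    rewrite ore_coef_linear; have := hu k; have := hv k; case: ifP => _.
      by move=> gv gu; apply: (gr_subspace _ _).2.
    by move=> -> ->; rewrite scaler0 addr0.
  - move=> k; rewrite -(rmorph1 iota) ore_coef_iota coefC.
    case: eqP => [->|k0]; first by rewrite mul0n /=; apply: gr1.
    by case: ifP => // _; apply: lin_span0.
  move: yys; rewrite mem_rcons inE => /orP[/eqP[-> ->]|/mapP[[z f] zxs [-> ->]]] k.
    rewrite ore_coef_mul_x coef_ore_shift.
    have dk : if (k * d <= d + m)%N then gr xs (d + m - k * d) (delta (coefs s)`_k)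
              else delta (coefs s)`_k = 0.
      have := IH k; case: (leqP (k * d) m) => km; last first.
        by move=> ->; rewrite linear0; case: ifP => // _; apply: lin_span0.
      move=> gk; rewrite ifT; last by lia.
      by rewrite -addnBA //; apply: gr_delta.
    case: k dk => [|k] dk; first by rewrite add0r.
    have := IH k; move: dk; rewrite mulSn leq_add2l subnDl; case: ifP => _.
      move=> g1 g2; apply: subspaceD => //; first exact: gr_subspace.
      exact: gr_sigma.
    by move=> -> ->; rewrite rmorph0 addr0.
  rewrite ore_coef_mul_iota coefZ; have := IH k; case: (leqP (k * d) m) => km.
    move=> gk; rewrite ifT; last by lia.
    by rewrite -addnBA //; apply: grM => //; apply: gr_gen.
  by move=> ->; rewrite mulr0; case: ifP => // _; apply: lin_span0.
rewrite -(ore_coefK ore s) /ore_eval; apply: subspace_sum; first exact: gr_subspace.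
move=> i _; have := sk i; case: ifP => [im gi|_ si].
  rewrite -(subnK im); apply: grM; first exact: gr_iota.
  by apply: grX; apply: gr_gen; rewrite mem_rcons mem_head.
by rewrite -/coefs si rmorph0 mul0r; apply: lin_span0.
Qed.

(** By [ore_gr] the piece of degree [m] is the direct sum over [k] of the
    elements [iota a * x ^+ k] with [a] of degree [m - k * d]. The induction
    is on a bound [N] for [k]. *)
Lemma ore_has_dim (h : nat -> nat) m : (0 < d)%N ->
  (forall j, has_dim (gr xs j) (h j)) ->
  has_dim (gr ys m) (sumn [seq h (m - k * d)%N | k <- seq.iota 0 m.+1 & (k * d <= m)%N]).
Proof.
move=> d0 hdim.
pose Q N s := forall k, if (k < N)%N && (k * d <= m)%N then gr xs (m - k * d) (coefs s)`_k
              else (coefs s)`_k = 0.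
have sQ N : is_subspace (Q N).
  split=> [k|c u v hu hv k]; first by rewrite ore_coef0 coef0; case: ifP => // _; apply: lin_span0.
  rewrite ore_coef_linear; have := hu k; have := hv k; case: ifP => _.
    by move=> gv gu; apply: (gr_subspace _ _).2.
  by move=> -> ->; rewrite scaler0 addr0.
have QE s : Q m.+1 s <-> gr ys m s.
  rewrite ore_gr; split=> Qs k; have := Qs k; rewrite ltnS.
    case: (leqP (k * d) m) => km; last by rewrite andbF.
    by rewrite (leq_trans _ km) // leq_pmulr.
  case: (leqP (k * d) m) => km; last by rewrite andbF.
  by rewrite (leq_trans _ km) // leq_pmulr.
apply: has_dim_ext QE _.
elim: m.+1 => [|N IH].
  rewrite /=; apply: has_dim_ext (has_dim0 _) => s; split=> [-> k|sk].
    by rewrite /= ore_coef0 coef0.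
  by apply: ore_coef_inj; rewrite ore_coef0; apply/polyP => k; rewrite coef0; apply: sk.
rewrite -addn1 iotaD add0n filter_cat map_cat sumn_cat /=.
case: (leqP (N * d) m) => Nm /=; last first.
  rewrite addn0; apply: has_dim_ext IH => s; split=> Qs k; have := Qs k.
    rewrite addn1 ltnS [(k <= N)%N]leq_eqVlt; case: eqP => [->|] //=.
    by rewrite ltnn leqNgt Nm.
  rewrite addn1 ltnS [(k <= N)%N]leq_eqVlt; case: eqP => [->|] //=.
  by rewrite ltnn leqNgt Nm.
rewrite addn0 addn1.
have finj : injective (fun r => iota r * x ^+ N).
  move=> r r' /(congr1 coefs); rewrite !ore_coef_monom => /polyP/(_ N).
  by rewrite !coefZ coefXn eqxx !mulr1.
have flin : linear (fun r => iota r * x ^+ N).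
  by move=> c u v; rewrite linearP mulrDl scalerAl.
pose f : {linear R -> S} :=
  HB.pack (fun r => iota r * x ^+ N) (GRing.isLinear.Build _ _ _ _ _ flin).
have dimf := has_dim_map (f := f) finj (hdim (m - N * d)%N).
set P := (fun w => _) in dimf.
have sP : is_subspace P.
  split=> [|c u v [a ga ->] [b gb ->]].
    by exists 0; rewrite ?linear0 //; apply: lin_span0.
  by exists (c *: a + b); rewrite ?linearP //; apply: (gr_subspace _ _).2.
have PQ0 u : Q N u -> P u -> u = 0.
  move=> Qu [r gr_r uE]; have := Qu N; rewrite ltnn /= uE [f r]/= ore_coef_monom.
  rewrite coefZ coefXn eqxx mulr1 => r0.
  by rewrite r0 rmorph0 mul0r.
apply: has_dim_ext (has_dimD (sQ N) sP PQ0 IH dimf) => s.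
split=> [[u [w [Qu [r gr_r ->] ->]]] k|Qs].
  rewrite addrC -[f r]scale1r ore_coef_linear scale1r ore_coef_monom coefZ coefXn.
  have := Qu k; rewrite ltnS; case: (ltngtP k N) => kN /=; rewrite ?mulr0 ?add0r //.
  by rewrite kN Nm mulr1 => ->; rewrite addr0.
exists (s - f (coefs s)`_N), (f (coefs s)`_N); split; last by rewrite subrK.
  move=> k; rewrite addrC -scaleN1r ore_coef_linear ore_coef_monom coefZ coefXn scaleN1r.
  have := Qs k; rewrite ltnS; case: (ltngtP k N) => kN /=; rewrite ?mulr0 ?oppr0 ?add0r //.
  by rewrite kN mulr1 addNr.
by exists (coefs s)`_N => //; have := Qs N; rewrite ltnSn Nm.
Qed.

End Graded.
End OreStep.

(** * Iterated Ore extensions *)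

Section Tower.
Variable K : fieldType.

Lemma tower_domain (A : algType K) (xs : seq (A * nat)) :
  graded_iterated_ore_inj xs -> forall a b : A, a * b = 0 -> a = 0 \/ b = 0.
Proof.
elim=> {A xs} [a b|R S xs sigma delta iota x d _ IH ore sinj _ _]; last exact: ore_domain ore sinj IH.
by move/eqP; rewrite mulf_eq0 => /orP[/eqP|/eqP]; [left|right].
Qed.

Lemma tower_pos (A : algType K) (xs : seq (A * nat)) :
  graded_iterated_ore_inj xs -> forall y, y \in xs -> (0 < y.2)%N.
Proof.
elim=> {A xs} [|R S xs sigma delta iota x d _ IH _ _ d0 _] y //.
by rewrite mem_rcons inE => /orP[/eqP->|/mapP[z /IH zxs ->]].
Qed.

Lemma tower_subalgebra_ind (A : algType K) (xs : seq (A * nat)) :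
  graded_iterated_ore_inj xs -> forall Q : A -> Prop, is_subalgebra Q ->
  (forall y e, (y, e) \in xs -> Q y) -> forall a, Q a.
Proof.
elim=> {A xs} [|R S xs sigma delta iota x d _ IH ore _ _ _] Q sQ Qxs.
  move=> a; have -> : a = a *: (1 : K^o) by rewrite /GRing.scale /= mulr1.
  by case: sQ => sQ Q1 _; apply: subspaceZ.
have Qi (r : R) : Q (iota r).
  apply: (IH (fun r => Q (iota r))); first exact: subalgebra_preim.
  by move=> y e yxs; apply: (Qxs _ e); rewrite mem_rcons inE; apply/orP; right; apply/mapP; exists (y, e).
apply: (ore_subalgebra_ind ore sQ Qi).
by apply: (Qxs _ d); rewrite mem_rcons mem_head.
Qed.

(** The Hilbert function of a polynomial ring with variables of degrees [ds]. *)
Fixpoint hilb (ds : seq nat) (m : nat) : nat :=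
  if ds is d :: ds' then sumn [seq hilb ds' (m - k * d)%N | k <- seq.iota 0 m.+1 & (k * d <= m)%N]
  else (m == 0)%N.

Lemma gr_nil (A : algType K) m (a : A) : gr [::] m a -> (m == 0)%N = false -> a = 0.
Proof.
move=> ga m0; move: a ga; apply: lin_span_min => [|u [w [wxs wm ->]]].
  by split=> // c u v -> ->; rewrite scaler0 addr0.
case: w wxs wm => [_|x w wxs]; last by have := wxs x (mem_head _ _).
by rewrite /word_deg big_nil => /eqP; rewrite eq_sym m0.
Qed.

Lemma tower_has_dim (A : algType K) (xs : seq (A * nat)) :
  graded_iterated_ore_inj xs -> forall m, has_dim (gr xs m) (hilb (rev (unzip2 xs)) m).
Proof.
elim=> {A xs} [|R S xs sigma delta iota x d _ IH ore _ d0 dxs] m.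
  rewrite /=; case: eqP => m0.
    exists (fun=> 1); split=> [_|v gv]; first by rewrite m0; apply: gr1.
    exists [ffun=> v]; split; first by rewrite big_ord1 ffunE /GRing.scale /= mulr1.
    move=> c; rewrite big_ord1 => vE; apply/ffunP => i; rewrite ffunE ord1 vE.
    by rewrite /GRing.scale /= mulr1.
  apply: has_dim_ext (has_dim0 _) => v; split=> [->|/gr_nil]; first exact: lin_span0.
  by apply; apply/eqP.
rewrite /unzip2 map_rcons rev_rcons -map_comp /=.
exact: (ore_has_dim ore dxs _ d0 IH).
Qed.

(** The sum of the graded pieces is direct, because by [ore_gr] the
    coefficients of elements of different degrees have different degrees. *)
Lemma tower_indep (A : algType K) (xs : seq (A * nat)) :
  graded_iterated_ore_inj xs -> forall N (a : nat -> A), (forall m, gr xs m (a m)) ->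
  \sum_(m < N) a m = 0 -> forall m, (m < N)%N -> a m = 0.
Proof.
elim=> {A xs} [|R S xs sigma delta iota x d _ IH ore _ d0 dxs] N a ga a0 m mN.
  have am k : (k == 0)%N = false -> a k = 0 by move/(gr_nil (ga k)).
  case: (eqVneq m 0%N) => m0; last by apply: am; apply/negbTE.
  case: N a0 mN => // N; rewrite big_ord_recl big1 ?addr0; first by rewrite m0.
  by move=> i _; rewrite am.
apply: (ore_coef_inj (ore := ore)); rewrite ore_coef0; apply/polyP => k; rewrite coef0.
pose b j := if (k * d <= j + k * d)%N then (ore_coef ore (a (j + k * d)%N))`_k else 0.
have gb j : gr xs j (b j).
  rewrite /b leq_addl; have /(ore_gr ore dxs)/(_ k) := ga (j + k * d)%N.
  by rewrite leq_addl addnK.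
case: (leqP (k * d) m) => km; last first.
  have /(ore_gr ore dxs)/(_ k) := ga m.
  by rewrite leqNgt km.
have := IH (N - k * d)%N b gb _ (m - k * d)%N; rewrite /b leq_addl subnK //; apply; last by lia.
have := congr1 (fun s => (ore_coef ore s)`_k) a0; rewrite /= ore_coef0 coef0 ore_coef_sum => E.
rewrite -[RHS]E.
rewrite -(big_mkord xpredT (fun i => (ore_coef ore (a i))`_k)).
rewrite (big_cat_nat (n := (k * d)%N)) //=; last by lia.
rewrite [X in _ = X + _]big_nat_cond [X in _ = X + _]big1 ?add0r; last first.
  move=> i /andP[/andP[_ ik] _]; have /(ore_gr ore dxs)/(_ k) := ga i.
  by rewrite leqNgt ik.
transitivity (\sum_(0 + k * d <= i < N) (ore_coef ore (a i))`_k); last by rewrite add0n.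
rewrite big_addn big_mkord; apply: eq_bigr => i _.
by rewrite leq_addl.
Qed.

(** The subalgebra generated by the degree one elements. *)
Definition deg1_span (A : algType K) (xs : seq (A * nat)) : A -> Prop :=
  lin_span (fun p : A => exists s : seq A,
    (forall y, y \in s -> gr xs 1 y) /\ p = \prod_(y <- s) y).

Lemma deg1_span1 (A : algType K) (xs : seq (A * nat)) : deg1_span xs 1.
Proof. by apply: lin_span_id; exists [::]; rewrite big_nil. Qed.

Lemma deg1_spanM (A : algType K) (xs : seq (A * nat)) a b :
  gr xs 1 a -> deg1_span xs b -> deg1_span xs (a * b).
Proof.
move=> ga; move: b; apply: lin_span_min => [|u [s [s1 ->]]].
  exact/subspace_mull/lin_span_subspace.
apply: lin_span_id; exists (a :: s); rewrite big_cons; split=> // y.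
by rewrite inE => /orP[/eqP->|/s1].
Qed.

Lemma deg1_span_ind (A : algType K) (xs : seq (A * nat)) (Q : A -> Prop) :
  is_subspace Q -> Q 1 ->
  (forall a b, gr xs 1 a -> deg1_span xs b -> Q b -> Q (a * b)) ->
  forall a, deg1_span xs a -> Q a.
Proof.
move=> sQ Q1 QM; apply: lin_span_min => // u [s [s1 ->]].
elim: s s1 => [|y s IH] s1; first by rewrite big_nil.
rewrite big_cons; apply: QM.
- by apply: s1; rewrite mem_head.
- by apply: lin_span_id; exists s; split=> // z zs; apply: s1; rewrite inE zs orbT.
- by apply: IH => z zs; apply: s1; rewrite inE zs orbT.
Qed.

Lemma gr_0 (A : algType K) (xs : seq (A * nat)) : (forall y, y \in xs -> (0 < y.2)%N) ->
  forall a, gr xs 0 a -> exists c, a = c%:A.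
Proof.
move=> pos; apply: lin_span_min => [|u [[|[y e] w] [wxs wm ->]]].
- split=> [|c u v [a ->] [b ->]]; first by exists 0; rewrite scale0r.
  by exists (c * a + b); rewrite scalerDl scalerA.
- by exists 1; rewrite scale1r /word_val big_nil.
by move: wm; rewrite /word_deg big_cons /= => wm; have := pos _ (wxs _ (mem_head _ _)) => /=; lia.
Qed.

Lemma gr_1_ind (A : algType K) (xs : seq (A * nat)) : (forall y, y \in xs -> (0 < y.2)%N) ->
  forall Q : A -> Prop, is_subspace Q -> (forall y, (y, 1%N) \in xs -> Q y) ->
  forall a, gr xs 1 a -> Q a.
Proof.
move=> pos Q sQ Qxs; apply: lin_span_min => // u [[|[y e] w] [wxs wm ->]].
  by move: wm; rewrite /word_deg big_nil.
have yxs := wxs _ (mem_head _ _).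
have /= e0 := pos _ yxs.
case: w wxs wm => [|[z f] w] wxs.
  rewrite /word_deg /word_val !big_seq1 /= => e1; apply: Qxs.
  by rewrite -e1.
rewrite /word_deg !big_cons /=; have /= := pos _ (wxs _ (mem_nth (y, e) (isT : (1 < size [:: (y, e), (z, f) & w])%N))).
lia.
Qed.

Lemma gr_2_deg1_span (A : algType K) (xs : seq (A * nat)) :
  (forall y, y \in xs -> (0 < y.2)%N) -> (forall y, y \in xs -> y.2 != 2%N) ->
  forall a, gr xs 2 a -> deg1_span xs a.
Proof.
move=> pos no2; apply: lin_span_min => [|u [w [wxs wm ->]]]; first exact: lin_span_subspace.
apply: lin_span_id; exists (unzip1 w); split; last by rewrite big_map.
move=> y /mapP[[z e] zw ->] /=; have zxs := wxs _ zw.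
suff e1 : e = 1%N by rewrite -e1; apply: gr_gen.
have /= z0 := pos _ zxs; have /= z2 := no2 _ zxs.
have : (e <= 2)%N; last by lia.
by rewrite -wm /word_deg (big_rem _ zw) /= leq_addr.
Qed.

(** Generation in degree one descends along the tower if no variable has
    degree two. A last variable of degree at least three does not occur in the
    degree one elements, hence in no product of them, so it cannot be there.
    If the last variable has degree one, then [delta] sends degree one
    elements to elements of degree two, which are sums of products of degree
    one elements for lack of variables of degree two; therefore all
    coefficients of a product of degree one elements are again such sums. *)
Lemma tower_no_degree_2 (A : algType K) (xs : seq (A * nat)) :
  graded_iterated_ore_inj xs -> (forall y, y \in xs -> y.2 != 2%N) ->
  (forall a, deg1_span xs a) -> forall y, y \in xs -> y.2 = 1%N.
Proof.
elim=> {A xs} [|R S xs sigma delta iota x d tow IH ore _ d0 dxs] // no2.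
set ys := rcons _ _ in no2 * => gen1.
have no2x y : y \in xs -> y.2 != 2%N.
  by move=> yxs; have := no2 (iota y.1, y.2); apply; rewrite mem_rcons inE (map_f (fun v => (iota v.1, v.2))) ?orbT.
have pos := tower_pos tow.
have sub k : is_subspace (fun s => deg1_span xs (ore_coef ore s)`_k).
  split=> [|c u v hu hv]; first by rewrite ore_coef0 coef0; apply: lin_span0.
  by rewrite ore_coef_linear; apply: (lin_span_subspace _).2.
case: (eqVneq d 1%N) => d1; last first.
  have : forall s, deg1_span ys s -> forall k, (0 < k)%N -> (ore_coef ore s)`_k = 0.
    apply: deg1_span_ind => [|k k0|a b /(ore_gr ore dxs) ga _ IHb k k0].
    - split=> [k k0|c u v hu hv k k0]; first by rewrite ore_coef0 coef0.
      by rewrite ore_coef_linear hu // hv // scaler0 addr0.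
    - by rewrite -(rmorph1 iota) ore_coef_iota coefC eqn0Ngt k0.
    have -> : a = iota (ore_coef ore a)`_0.
      apply: (ore_coef_inj (ore := ore)); rewrite ore_coef_iota; apply/polyP => j.
      rewrite coefC; case: eqP => [->|/eqP j0] //; have := ga j.
      by rewrite ifF //; apply/negbTE; rewrite -ltnNge; nia.
    by rewrite ore_coef_mul_iota coefZ IHb // mulr0.
  move=> /(_ x (gen1 _) 1%N isT); have := ore_coef_monom ore 1 1; rewrite rmorph1 mul1r expr1 => ->.
  by rewrite scale1r coefX /= => /eqP; rewrite oner_eq0.
have dspan a : deg1_span xs a -> deg1_span xs (delta a).
  move: a; apply: (deg1_span_ind (Q := fun a => deg1_span xs (delta a))).
  - exact/(@subspace_preim _ _ _ delta)/lin_span_subspace.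
  - by rewrite (ore_delta1 ore); apply: lin_span0.
  move=> b c gb hc IHc; rewrite (ore_deltaM ore); apply: subspaceD.
  - exact: lin_span_subspace.
  - by apply: deg1_spanM => //; apply: (gr_sigma dxs).
  move: (gr_delta ore dxs gb); rewrite d1 => /(gr_2_deg1_span pos no2x).
  move: {gb IHc b} (delta b); apply: (deg1_span_ind (Q := fun b => deg1_span xs (b * c))).
  - exact/subspace_mulr/lin_span_subspace.
  - by rewrite mul1r.
  - by move=> a' b ga' _ IHb; rewrite -mulrA; apply: deg1_spanM.
have sspan a : deg1_span xs a -> deg1_span xs (sigma a).
  move: a; apply: (deg1_span_ind (Q := fun a => deg1_span xs (sigma a))).
  - exact/(@subspace_preim _ _ _ sigma)/lin_span_subspace.
  - by rewrite rmorph1; apply: deg1_span1.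
  by move=> b c gb _ IHc; rewrite rmorphM; apply: deg1_spanM => //; apply: (gr_sigma dxs).
have key s : deg1_span ys s -> forall k, deg1_span xs (ore_coef ore s)`_k.
  move: s; apply: (deg1_span_ind (Q := fun s => forall k, deg1_span xs (ore_coef ore s)`_k)) => [|k|a b /(ore_gr ore dxs) ga _ IHb k].
  - split=> [k|c u v hu hv k]; first exact: (sub k).1.
    exact: (sub k).2.
  - rewrite -(rmorph1 iota) ore_coef_iota coefC; case: eqP => _; last exact: lin_span0.
    exact: deg1_span1.
  have := ga 1%N; rewrite d1 muln1 leqnn subnn => /(gr_0 pos)[c cE].
  have -> : a = iota (ore_coef ore a)`_0 + c *: x.
    apply: (ore_coef_inj (ore := ore)); apply/polyP => j.
    rewrite addrC ore_coef_linear ore_coef_iota coefC.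
    have := ore_coef_monom ore 1 1; rewrite rmorph1 mul1r expr1 => ->.
    rewrite scale1r coefX; case: j => [|[|j]] /=; rewrite ?scaler0 ?add0r ?addr0 //.
    by have := ga j.+2; rewrite ifF // d1 muln1.
  rewrite mulrDl addrC -scalerAl ore_coef_linear; apply: (lin_span_subspace _).2.
    rewrite ore_coef_mul_x coef_ore_shift; apply: subspaceD; first exact: lin_span_subspace.
      by case: k => [|k]; [apply: lin_span0 | apply: sspan].
    exact: dspan.
  rewrite ore_coef_mul_iota coefZ; apply: deg1_spanM => //.
  by have := ga 0%N; rewrite mul0n subn0.
move=> y; rewrite mem_rcons inE => /orP[/eqP->|/mapP[z zxs ->]] //=.
apply: IH => // a; have := key _ (gen1 (iota a)) 0%N.
by rewrite ore_coef_iota coefC.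
Qed.

End Tower.

Lemma scalar_section (K : fieldType) (F : algType K) (I : F -> Prop) : is_ideal I ->
  exists s : {linear K^o -> F}, [/\ forall c, s c = c%:A, s 1 = 1
    & forall a b : K^o, eqI I (s (a * b)) (s a * s b)].
Proof.
move=> idI; have [|s sE] := @linear_of K K^o F (fun c => c%:A).
  by move=> c a b; rewrite scalerDl scalerA.
exists s; split=> [//||a b]; first by rewrite sE scale1r.
by rewrite !sE -scalerAl mul1r scalerA; apply: eqI_refl.
Qed.

Section TowerSection.
Variables (K : fieldType) (F A : algType K).
Variable H : nat -> F -> Prop.
Hypothesis HS : forall m, is_subspace (H m).
Hypothesis H1 : H 0 1.
Hypothesis HM : forall m n a b, H m a -> H n b -> H (m + n) (a * b).
Variables (pi : {lrmorphism F -> A}) (I : F -> Prop).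
Hypothesis idI : is_ideal I.
Hypothesis ker3 : forall m f, (m <= 3)%N -> H m f -> pi f = 0 -> I f.

Lemma homogX m n a : H m a -> H (n * m) (a ^+ n).
Proof.
by move=> Ha; elim: n => [|n IH]; [exact: H1 | rewrite exprS mulSn; apply: HM].
Qed.

(** When any two variables have total degree at most three, the commutation
    rules of the tower have degree at most three. If [I] contains all
    relations of degree at most three, then [ore_lift] applies at each step
    and lifts the tower to [F] multiplicatively modulo [I]. *)
Lemma tower_section (R : algType K) (xs : seq (R * nat)) :
  graded_iterated_ore_inj xs -> forall phi : {lrmorphism R -> A},
  pairwise (fun d e => d + e <= 3)%N (unzip2 xs) ->
  (forall y e, (y, e) \in xs -> exists2 f, H e f & pi f = phi y) ->
  exists s : {linear R -> F},
    [/\ s 1 = 1, forall a b : R, eqI I (s (a * b)) (s a * s b),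
        forall a, pi (s a) = phi a & forall m a, gr xs m a -> H m (s a)].
Proof.
elim=> {R xs} [phi _ _|R S xs sigma delta iota x d tow IH ore _ d0 dxs phi].
  have [s [sE s1 sM]] := scalar_section idI.
  exists s; split=> // [a|m a ga].
    rewrite sE linearZ rmorph1 -(rmorph1 phi) -linearZ /=; congr (phi _).
    by rewrite /GRing.scale /= mulr1.
  case: (eqVneq m 0%N) ga => [-> _|/negbTE m0 /gr_nil/(_ m0) ->].
    by rewrite sE; apply: (subspaceZ _ (HS 0) H1).
  by rewrite linear0; apply: (HS m).1.
rewrite /unzip2 map_rcons -map_comp pairwise_rcons => /andP[dall pw] lifts.
pose psi := [the {lrmorphism R -> A} of phi \o iota].
have [|y e yxs|s [s1 sM pis Hs]] := IH psi.
- by rewrite (eq_map (g := snd)) in pw.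
- have [|f Hf pif] := lifts (iota y) e; last by exists f.
  by rewrite mem_rcons inE; apply/orP; right; apply/mapP; exists (y, e).
have [Y HY piY] : exists2 f, H d f & pi f = phi x.
  by apply: lifts; rewrite mem_rcons mem_head.
have compat r : ore_compatible sigma delta I s Y r.
  move: r; apply: (tower_subalgebra_ind tow).
    exact: (ore_compatible_subalgebra ore).
  move=> y e yxs; have [gs gd] := dxs _ _ yxs.
  have de : (e + d <= 3)%N.
    by move/allP: dall => /(_ e); apply; apply/mapP; exists (y, e).
  apply: (ker3 (m := (d + e)%N)); first by rewrite addnC.
    apply: subspaceB => //; first by apply: HM => //; apply/Hs/gr_gen.
    apply: subspaceD => //; last exact: Hs.
    by rewrite addnC; apply: HM => //; apply: Hs.
  rewrite rmorphB rmorphD !rmorphM /= !pis piY /= -!rmorphM -rmorphD -rmorphB /=.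
  have -> : x * iota y = iota (sigma y) * x + iota (delta y) by case: ore.
  by rewrite subrr rmorph0.
have [g [gm gi gx gM]] := ore_lift ore idI s1 sM compat.
exists g; split=> //.
- by rewrite -(rmorph1 iota) gi.
- move=> a; move: a; apply: (ore_ind ore) => [|r n].
    exact: (@subspace_eq _ _ _ [the {linear S -> A} of pi \o g] phi).
  by rewrite gm !rmorphM !rmorphXn /= pis piY.
move=> m a /(ore_gr ore dxs) ga.
rewrite -(ore_coefK ore a) /ore_eval linear_sum; apply: subspace_sum => // i _.
have := ga i; case: ifP => [im gi'|_ ->].
  rewrite gm -(subnK im); apply: HM; first exact: Hs.
  exact: homogX.
by rewrite rmorph0 mul0r linear0; case: (HS m).
Qed.

End TowerSection.

(** * The flag of degree one variables *)

Section DegOne.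
Variable K : fieldType.

Definition deg1_vars (A : algType K) (xs : seq (A * nat)) : seq A :=
  [seq y.1 | y <- xs & y.2 == 1%N].

Lemma deg1_vars_rcons (R S : algType K) (iota : R -> S) (xs : seq (R * nat)) x d :
  deg1_vars (rcons [seq (iota v.1, v.2) | v <- xs] (x, d)) =
    if d == 1%N then rcons (map iota (deg1_vars xs)) x else map iota (deg1_vars xs).
Proof.
rewrite /deg1_vars filter_rcons /= filter_map -!map_comp.
by case: ifP => _; rewrite ?map_rcons -?map_comp.
Qed.

Lemma deg1_vars_gr (A : algType K) (xs : seq (A * nat)) y : y \in deg1_vars xs -> gr xs 1 y.
Proof.
move=> /mapP[[z e]]; rewrite mem_filter => /andP[/= /eqP-> zxs] ->.
exact: gr_gen.
Qed.

End DegOne.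

Section FlagStep.
Variable K : fieldType.
Variables (R S : algType K) (sigma : {lrmorphism R -> R}) (delta : {linear R -> R}).
Variables (iota : {lrmorphism R -> S}) (x : S).
Hypothesis ore : ore_extension sigma delta iota x.
Variable v : seq R.
Let N := size v.
Let w := rcons (map iota v) x.

Let wl i : (i < N)%N -> w`_i = iota v`_i.
Proof. by move=> iN; rewrite nth_rcons size_map iN (nth_map 0). Qed.

Let wN : w`_N = x.
Proof. by rewrite nth_rcons size_map ltnn eqxx. Qed.

Lemma flag_lin_step (c : nat -> K) : \sum_(i < N.+1) c i *: w`_i = 0 ->
  c N = 0 /\ \sum_(i < N) c i *: v`_i = 0.
Proof.
rewrite big_ord_recr /= wN (eq_bigr (fun i : 'I_N => iota (c i *: v`_i))); last first.
  by move=> i _; rewrite wl // linearZ.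
rewrite -linear_sum addrC; set s := \sum_(i < N) _ => s0.
have cE k : c N *: ('X : {poly R})`_k + (s%:P)`_k = 0.
  have := ore_coef_linear ore k (c N) x (iota s); rewrite s0 ore_coef0 coef0 ore_coef_iota.
  by have := ore_coef_monom ore 1 1; rewrite rmorph1 mul1r expr1 scale1r => -> <-.
split.
  have := cE 1%N; rewrite coefX coefC /= addr0 => /eqP.
  by rewrite scaler_eq0 oner_eq0 orbF => /eqP.
by have := cE 0%N; rewrite coefX coefC /= scaler0 add0r.
Qed.

(** A quadratic expression in the degree one variables has degree at most two
    in the last variable [x]; its coefficients at [x ^+ 2], [x] and 1 vanish
    separately. *)
Lemma flag_quad_step (t : nat -> nat -> K) :
  \sum_(i < N.+1) \sum_(k < N.+1) t i k *: (w`_i * w`_k) = 0 ->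
  [/\ t N N = 0,
      \sum_(i < N) t i N *: v`_i + sigma (\sum_(k < N) t N k *: v`_k) = 0
    & \sum_(i < N) \sum_(k < N) t i k *: (v`_i * v`_k)
        + delta (\sum_(k < N) t N k *: v`_k) = 0].
Proof.
set a := \sum_(i < N) t i N *: _; set q := \sum_(i < N) \sum_(k < N) _.
set b := \sum_(k < N) _.
rewrite big_ord_recr /= (eq_bigr (fun i : 'I_N =>
  iota (\sum_(k < N) t i k *: (v`_i * v`_k)) + iota (t i N *: v`_i) * x)); last first.
  move=> i _; rewrite big_ord_recr /= wl // wN linear_sum linearZ -scalerAl; congr (_ + _).
  by apply: eq_bigr => k _; rewrite wl // linearZ rmorphM.
rewrite big_split /= -mulr_suml -!linear_sum -/q -/a wN.
rewrite big_ord_recr /= wN (eq_bigr (fun k : 'I_N => x * iota (t N k *: v`_k))); last first.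
  by move=> k _; rewrite wl // linearZ scalerAr.
rewrite -mulr_sumr -linear_sum -/b => E.
have cE k : (q%:P)`_k + (a *: ('X : {poly R}))`_k
    + ((ore_shift sigma delta b%:P)`_k + t N N *: ('X^2 : {poly R})`_k) = 0.
  transitivity ((ore_coef ore 0)`_k); last by rewrite ore_coef0 coef0.
  rewrite -E !ore_coefD ore_coefZ ore_coef_mul_x !ore_coef_mul_iota !ore_coef_iota ore_coef_x.
  have := ore_coef_monom ore 1 2; rewrite rmorph1 mul1r expr2 scale1r => ->.
  by [].
have := cE 2%N; have := cE 1%N; have := cE 0%N.
rewrite !coef_ore_shift !coefC !coefZ !coefX !coefXn /= ?mulr0 ?mulr1 ?scaler0 ?linear0 ?add0r ?addr0.
move=> E0 E1 /eqP E2; split=> //.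
  by move: E2; rewrite ?rmorph0 ?add0r scaler_eq0 oner_eq0 orbF => /eqP.
Qed.

End FlagStep.

Section Flags.
Variable K : fieldType.

(** What the quadratic relations [t] among the degree one variables know about
    the order [v] of adjunction. All clauses come from the rule by which x_j
    passes x_k for k < j: the left factors of a relation bound its right
    factors; the last left factor x_j that occurs is not multiplied by itself
    on the right; and it does occur on the right after an earlier variable, as
    [sigma] kills no nonzero linear form. *)
Definition flag_relations (A : algType K) (v : seq A) :=
  (forall c : nat -> K, \sum_(i < size v) c i *: v`_i = 0 ->
     forall i, (i < size v)%N -> c i = 0) /\
  (forall t : nat -> nat -> K,
     \sum_(i < size v) \sum_(k < size v) t i k *: (v`_i * v`_k) = 0 ->
     [/\ forall j, (forall i k, (j <= i < size v)%N -> (k < size v)%N -> t i k = 0) ->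
           forall i k, (i < size v)%N -> (j <= k < size v)%N -> t i k = 0,
         forall j, (j < size v)%N ->
           (forall i k, (j < i < size v)%N -> (k < size v)%N -> t i k = 0) -> t j j = 0
       & forall j, (j < size v)%N ->
           (forall i k, (j < i < size v)%N -> (k < size v)%N -> t i k = 0) ->
           (forall i, (i < j)%N -> t i j = 0) ->
           forall k, (k < size v)%N -> t j k = 0]).

Lemma tower_flag (A : algType K) (xs : seq (A * nat)) :
  graded_iterated_ore_inj xs -> flag_relations (deg1_vars xs).
Proof.
elim=> {A xs} [|R S xs sigma delta iota x d _ IH ore sinj _ _]; first by split=> // t _; split.
rewrite deg1_vars_rcons; move: (deg1_vars xs) IH => v IH.
have [IH1 IH2] := IH.
case: ifP => _; last first.
  split=> [c|t]; rewrite size_map.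
    rewrite (eq_bigr (fun i : 'I_(size v) => iota (c i *: v`_i))) => [|i _]; last first.
      by rewrite (nth_map 0) // linearZ.
    rewrite -linear_sum -(linear0 iota) => /(ore_iota_inj ore); exact: IH1.
  rewrite (eq_bigr (fun i : 'I_(size v) => iota (\sum_(k < size v) t i k *: (v`_i * v`_k)))).
    rewrite -linear_sum -(linear0 iota) => /(ore_iota_inj ore); exact: IH2.
  move=> i _; rewrite linear_sum; apply: eq_bigr => k _.
  by rewrite !(nth_map 0) // linearZ rmorphM.
split=> [c|t]; rewrite size_rcons size_map.
  move=> /(flag_lin_step ore)[cN /IH1 c0] i.
  by rewrite ltnS leq_eqVlt => /orP[/eqP->|/c0].
move=> /(flag_quad_step ore)[tNN tN tQ].
set N := size v in tNN tN tQ IH1 IH2 *.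
have colN : (forall k, (k < N)%N -> t N k = 0) -> forall i, (i < N.+1)%N -> t i N = 0.
  move=> tNk i; rewrite ltnS leq_eqVlt => /orP[/eqP->//|iN].
  apply: (IH1 (fun i => t i N)) => //; rewrite -[RHS]tN [X in sigma X]big1 ?linear0 ?addr0 //.
  by move=> k _; rewrite tNk // scale0r.
have rowN : (forall i, (i < N)%N -> t i N = 0) -> forall k, (k < N.+1)%N -> t N k = 0.
  move=> tiN k; rewrite ltnS leq_eqVlt => /orP[/eqP->//|kN].
  apply: (IH1 (t N)) => //; apply: sinj; rewrite rmorph0 -[RHS]tN [X in _ = X + _]big1 ?add0r //.
  by move=> i _; rewrite tiN // scale0r.
have tQ0 : (forall k, (k < N)%N -> t N k = 0) ->
    \sum_(i < N) \sum_(k < N) t i k *: (v`_i * v`_k) = 0.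
  move=> tNk; rewrite -[RHS]tQ [X in delta X]big1 ?linear0 ?addr0 // => k _.
  by rewrite tNk // scale0r.
split.
- move=> j tj; case: (leqP j N) => jN; last by move=> i k; lia.
  have tNk k : (k < N)%N -> t N k = 0 by move=> kN; apply: tj; lia.
  have [IHA _ _] := IH2 t (tQ0 tNk).
  move=> i k iN /andP[jk]; rewrite ltnS leq_eqVlt => /orP[/eqP->|kN].
    exact: colN.
  move: iN; rewrite ltnS leq_eqVlt => /orP[/eqP->|iN]; first exact: tNk.
  by apply: (IHA j) => // [i' k' ij' kj'|]; [apply: tj; lia | rewrite jk].
- move=> j; rewrite ltnS leq_eqVlt => /orP[/eqP-> //|jN] tj.
  have tNk k : (k < N)%N -> t N k = 0 by move=> kN; apply: tj; lia.
  have [_ IHB _] := IH2 t (tQ0 tNk).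
  by apply: IHB => // i k ij kN; apply: tj; lia.
move=> j; rewrite ltnS leq_eqVlt => /orP[/eqP->|jN] tj tij.
  exact: rowN.
have tNk k : (k < N)%N -> t N k = 0 by move=> kN; apply: tj; lia.
have [_ _ IHC] := IH2 t (tQ0 tNk).
move=> k; rewrite ltnS leq_eqVlt => /orP[/eqP->|kN]; first by apply: colN => //; lia.
by apply: IHC => // i k' ij kN'; apply: tj; lia.
Qed.

Lemma tower_deg1_dim (A : algType K) (xs : seq (A * nat)) :
  graded_iterated_ore_inj xs -> has_dim (gr xs 1) (size (deg1_vars xs)).
Proof.
move=> tow; have [indep _] := tower_flag tow; set v := deg1_vars xs in indep *.
exists (fun i => v`_i); split=> [i|a].
  by apply/deg1_vars_gr/mem_nth.
have spanP : forall a, gr xs 1 a -> exists c : {ffun 'I_(size v) -> K}, a = \sum_i c i *: v`_i.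
  apply: (gr_1_ind (tower_pos tow)) => [|y yxs].
    split=> [|c b b' [e ->] [e' ->]].
      by exists [ffun=> 0]; rewrite big1 // => i _; rewrite ffunE scale0r.
    exists [ffun i => c * e i + e' i]; rewrite scaler_sumr -big_split.
    by apply: eq_bigr => i _; rewrite ffunE scalerDl scalerA.
  have yv : y \in v by apply/mapP; exists (y, 1%N) => //; rewrite mem_filter eqxx.
  have iv : (index y v < size v)%N by rewrite index_mem.
  exists [ffun i => (i == Ordinal iv)%:R]; rewrite (bigD1 (Ordinal iv)) //= big1 ?addr0.
    by rewrite ffunE eqxx scale1r nth_index.
  by move=> i /negbTE ni; rewrite ffunE ni scale0r.
move=> /spanP[c aE]; exists c; split=> // c' aE'; apply/ffunP => i.
pose e (j : nat) := if insub j is Some j' then c j' - c' j' else 0.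
have eE (j : 'I_(size v)) : e j = c j - c' j by rewrite /e valK.
have := indep e _ i (ltn_ord i); rewrite eE => e0; apply/eqP; rewrite -subr_eq0 e0 //.
rewrite (eq_bigr (fun i : 'I_(size v) => c i *: v`_i - c' i *: v`_i)); last first.
  by move=> j _; rewrite eE scalerBl.
by rewrite sumrB -aE -aE' subrr.
Qed.

End Flags.

(** * Overlaps of quadratic relations *)

Section CubicBound.
Variable K : fieldType.
Local Notation T1 := 'rV[K]_4.
Local Notation T2 := 'M[K]_4.

(** The third tensor power of [K^4] as a family of matrices: [T i] is the
    slice with first index [i], so that left multiplication by a variable
    fills one slice. *)
Definition tensor3 := {ffun 'I_4 -> 'M[K]_4}.
Local Notation T3 := tensor3.

Definition slice1 (i : 'I_4) (T : T3) : T2 := T i.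
Definition slice3 (k : 'I_4) (T : T3) : T2 := \matrix_(i, j) T i j k.

Lemma slice1_linear i : linear (slice1 i).
Proof. by move=> c T U; rewrite /slice1 !ffunE. Qed.
HB.instance Definition _ i :=
  GRing.isLinear.Build K T3 T2 *:%R (slice1 i) (slice1_linear i).

Lemma slice3_linear k : linear (slice3 k).
Proof. by move=> c T U; apply/matrixP => i j; rewrite !mxE !ffunE !mxE. Qed.
HB.instance Definition _ k :=
  GRing.isLinear.Build K T3 T2 *:%R (slice3 k) (slice3_linear k).

(** With V = [K^4], this is V tensor R, and [rel_mul_var] is R tensor V. *)
Definition var_mul_rel (R : {vspace T2}) : {vspace T3} :=
  (\bigcap_i (linfun (slice1 i) @^-1: R))%VS.
Definition rel_mul_var (R : {vspace T2}) : {vspace T3} :=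
  (\bigcap_k (linfun (slice3 k) @^-1: R))%VS.

Lemma memv_bigcap (V : vectType K) (I : finType) (P : pred I) (U : I -> {vspace V}) v :
  (v \in (\bigcap_(i | P i) U i)%VS) = [forall (i | P i), v \in U i].
Proof. by apply/subv_bigcapP/forall_inP. Qed.

Lemma mem_var_mul_rel R T : (T \in var_mul_rel R) = [forall i, T i \in R].
Proof.
rewrite memv_bigcap; apply: eq_forallb => i /=.
by rewrite -memv_preim lfunE.
Qed.

Lemma mem_rel_mul_var R T : (T \in rel_mul_var R) = [forall k, slice3 k T \in R].
Proof.
rewrite memv_bigcap; apply: eq_forallb => i /=.
by rewrite -memv_preim lfunE.
Qed.

Definition rowL (i : 'I_4) : 'Hom(T2, T1) := linfun (row i).
Definition colL (k : 'I_4) : 'Hom(T2, T1) := linfun (row k \o trmx).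

Lemma rowLE i t : rowL i t = row i t. Proof. exact: lfunE. Qed.
Lemma colLE k t j : colL k t 0 j = t j k. Proof. by rewrite lfunE /= !mxE. Qed.

Definition coord1 (k : 'I_4) (u : T1) : K^o := u 0 k.
Lemma coord1_linear k : linear (coord1 k).
Proof. by move=> c u v; rewrite /coord1 !mxE. Qed.
HB.instance Definition _ k :=
  GRing.isLinear.Build K T1 K^o *:%R (coord1 k) (coord1_linear k).

(** The hypotheses [RA], [RB] and [RC] are the three clauses of
    [flag_relations]; [RD] says that no product of two nonzero linear forms is
    a relation, which holds in a domain. *)
Variable R : {vspace T2}.
Hypothesis RA : forall t, t \in R -> forall j : nat,
  (forall i k : 'I_4, (j <= i)%N -> t i k = 0) -> forall i k : 'I_4, (j <= k)%N -> t i k = 0.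
Hypothesis RB : forall t, t \in R -> forall j : 'I_4,
  (forall i k : 'I_4, (j < i)%N -> t i k = 0) -> t j j = 0.
Hypothesis RC : forall t, t \in R -> forall j : 'I_4,
  (forall i k : 'I_4, (j < i)%N -> t i k = 0) ->
  (forall i : 'I_4, (i < j)%N -> t i j = 0) -> forall k, t j k = 0.
Hypothesis RD : forall u v : T1, u^T *m v \in R -> u = 0 \/ v = 0.
Hypothesis dimR : \dim R = 5%N.

(** The relations whose left factors are among the first [j] variables; their
    last rows form the spaces [D j]. *)
Let Rle (j : nat) : {vspace T2} := (R :&: \bigcap_(i < 4 | (j <= i)%N) lker (rowL i))%VS.

Lemma mem_Rle j t : reflect (t \in R /\ forall i k : 'I_4, (j <= i)%N -> t i k = 0) (t \in Rle j).
Proof.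
rewrite memv_cap memv_bigcap; apply: (iffP andP) => -[tR h]; split=> //.
  move=> i k ji; move/forall_inP: h => /(_ i ji).
  by rewrite memv_ker rowLE => /eqP/rowP/(_ k); rewrite !mxE.
apply/forall_inP => i ji; rewrite memv_ker rowLE; apply/eqP/rowP => k.
by rewrite !mxE h.
Qed.

Let D (j : 'I_4) : {vspace T1} := (rowL j @: Rle j.+1)%VS.

Lemma dim_RleS (j : 'I_4) : \dim (Rle j.+1) = (\dim (Rle j) + \dim (D j))%N.
Proof.
rewrite -(limg_ker_dim (rowL j)); congr (\dim _ + _)%N.
apply/vspaceP => t; rewrite memv_cap memv_ker rowLE.
apply/andP/mem_Rle => [[/mem_Rle[tR h] /eqP t0]|[tR h]]; split=> //.
- move=> i k; rewrite leq_eqVlt => /orP[/eqP ji|/h //].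
  by move/rowP/(_ k): t0; rewrite !mxE (val_inj ji : j = i).
- by apply/mem_Rle; split=> // i k ji; apply: h; apply: ltnW.
by apply/eqP/rowP => k; rewrite !mxE h.
Qed.

Lemma mem_D (j : 'I_4) u (k : 'I_4) : u \in D j -> (j <= k)%N -> u 0 k = 0.
Proof.
move=> /memv_imgP[t /mem_Rle[tR h] ->] jk; rewrite rowLE mxE.
move: jk; rewrite leq_eqVlt => /orP[/eqP jk|jk]; last exact: (RA tR h).
by rewrite -(val_inj jk : j = k); apply: (RB tR) => i l ji; apply: h.
Qed.

Lemma dim_initial (U : {vspace T1}) (j : nat) :
  (forall u (k : 'I_4), u \in U -> (j <= k)%N -> u 0 k = 0) -> (\dim U <= j)%N.
Proof.
move=> Uj; pose s := [seq (delta_mx 0 k : T1) | k <- filter (fun k : 'I_4 => (k < j)%N) (enum 'I_4)].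
have sU : (U <= <<s>>)%VS.
  apply/subvP => u uU; rewrite (row_sum_delta u); apply: memv_suml => k _.
  case: (leqP j k) => kj; first by rewrite (Uj u k) // scale0r mem0v.
  by apply/memvZ/memv_span/map_f; rewrite mem_filter kj mem_enum.
apply: leq_trans (dimvS sU) _; apply: leq_trans (dim_span _) _.
rewrite size_map size_filter.
have -> : count (fun k : 'I_4 => (k < j)%N) (enum 'I_4) = count (fun i => i < j)%N (iota 0 4).
  by rewrite -val_enum_ord count_map.
by move: {Uj s sU} j; do 4?case=> //.
Qed.

Lemma dim_D j : (\dim (D j) <= j)%N.
Proof. by apply: dim_initial => u k; apply: mem_D. Qed.

Lemma dim_Rle4 : \dim (Rle 4) = 5%N.
Proof.
rewrite -dimR; congr (\dim _); apply/vspaceP => t.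
by apply/mem_Rle/idP => [[]//|tR]; split=> // i k; rewrite leqNgt ltn_ord.
Qed.

Lemma dim_Rle0 : \dim (Rle 0) = 0%N.
Proof.
apply/eqP; rewrite dimv_eq0 -subv0; apply/subvP => t /mem_Rle[_ t0].
by rewrite memv0; apply/eqP/matrixP => i k; rewrite mxE t0.
Qed.

Let X : {vspace T3} := (var_mul_rel R :&: rel_mul_var R)%VS.
(** The same filtration on the overlaps, by the first tensor factor, with the
    spaces [E j] of last slices. *)
Let Xle (j : nat) : {vspace T3} :=
  (X :&: \bigcap_(i < 4 | (j <= i)%N) lker (linfun (slice1 i)))%VS.

Lemma mem_Xle j T : reflect (T \in X /\ forall i : 'I_4, (j <= i)%N -> T i = 0) (T \in Xle j).
Proof.
rewrite /Xle memv_cap memv_bigcap; apply: (iffP andP) => -[tR h]; split=> //.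
  move=> i ji; move/forall_inP: h => /(_ i ji).
  by rewrite memv_ker lfunE => /eqP.
by apply/forall_inP => i ji; rewrite memv_ker lfunE; apply/eqP/h.
Qed.

Let E (j : 'I_4) : {vspace T2} := (linfun (slice1 j) @: Xle j.+1)%VS.

Lemma dim_XleS (j : 'I_4) : \dim (Xle j.+1) = (\dim (Xle j) + \dim (E j))%N.
Proof.
rewrite -(limg_ker_dim (linfun (slice1 j))); congr (\dim _ + _)%N.
apply/vspaceP => t; rewrite memv_cap memv_ker lfunE.
apply/andP/mem_Xle => [[/mem_Xle[tR h] /eqP t0]|[tR h]]; split=> //.
- move=> i; rewrite leq_eqVlt => /orP[/eqP ji|/h //].
  by rewrite -(val_inj ji : j = i).
- by apply/mem_Xle; split=> // i ji; apply: h; apply: ltnW.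
by apply/eqP/h.
Qed.

Lemma mem_E (j : 'I_4) t : t \in E j ->
  t \in Rle j /\ forall k, colL k t \in D j.
Proof.
case/memv_imgP => T /mem_Xle[]; rewrite memv_cap mem_var_mul_rel mem_rel_mul_var.
case/andP => /forallP TR /forallP TL Tj ->; rewrite lfunE /= /slice1.
have colD k : colL k (T j) \in D j.
  apply/memv_imgP; exists (slice3 k T); last first.
    by apply/rowP => i; rewrite rowLE colLE !mxE.
  by apply/mem_Rle; split=> // i l ji; rewrite mxE Tj // mxE.
split=> //; apply/mem_Rle; split=> // i k ji.
by rewrite -colLE; apply: (mem_D (colD k)).
Qed.

Lemma dim_le1 (V : vectType K) (U : {vspace V}) : (\dim U <= 1)%N -> exists w, U = <[w]>%VS.
Proof.
case: (eqVneq U 0%VS) => [-> _|U0 U1].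
  by exists 0; apply/esym/eqP; rewrite -dimv_eq0 dim_vline eqxx.
exists (vpick U); apply/esym/eqP; rewrite eqEdim -memvE memv_pick /=.
by rewrite dim_vline vpick0 U0.
Qed.

(** Such a relation is a product of two linear forms. *)
Lemma rank_one_columns (D1 : {vspace T1}) t : (\dim D1 <= 1)%N -> t \in R ->
  (forall k, colL k t \in D1) -> t = 0.
Proof.
move=> /dim_le1[w ->] tR tw.
have [r tE] : exists r : T1, t = w^T *m r.
  have rk k : exists c, colL k t == c *: w by have /vlineP[c ->] := tw k; exists c.
  exists (\row_k xchoose (rk k)); apply/matrixP => i k.
  rewrite mxE big_ord1 !mxE; have /eqP/rowP/(_ i) := xchooseP (rk k).
  by rewrite colLE mxE mulrC.
move: tR; rewrite tE => /RD[->|->]; first by rewrite trmx0 mul0mx.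
by rewrite mulmx0.
Qed.

(** Let r_j, d_j and e_j be the dimensions of [Rle j], [D j] and [E j]. Then
    r_(j+1) = r_j + d_j with d_j <= j and r_4 = 5, while the space in question
    has dimension e_0 + e_1 + e_2 + e_3 with e_j <= r_j. Hence e_0 = e_1 = 0,
    and (d_1, d_2, d_3) is one of (0, 2, 3), (1, 1, 3), (1, 2, 2), where r_3 =
    d_1 + d_2 and r_2 = d_1. In the first two cases e_3 <= r_3 = 2, and e_2 =
    0: in the first because r_2 = 0, in the second because d_2 = 1 and all
    columns of an element of [E j] lie in [D j] ([rank_one_columns]). In the
    last case e_2 <= r_2 = 1 and it remains to see that e_3 <= 1. *)
Lemma dim_cubic_overlap : (\dim (var_mul_rel R :&: rel_mul_var R)%VS <= 2)%N.
Proof.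
pose o i (H : (i < 4)%N) : 'I_4 := Ordinal H.
pose o0 := o 0%N isT; pose o1 := o 1%N isT; pose o2 := o 2%N isT; pose o3 := o 3%N isT.
have ER j : (E j <= Rle j)%VS by apply/subvP => t /mem_E[].
have Ej j : (\dim (E j) <= \dim (Rle j))%N := dimvS (ER j).
have := dim_RleS o0; have := dim_RleS o1; have := dim_RleS o2; have := dim_RleS o3.
have := dim_D o0; have := dim_D o1; have := dim_D o2; have := dim_D o3.
have := dim_XleS o0; have := dim_XleS o1; have := dim_XleS o2; have := dim_XleS o3.
have := Ej o0; have := Ej o1; have := Ej o2; have := Ej o3.
rewrite /= dim_Rle0 dim_Rle4.
have -> : Xle 4 = X.
  apply/vspaceP => T; apply/mem_Xle/idP => [[]//|TX]; split=> // i.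
  by rewrite leqNgt ltn_ord.
have -> : \dim (Xle 0) = 0%N.
  apply/eqP; rewrite dimv_eq0 -subv0; apply/subvP => T /mem_Xle[_ T0].
  by rewrite memv0; apply/eqP/ffunP => i; rewrite ffunE T0.
rewrite -/X.
have E2 : (\dim (D o2) <= 1)%N -> \dim (E o2) = 0%N.
  move=> D21; apply/eqP; rewrite dimv_eq0 -subv0; apply/subvP => t /mem_E[/mem_Rle[tR _] tD].
  by rewrite memv0; apply/eqP; apply: rank_one_columns D21 tR tD.
have E3 : (\dim (D o3) <= 2)%N -> (\dim (Rle 2) <= 1)%N -> (\dim (E o3) <= 1)%N.
  move=> D32 R21.
  have [D3le|D3nle] := boolP (E o3 <= Rle 2)%VS; first exact: leq_trans (dimvS D3le) R21.
  (* Some relation in [E o3] has a nonzero row [o2], so [D o3] is not contained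
     in the kernel of coordinate [o2] and [D'] is at most a line. Column [o2] of
     an element of [E o3] lies in [D'], by [RB]; if it vanishes then so does row
     [o2], by [RC], all columns lie in [D'], and the element is zero. *)
  pose D' := (D o3 :&: lker (linfun (coord1 o2)))%VS.
  have D'P u : (u \in D') = (u \in D o3) && (u 0 o2 == 0).
    by rewrite memv_cap memv_ker lfunE.
  have D'1 : (\dim D' <= 1)%N.
    rewrite -ltnS; apply: leq_trans D32; rewrite -(limg_ker_dim (linfun (coord1 o2)) (D o3)) -/D'.
    rewrite -[X in (X <= _)%N]addn1 leq_add2l lt0n dimv_eq0; apply: contraNneq D3nle => im0.
    apply/subvP => t /mem_E[/mem_Rle[tR t3] tD]; apply/mem_Rle; split=> // i k.
    rewrite leq_eqVlt => /orP[/eqP i2|]; last exact: t3.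
    have -> : i = o2 by apply: val_inj.
    have := memv_img (linfun (coord1 o2)) (tD k); rewrite im0 memv0 lfunE => /eqP.
    by rewrite /= /coord1 colLE.
  rewrite -(limg_ker_dim (colL o2) (E o3)).
  have -> : (E o3 :&: lker (colL o2) = 0)%VS.
    apply/eqP; rewrite -subv0; apply/subvP => t; rewrite memv_cap memv_ker memv0.
    case/andP => /mem_E[/mem_Rle[tR t3] tD] /eqP col0; apply/eqP.
    apply: (rank_one_columns D'1 (tR)) => k; rewrite D'P tD colLE; apply/eqP.
    apply: (RC (tR) (j := o2)) => [i l|i _]; first exact: t3.
    by rewrite -colLE col0 mxE.
  rewrite dimv0 add0n; apply: leq_trans D'1; apply: dimvS.
  apply/subvP => _ /memv_imgP[t /mem_E[/mem_Rle[tR t3] tD] ->].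
  by rewrite D'P tD colLE; apply/eqP/(RB tR) => i l; apply: t3.
lia.
Qed.

End CubicBound.

(** * Free algebras *)

(** The freeness of [F] on [y] is used only through these properties. The
    functionals [cf s], which read off the coefficient of the word [s], are
    part of the data because homogeneity and independence are statements about
    them. *)
Record free_on (K : fieldType) (b : nat) (F : algType K) (y : 'I_b -> F)
    (cf : seq 'I_b -> F -> K) := FreeOn {
  free_coef_linear : forall s c f g, cf s (c *: f + g) = c * cf s f + cf s g;
  free_coef_word : forall s t, cf s (\prod_(i <- t) y i) = (t == s)%:R;
  free_expand : forall f, exists r : seq (seq 'I_b),
    uniq r /\ f = \sum_(s <- r) cf s f *: \prod_(i <- s) y i;
  free_eval : forall (A : algType K) (a : 'I_b -> A),
    exists ev : {lrmorphism F -> A}, forall i, ev (y i) = a i }.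

Section FreeAlgebra.
Variables (K : fieldType) (b : nat) (F : algType K) (fvar : 'I_b -> F).
Variable wcoef : seq 'I_b -> F -> K.
Hypothesis fr : free_on fvar wcoef.
Implicit Types (s t : seq 'I_b) (f g : F).

Definition word s : F := \prod_(i <- s) fvar i.

Lemma wcoef_linear s c f g : wcoef s (c *: f + g) = c * wcoef s f + wcoef s g.
Proof. exact: free_coef_linear fr s c f g. Qed.

Lemma wcoefD s f g : wcoef s (f + g) = wcoef s f + wcoef s g.
Proof. by have := wcoef_linear s 1 f g; rewrite scale1r mul1r. Qed.

Lemma wcoef0 s : wcoef s 0 = 0.
Proof. by apply: (addrI (wcoef s 0)); rewrite -wcoefD !addr0. Qed.

Lemma wcoefZ s c f : wcoef s (c *: f) = c * wcoef s f.
Proof. by have := wcoef_linear s c f 0; rewrite wcoef0 !addr0. Qed.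

Lemma wcoef_sum s (J : Type) (r : seq J) (P : pred J) (G : J -> F) :
  wcoef s (\sum_(i <- r | P i) G i) = \sum_(i <- r | P i) wcoef s (G i).
Proof. exact: (big_morph (wcoef s) (wcoefD s) (wcoef0 s)). Qed.

Lemma wcoef_word s t : wcoef s (word t) = (t == s)%:R.
Proof. exact: free_coef_word. Qed.

Lemma word_cat s t : word (s ++ t) = word s * word t.
Proof. by rewrite /word big_cat. Qed.

Lemma word_nil : word [::] = 1.
Proof. by rewrite /word big_nil. Qed.

Lemma word1 i : word [:: i] = fvar i.
Proof. by rewrite /word big_seq1. Qed.

Lemma free_ind (Q : F -> Prop) : is_subspace Q -> (forall s, Q (word s)) -> forall f, Q f.
Proof.
move=> sQ Qw f; have [r [_ ->]] := free_expand fr f.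
by apply: subspace_sum => // s _; apply: subspaceZ => //; apply: Qw.
Qed.

Lemma free_ext f g : (forall s, wcoef s f = wcoef s g) -> f = g.
Proof.
move=> fg; apply/eqP; rewrite -subr_eq0; apply/eqP.
have [r [_ ->]] := free_expand fr (f - g); apply: big1 => s _.
by rewrite addrC -scaleN1r wcoef_linear fg mulN1r addNr scale0r.
Qed.

Lemma wcoef_var_mul i j s f :
  wcoef (i :: s) (fvar j * f) = (j == i)%:R * wcoef s f.
Proof.
move: f; apply: free_ind => [|t].
  split=> [|c f g hf hg]; first by rewrite mulr0 !wcoef0 mulr0.
  by rewrite mulrDr -scalerAr !wcoef_linear hf hg mulrDr mulrCA.
by rewrite -word1 -word_cat !wcoef_word eqseq_cons -natrM mulnb.
Qed.

Lemma wcoef_mul_var i j s f :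
  wcoef (rcons s i) (f * fvar j) = (j == i)%:R * wcoef s f.
Proof.
move: f; apply: free_ind => [|t].
  split=> [|c f g hf hg]; first by rewrite mul0r !wcoef0 mulr0.
  by rewrite mulrDl -scalerAl !wcoef_linear hf hg mulrDr mulrCA.
by rewrite -word1 -word_cat !wcoef_word cats1 eqseq_rcons andbC -natrM mulnb.
Qed.

Lemma wcoef_two_sided m s t f : wcoef m (word s * f * word t) != 0 ->
  exists2 u, m = s ++ u ++ t & wcoef u f != 0.
Proof.
pose u := take (size m - size s - size t) (drop (size s) m).
have -> : wcoef m (word s * f * word t) = (m == s ++ u ++ t)%:R * wcoef u f.
  move: f; apply: free_ind => [|r].
    split=> [|c f g hf hg]; first by rewrite mulr0 mul0r !wcoef0 mulr0.
    rewrite mulrDr mulrDl -scalerAr -scalerAl !wcoef_linear hf hg mulrDr.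
    by rewrite mulrCA.
  rewrite -!word_cat !wcoef_word -natrM mulnb -catA; congr (nat_of_bool _)%:R.
  apply/eqP/andP => [mE|[/eqP mE /eqP rE]]; last by rewrite rE.
  suff uE : u = r by rewrite uE mE !eqxx.
  have sz : (size m - size s - size t)%N = size r by rewrite -mE !size_cat; lia.
  by rewrite /u sz -mE drop_size_cat // take_size_cat.
case: (eqVneq m (s ++ u ++ t)) => [mE|_]; last by rewrite mul0r eqxx.
by rewrite mul1r => uf; exists u.
Qed.

Definition homog (m : nat) f : Prop := forall s, wcoef s f != 0 -> size s = m.

Lemma homog_subspace m : is_subspace (homog m).
Proof.
split=> [|c f g hf hg] s; first by rewrite wcoef0 eqxx.
rewrite wcoef_linear; case: (eqVneq (wcoef s f) 0) => [->|/hf -> //].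
by rewrite mulr0 add0r; apply: hg.
Qed.

Lemma homog_word s : homog (size s) (word s).
Proof. by move=> t; rewrite wcoef_word; case: (eqVneq s t) => [->|]; rewrite ?eqxx. Qed.

Lemma homog1 : homog 0 (1 : F).
Proof. by rewrite -word_nil; apply: homog_word. Qed.

Lemma homog_var i : homog 1 (fvar i).
Proof. by rewrite -word1; exact: homog_word. Qed.

Lemma homog_ind m (Q : F -> Prop) : is_subspace Q -> (forall s, size s = m -> Q (word s)) ->
  forall f, homog m f -> Q f.
Proof.
move=> sQ Qw f fm; have [r [_ fE]] := free_expand fr f.
rewrite fE; apply: subspace_sum => // s _.
have [->|/fm sm] := eqVneq (wcoef s f) 0; first by rewrite scale0r; case: sQ.
by apply: subspaceZ => //; apply: Qw.
Qed.

Lemma homogM m n f g : homog m f -> homog n g -> homog (m + n) (f * g).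
Proof.
move=> hf hg; move: f hf; apply: homog_ind => [|s <-].
  exact/subspace_mulr/homog_subspace.
move: g hg; apply: homog_ind => [|t <-].
  exact/subspace_mull/homog_subspace.
by rewrite -word_cat -size_cat; apply: homog_word.
Qed.

Definition component (m : nat) f : F :=
  \sum_(s <- projT1 (cid (free_expand fr f)) | size s == m) wcoef s f *: word s.

Lemma wcoef_component m s f : wcoef s (component m f) = if size s == m then wcoef s f else 0.
Proof.
rewrite /component; case: cid => r /= [ur fE].
have cE P : wcoef s (\sum_(t <- r | P t) wcoef t f *: word t) =
    \sum_(t <- r | P t && (t == s)) wcoef t f.
  rewrite wcoef_sum big_mkcondr; apply: eq_bigr => t _.
  by rewrite wcoefZ wcoef_word; case: eqP; rewrite ?mulr1 ?mulr0.
rewrite cE; have {fE} := congr1 (wcoef s) fE; rewrite (cE xpredT) /= => fE.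
case: ifP => sm.
  rewrite [RHS]fE; apply: eq_bigl => t.
  by case: (eqVneq t s) => [->|]; rewrite ?sm ?andbF ?andbT.
by rewrite big_pred0 // => t; case: (eqVneq t s) => [->|]; rewrite ?sm ?andbF ?andbT.
Qed.

Lemma component_linear m c f g : component m (c *: f + g) = c *: component m f + component m g.
Proof.
apply: free_ext => s; rewrite wcoef_linear !wcoef_component wcoef_linear.
by case: ifP; rewrite ?mulr0 ?addr0.
Qed.

Lemma homog_component m f : homog m (component m f).
Proof. by move=> s; rewrite wcoef_component; case: (size s =P m) => //; rewrite eqxx. Qed.

Lemma component_homog m n f : homog m f -> component n f = if m == n then f else 0.
Proof.
move=> fm; apply: free_ext => s; rewrite wcoef_component.
have [f0|/fm ->] := eqVneq (wcoef s f) 0; last by case: ifP; rewrite ?wcoef0.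
by rewrite f0; case: ifP; case: ifP; rewrite ?f0 ?wcoef0.
Qed.

Lemma component_sum f : exists N, forall n, (N <= n)%N -> f = \sum_(m < n) component m f.
Proof.
have [r [_ fE]] := free_expand fr f.
exists (\max_(s <- r) size s).+1 => n Nn; apply: free_ext => s.
rewrite wcoef_sum (eq_bigr (fun m : 'I_n => if size s == m then wcoef s f else 0)); last first.
  by move=> m _; rewrite wcoef_component.
have [f0|f0] := eqVneq (wcoef s f) 0.
  by rewrite f0 big1 // => i _; case: ifP.
have sr : s \in r.
  apply: contraNT f0 => sr; rewrite fE wcoef_sum big_seq big1 // => t tr.
  rewrite wcoefZ wcoef_word; case: eqP => [ts|_]; last by rewrite mulr0.
  by rewrite -ts tr in sr.
have sn : (size s < n)%N.
  by apply: leq_trans Nn; rewrite ltnS; apply: leq_bigmax_seq.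
rewrite (bigD1 (Ordinal sn)) //= eqxx big1 ?addr0 // => i.
by rewrite -val_eqE /= eq_sym => /negbTE->.
Qed.

End FreeAlgebra.

Section GeneratedIdeals.
Variables (K : fieldType) (F : algType K).
Implicit Types (G H : seq F).

Lemma two_sided_ideal_is_ideal G : is_ideal (two_sided_ideal G).
Proof.
split=> [|a u|a u]; first exact: lin_span_subspace.
- move: u; apply: lin_span_min => [|u [v [g [w [gG ->]]]]].
    exact/subspace_mull/lin_span_subspace.
  by apply: lin_span_id; exists (a * v), g, w; rewrite !mulrA.
- move: u; apply: lin_span_min => [|u [v [g [w [gG ->]]]]].
    exact/subspace_mulr/lin_span_subspace.
  by apply: lin_span_id; exists v, g, (w * a); rewrite !mulrA.
Qed.

Lemma two_sided_ideal_gen G g : g \in G -> two_sided_ideal G g.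
Proof. by move=> gG; apply: lin_span_id; exists 1, g, 1; rewrite mul1r mulr1. Qed.

Lemma two_sided_ideal_min G (I : F -> Prop) : is_ideal I -> (forall g, g \in G -> I g) ->
  forall f, two_sided_ideal G f -> I f.
Proof.
move=> [sI IL IR] GI; apply: lin_span_min => // u [v [g [w [gG ->]]]].
by apply/IR/IL/GI.
Qed.

Lemma minimal_generating_irredundant G (I : F -> Prop) g :
  minimal_generating_set G I -> g \in G ->
  ~ two_sided_ideal [seq h <- G | h != g] g.
Proof.
move=> [_ Ggen Gmin] gG gI.
suff /(_ g gG) : {subset G <= [seq h <- G | h != g]} by rewrite mem_filter eqxx.
apply: Gmin => [h|f]; first by rewrite mem_filter => /andP[].
rewrite (Ggen f); split; apply: two_sided_ideal_min.
- exact: two_sided_ideal_is_ideal.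
- move=> h hG; case: (eqVneq h g) => [->//|hg].
  by apply: two_sided_ideal_gen; rewrite mem_filter hg.
- exact: two_sided_ideal_is_ideal.
by move=> h; rewrite mem_filter => /andP[_]; apply: two_sided_ideal_gen.
Qed.

Section Homogeneous.
Variables (b : nat) (fvar : 'I_b -> F) (wcoef : seq 'I_b -> F -> K).
Hypothesis fr : free_on fvar wcoef.
Local Notation homog := (homog wcoef).
Local Notation word := (word fvar).

(** Projecting an expression of a homogeneous element of the ideal to its
    component of degree [m] keeps exactly the terms [s * g * t] of total
    degree [m]. *)
Lemma two_sided_ideal_homog_ind G (hd : F -> nat) m (Q : F -> Prop) :
  (forall g, g \in G -> homog (hd g) g) -> is_subspace Q ->
  (forall s g t, g \in G -> (size s + hd g + size t)%N = m -> Q (word s * g * word t)) ->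
  forall f, two_sided_ideal G f -> homog m f -> Q f.
Proof.
move=> Ghd sQ Qw f fG fm; have := component_homog fr m fm; rewrite eqxx => <-.
pose C f := Q (component fr m f).
have sC : is_subspace C.
  split=> [|c u v hu hv]; last by rewrite /C component_linear; apply: sQ.2.
  rewrite /C (_ : component fr m 0 = 0); first by case: sQ.
  by apply: (free_ext fr) => s; rewrite wcoef_component (wcoef0 fr) if_same.
move: f fG {fm}; apply: (lin_span_min sC) => _ [u [g [v [gG ->]]]].
move: u; apply: (free_ind fr) => [|s].
  split=> [|c u u' hu hu']; first by rewrite !mul0r; apply: sC.1.
  by rewrite !mulrDl -!scalerAl; apply: sC.2.
move: v; apply: (free_ind fr) => [|t].
  split=> [|c u u' hu hu']; first by rewrite !mulr0; apply: sC.1.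
  by rewrite !mulrDr -!scalerAr; apply: sC.2.
have hw : homog (size s + hd g + size t) (word s * g * word t).
  apply: (homogM fr); last exact: (homog_word fr).
  by apply: (homogM fr); [exact: (homog_word fr) | exact: Ghd].
rewrite /C (component_homog fr m hw); case: eqP => [|_]; first exact: Qw.
by case: sQ.
Qed.

End Homogeneous.
End GeneratedIdeals.

Lemma span_ind (K : fieldType) (V : vectType K) (s : seq V) (Q : V -> Prop) :
  is_subspace Q -> (forall v, v \in s -> Q v) -> forall v, v \in <<s>>%VS -> Q v.
Proof.
move=> sQ Qs v; rewrite -[s]/(tval (in_tuple s)) => /coord_span ->.
by apply: subspace_sum => // i _; apply: subspaceZ => //; apply/Qs/mem_nth.
Qed.

(** Irredundance is a condition on one element at a time, against all the
    others; it is what [minimal_generating_set] provides, and it amounts to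
    independence modulo [Q]. *)
Lemma dim_irredundant (K : fieldType) (V : vectType K) (T : eqType) (f : T -> V)
    (Q : {vspace V}) (s : seq T) : uniq s ->
  (forall x, x \in s -> f x \notin (Q + <<map f [seq y <- s | y != x]>>)%VS) ->
  \dim (Q + <<map f s>>)%VS = (\dim Q + size s)%N.
Proof.
elim: s => [|x s IH] /= => [_ _|/andP[xs us] nf]; first by rewrite span_nil addv0 addn0.
rewrite span_cons addvA [(Q + _)%VS]addvC -addvA addnS -IH //; last first.
  move=> y ys; apply: contra (nf y _); last by rewrite inE ys orbT.
  apply/subvP; apply: addvS => //; apply: sub_span => z /mapP[w ws ->].
  by apply: map_f; case: ifP => //; rewrite inE ws orbT.
have fx := nf x (mem_head _ _); rewrite eqxx /= in fx.
have sE : [seq y <- s | y != x] = s.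
  by apply/all_filterP/allP => y ys; apply: contraNneq xs => <-.
rewrite sE in fx; rewrite dimv_disjoint_sum; last first.
  apply/eqP; rewrite -subv0; apply/subvP => v; rewrite memv_cap => /andP[/vlineP[c ->] cf].
  rewrite memv0; case: (eqVneq c 0) => [->|c0]; first by rewrite scale0r.
  by case/negP: fx; rewrite -[f x](scalerK c0); apply: memvZ.
rewrite dim_vline; case: eqP fx => [->|_ _]; last by rewrite addnC addn1.
by rewrite mem0v.
Qed.

Section Tensors.
Variables (K : fieldType) (F : algType K) (fvar : 'I_4 -> F) (wcoef : seq 'I_4 -> F -> K).
Hypothesis fr : free_on fvar wcoef.
Local Notation homog := (homog wcoef).
Local Notation word := (word fvar).

(** The maps [tau2] and [tau3] identify tensors with the homogeneous elements
    of degree two and three of the free algebra, with inverses [kappa2] and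
    [kappa3]. *)
Definition tau2 (t : 'M[K]_4) : F := \sum_i \sum_j t i j *: (fvar i * fvar j).
Definition tau3 (T : tensor3 K) : F := \sum_i fvar i * tau2 (T i).
Definition kappa2 (f : F) : 'M[K]_4 := \matrix_(i, j) wcoef [:: i; j] f.
Definition kappa3 (f : F) : tensor3 K := [ffun i => \matrix_(j, k) wcoef [:: i; j; k] f].

Lemma tau2_linear : linear tau2.
Proof.
move=> c t u; rewrite /tau2 scaler_sumr -big_split; apply: eq_bigr => i _.
rewrite scaler_sumr -big_split; apply: eq_bigr => j _.
by rewrite !mxE scalerDl scalerA.
Qed.
HB.instance Definition _ := GRing.isLinear.Build K 'M[K]_4 F *:%R tau2 tau2_linear.

Lemma tau3_linear : linear tau3.
Proof.
move=> c t u; rewrite /tau3 scaler_sumr -big_split; apply: eq_bigr => i _.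
by rewrite !ffunE linearP mulrDr scalerAr.
Qed.
HB.instance Definition _ := GRing.isLinear.Build K (tensor3 K) F *:%R tau3 tau3_linear.

Lemma kappa2_linear : linear kappa2.
Proof. by move=> c f g; apply/matrixP => i j; rewrite !mxE (wcoef_linear fr). Qed.
HB.instance Definition _ := GRing.isLinear.Build K F 'M[K]_4 *:%R kappa2 kappa2_linear.

Lemma kappa3_linear : linear kappa3.
Proof.
by move=> c f g; apply/ffunP => i; apply/matrixP => j k; rewrite !ffunE !mxE (wcoef_linear fr).
Qed.
HB.instance Definition _ := GRing.isLinear.Build K F (tensor3 K) *:%R kappa3 kappa3_linear.

Lemma homog_tau2 t : homog 2 (tau2 t).
Proof.
have sH := homog_subspace fr 2.
apply: (subspace_sum _ sH) => i _; apply: (subspace_sum _ sH) => j _.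
apply: (subspaceZ _ sH).
by apply: (homogM fr (m := 1) (n := 1)); apply: (homog_var fr).
Qed.

Lemma homog_tau3 T : homog 3 (tau3 T).
Proof.
apply: (subspace_sum _ (homog_subspace fr 3)) => i _.
by apply: (homogM fr (m := 1) (n := 2)); [apply: (homog_var fr) | apply: homog_tau2].
Qed.

Lemma tau2K t : kappa2 (tau2 t) = t.
Proof.
apply/matrixP => i j; rewrite mxE /tau2 (wcoef_sum fr) (bigD1 i) //= [X in _ + X]big1 ?addr0 => [|i' ni].
  rewrite (wcoef_sum fr) (bigD1 j) //= [X in _ + X]big1 ?addr0 => [|j' nj].
    by rewrite (wcoefZ fr) -!(word1 fvar) -word_cat (wcoef_word fr) eqxx mulr1.
  by rewrite (wcoefZ fr) (wcoef_var_mul fr) -(word1 fvar) (wcoef_word fr) eqseq_cons (negPf nj) !mulr0.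
rewrite (wcoef_sum fr) big1 // => j' _.
by rewrite (wcoefZ fr) (wcoef_var_mul fr) (negPf ni) mul0r mulr0.
Qed.

Lemma kappa3_var_mul i f l : kappa3 (fvar i * f) l = (i == l)%:R *: kappa2 f.
Proof. by apply/matrixP => j k; rewrite ffunE !mxE (wcoef_var_mul fr). Qed.

Lemma kappa3_mul_var k f l : slice3 l (kappa3 (f * fvar k)) = (k == l)%:R *: kappa2 f.
Proof.
by apply/matrixP => i j; rewrite !mxE ffunE mxE -[[:: i; j; l]]/(rcons [:: i; j] l) (wcoef_mul_var fr).
Qed.

Lemma tau3K T : kappa3 (tau3 T) = T.
Proof.
rewrite /tau3 linear_sum; apply/ffunP => l; rewrite sum_ffunE (bigD1 l) //= [X in _ + X]big1 ?addr0.
  by rewrite kappa3_var_mul eqxx scale1r tau2K.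
by move=> i ni; rewrite kappa3_var_mul (negPf ni) scale0r.
Qed.

Lemma kappa2K f : homog 2 f -> tau2 (kappa2 f) = f.
Proof.
move: f; apply: (homog_ind fr) => [|s sz].
  by split=> [|c f g hf hg]; rewrite ?linear0 // !linearP /= hf hg.
have [i [j ->]] : exists i j, s = [:: i; j] by case: s sz => [|i [|j []]] // _; exists i, j.
have -> : word [:: i; j] = tau2 (delta_mx i j).
  rewrite /tau2 (bigD1 i) //= [X in _ + X]big1 ?addr0 => [|i' ni].
    rewrite (bigD1 j) //= [X in _ + X]big1 ?addr0 => [|j' nj].
      by rewrite mxE !eqxx scale1r -!(word1 fvar) -word_cat.
    by rewrite mxE (negPf nj) andbF scale0r.
  by rewrite big1 // => j' _; rewrite mxE (negPf ni) scale0r.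
by rewrite tau2K.
Qed.

Lemma kappa3K f : homog 3 f -> tau3 (kappa3 f) = f.
Proof.
move: f; apply: (homog_ind fr) => [|s sz].
  by split=> [|c f g hf hg]; rewrite ?linear0 // !linearP /= hf hg.
have [i [t [-> st]]] : exists i t, s = i :: t /\ size t = 2%N.
  by case: s sz => // i t [st]; exists i, t.
rewrite -cat1s word_cat word1 /tau3 (bigD1 i) //= [X in _ + X]big1 ?addr0 => [|i' ni].
  by rewrite kappa3_var_mul eqxx scale1r kappa2K //; have := @homog_word _ _ _ _ _ fr t; rewrite st.
by rewrite kappa3_var_mul eq_sym (negPf ni) scale0r linear0 mulr0.
Qed.

Lemma tau3_slice3 T : tau3 T = \sum_k tau2 (slice3 k T) * fvar k.
Proof.
rewrite -[LHS]kappa3K; last exact: homog_tau3.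
rewrite tau3K -[RHS]kappa3K; last first.
  apply: (subspace_sum _ (homog_subspace fr 3)) => i _.
  by apply: (homogM fr (m := 2) (n := 1)); [apply: homog_tau2 | apply: (homog_var fr)].
congr (tau3 _); apply/ffunP => i; apply/matrixP => j l; rewrite linear_sum sum_ffunE summxE.
have sE (T' : tensor3 K) : T' i j l = slice3 l T' i j by rewrite mxE.
rewrite (bigD1 l) //= [X in _ + X]big1 ?addr0 => [|k nk].
  by rewrite [RHS]sE kappa3_mul_var eqxx scale1r tau2K mxE.
by rewrite [LHS]sE kappa3_mul_var (negPf nk) scale0r mxE.
Qed.

End Tensors.

Lemma lrmorphism_of (K : fieldType) (A B : lalgType K) (f : A -> B) :
  linear f -> f 1 = 1 -> {morph f : x y / x * y} -> exists g : {lrmorphism A -> B}, g =1 f.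
Proof.
move=> fl f1 fM.
pose g : {lrmorphism A -> B} := HB.pack f (GRing.isLinear.Build _ _ _ _ f fl)
  (GRing.isMonoidMorphism.Build _ _ f (f1, fM)).
by exists g.
Qed.

Lemma malg_scalerAr (K : fieldType) (M : monomType) (c : K) (f g : {malg K[M]}) :
  c *: (f * g) = f * (c *: g).
Proof.
rewrite (monalgE f) !mulr_suml scaler_sumr.
apply: eq_bigr => k _; rewrite (monalgE g) mulr_sumr !scaler_sumr mulr_sumr.
apply: eq_bigr => k' _.
have zU d a (w : M) : d *: << a *g w >> = << d * a *g w >>.
  by apply/malgP => u; rewrite mcoeffZ !mcoeffU mulrnAr.
by rewrite !malgM_def zU !fgmulUU zU mulrCA.
Qed.

(** The same ring as [free_alg], whose declared structure of a left algebra is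
    completed to that of an algebra. *)
Definition free_algebra (K : fieldType) (b : nat) : algType K :=
  HB.pack (GRing.Lalgebra.sort (free_alg K b))
    (GRing.Lalgebra_isAlgebra.Build K (free_alg K b) (@malg_scalerAr K {fmonom 'I_b})).

Section ConcreteFree.
Variables (K : fieldType) (b : nat).
Local Notation F := (free_alg K b).

Lemma malg_word (s : seq 'I_b) : \prod_(i <- s) free_var K i = << FMonom s >>.
Proof.
elim: s => [|i s IH]; first by rewrite big_nil -fmoneE.
rewrite big_cons IH /free_var malgM_def fgmulUU mulr1; congr (<< _ >>).
by rewrite fmuE; apply: fmmulE.
Qed.

Lemma malgU_scale (c : K) (s : seq 'I_b) : << c *g FMonom s >> = c *: << FMonom s >> :> F.
Proof. by apply/malgP => u; rewrite mcoeffZ !mcoeffU mulr_natr. Qed.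

Lemma malg_eval (A : algType K) (a : 'I_b -> A) :
  exists ev : {lrmorphism F -> A}, forall i, ev (free_var K i) = a i.
Proof.
pose h (w : {fmonom 'I_b}) : A := \prod_(i <- fmonom_val w) a i.
have hM : mmorphism h.
  split=> [u v|]; last by rewrite /h fm1 big_nil.
  by rewrite /h fmM big_cat.
pose hm : {mmorphism {fmonom 'I_b} -> A} := HB.pack h (monalg.isMultiplicative.Build _ _ h hM).
pose ev := @mmap _ K A (in_alg A) hm.
have evM : multiplicative ev.
  apply: commr_mmap_is_multiplicative => g m m'.
  by rewrite /GRing.comm /= mulr_algl mulr_algr.
have evL : linear ev.
  move=> c f g; rewrite /ev mmapD mmapZ.
  by rewrite /= mulr_algl.
have [ev' evE] := lrmorphism_of evL evM.2 evM.1.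
exists ev' => i; rewrite evE /ev /free_var mmapU /= scale1r mul1r /h.
by rewrite fmU big_seq1.
Qed.

Lemma free_alg_free_on :
  @free_on K b (free_algebra K b) (@free_var K b) (fun s f => mcoeff (FMonom s) f).
Proof.
split.
- move=> s c f g; have -> : c *: f + g = (c *: (f : F) + (g : F))%R :> F by [].
  by rewrite mcoeffD mcoeffZ.
- move=> s t; have := malg_word t => /(congr1 (mcoeff (FMonom s))).
  by rewrite mcoeffU1.
- move=> f; exists (map (@fmonom_val _) (msupp (f : F))); split.
    by rewrite map_inj_uniq ?fset_uniq // => -[u] [v] /= ->.
  rewrite big_map {1}(monalgE (f : F)); apply: eq_bigr => -[s] _.
  by rewrite malg_word malgU_scale.
exact: malg_eval.
Qed.

Lemma free_homogE m (f : F) :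
  free_homog m f <-> @homog K b (free_algebra K b) (fun s f => mcoeff (FMonom s) f) m f.
Proof.
split=> [/allP fm s|fm]; first by rewrite mcoeff_neq0 => /fm /eqP.
by apply/allP => -[s]; rewrite -mcoeff_neq0 => /fm /eqP.
Qed.
End ConcreteFree.

(** * Counting relations *)

Lemma sorted_two_three (l : seq nat) : sorted leq l -> all (fun m => (m == 2) || (m == 3))%N l ->
  l = nseq (count_mem 2%N l) 2%N ++ nseq (count_mem 3%N l) 3%N.
Proof.
elim: l => [|m l IH] //= pl /andP[m23 l23].
have lE := IH (path_sorted pl) l23.
case/orP: m23 => /eqP mE; rewrite mE /=; first by rewrite {1}lE.
suff l2 : count_mem 2%N l = 0%N by rewrite {1}lE l2.
apply/eqP; rewrite -leqn0 leqNgt -has_count; apply/hasPn => n nl /=.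
have /(order_path_min leq_trans)/allP/(_ n nl) := pl; rewrite mE.
by case: n nl => [|[|[|n]]].
Qed.

Section RelationCount.
Variables (K : fieldType) (F : algType K) (fvar : 'I_4 -> F) (wcoef : seq 'I_4 -> F -> K).
Hypothesis fr : free_on fvar wcoef.
Local Notation homog := (homog wcoef).
Local Notation word := (word fvar).
Local Notation tau2 := (tau2 fvar).
Local Notation tau3 := (tau3 fvar).
Local Notation kappa2 := (kappa2 wcoef).
Local Notation kappa3 := (kappa3 wcoef).
Variables (A : algType K) (pi : {lrmorphism F -> A}).
Hypothesis ker01 : forall m f, (m <= 1)%N -> homog m f -> pi f = 0 -> f = 0.
Variables (R : {vspace 'M[K]_4}) (Ker3 : {vspace tensor3 K}).
Hypothesis memR : forall t, (t \in R) = (pi (tau2 t) == 0).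
Hypothesis dimR : \dim R = 5%N.
Hypothesis memKer3 : forall T, (T \in Ker3) = (pi (tau3 T) == 0).
Hypothesis dimKer3 : \dim Ker3 = 40%N.
Hypothesis ker_gen : forall I : F -> Prop, is_ideal I ->
  (forall m f, (m <= 3)%N -> homog m f -> pi f = 0 -> I f) -> forall f, pi f = 0 -> I f.

Lemma pi_tau2 t : t \in R -> pi (tau2 t) = 0.
Proof. by rewrite memR => /eqP. Qed.

Lemma var_mul_rel_ker T : T \in var_mul_rel R -> pi (tau3 T) = 0.
Proof.
rewrite mem_var_mul_rel => /forallP TR; rewrite /tau3 linear_sum big1 // => i _.
by rewrite rmorphM /= pi_tau2 ?mulr0.
Qed.

Lemma rel_mul_var_ker T : T \in rel_mul_var R -> pi (tau3 T) = 0.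
Proof.
rewrite mem_rel_mul_var => /forallP TR; rewrite (tau3_slice3 fr) linear_sum big1 // => i _.
by rewrite rmorphM /= pi_tau2 ?mul0r.
Qed.

Lemma dim_var_mul_rel : \dim (var_mul_rel R) = 20%N.
Proof.
pose f (u : {ffun 'I_4 -> subvs_of R}) : tensor3 K := [ffun i => vsval (u i)].
have fl : linear f by move=> c u v; apply/ffunP => i; rewrite !ffunE linearP.
pose fL : {linear _ -> _} := HB.pack f (GRing.isLinear.Build _ _ _ _ f fl).
have finj : lker (linfun fL) == 0%VS.
  apply/lker0P => u v; rewrite !lfunE /= => /ffunP uv; apply/ffunP => i.
  by have := uv i; rewrite !ffunE => /val_inj.
have -> : var_mul_rel R = limg (linfun fL).
  apply/vspaceP => T; rewrite mem_var_mul_rel; apply/forallP/memv_imgP => [TR|[u _ ->] i].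
    exists [ffun i => Subvs (TR i)]; rewrite ?memvf // lfunE.
    by apply/ffunP => i; rewrite !ffunE.
  by rewrite lfunE ffunE; apply: subvsP.
rewrite limg_dim_eq; last by rewrite (eqP finj) capv0.
by rewrite dimvf /dim /= card_ord (_ : dim _ = \dim R) ?dimR.
Qed.

Lemma dim_rel_mul_var : \dim (rel_mul_var R) = 20%N.
Proof.
pose f (u : {ffun 'I_4 -> subvs_of R}) : tensor3 K :=
  [ffun i => \matrix_(j, k) (vsval (u k) : 'M_4) i j].
have fl : linear f.
  by move=> c u v; apply/ffunP => i; apply/matrixP => j k; rewrite !ffunE !mxE !ffunE linearP !mxE.
pose fL : {linear _ -> _} := HB.pack f (GRing.isLinear.Build _ _ _ _ f fl).
have fE u k : slice3 k (f u) = vsval (u k).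
  by apply/matrixP => i j; rewrite mxE ffunE mxE.
have finj : lker (linfun fL) == 0%VS.
  apply/lker0P => u v; rewrite !lfunE /= => uv; apply/ffunP => k.
  by apply: val_inj; rewrite /= -!fE uv.
have -> : rel_mul_var R = limg (linfun fL).
  apply/vspaceP => T; rewrite mem_rel_mul_var; apply/forallP/memv_imgP => [TR|[u _ ->] k].
    exists [ffun k => Subvs (TR k)]; rewrite ?memvf // lfunE.
    apply/ffunP => i; apply/matrixP => j k.
    by rewrite ffunE mxE ffunE /= mxE.
  by rewrite lfunE /= fE; apply: subvsP.
rewrite limg_dim_eq; last by rewrite (eqP finj) capv0.
by rewrite dimvf /dim /= card_ord (_ : dim _ = \dim R) ?dimR.
Qed.

Variables (l : seq nat) (G : seq F).
Hypothesis Gmin : minimal_generating_set G (fun f => pi f = 0).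
Hypothesis sizeG : size l = size G.
Hypothesis homogG : forall i, (i < size G)%N -> homog (nth 0%N l i) G`_i.

Let hd (g : F) := nth 0%N l (index g G).
Let ideal H := two_sided_ideal (H : seq F).

Lemma homog_hd g : g \in G -> homog (hd g) g.
Proof. by move=> gG; rewrite -{2}(nth_index 0 gG); apply: homogG; rewrite index_mem. Qed.

Lemma degrees_hd : l = map hd G.
Proof.
have [uG _ _] := Gmin.
apply: (@eq_from_nth _ 0%N) => [|i il]; first by rewrite size_map.
by rewrite (nth_map 0) -?sizeG // /hd index_uniq -?sizeG.
Qed.

Lemma kerG g : g \in G -> pi g = 0.
Proof.
by case: Gmin => _ Ggen _ gG; apply/Ggen/two_sided_ideal_gen.
Qed.

Lemma irredundantG g : g \in G -> ~ ideal [seq h <- G | h != g] g.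
Proof. exact: minimal_generating_irredundant Gmin. Qed.

(** The kernel vanishes in degrees 0 and 1, and a generator of degree at least
    four is redundant because the kernel is generated by its elements of
    degree at most three. *)
Lemma hd_bounds g : g \in G -> (hd g == 2)%N || (hd g == 3)%N.
Proof.
move=> gG.
have g0 : g != 0.
  apply/eqP => g0; apply: (irredundantG gG); rewrite g0.
  by case: (two_sided_ideal_is_ideal [seq h <- G | h != 0]) => -[].
have : (2 <= hd g)%N.
  rewrite ltnNge; apply/negP => hd1; case/eqP: g0.
  exact: ker01 hd1 (homog_hd gG) (kerG gG).
have : (hd g <= 3)%N; last by case: (hd g) => [|[|[|[|]]]].
rewrite leqNgt; apply/negP => hd3.
apply: (irredundantG gG).
have : ideal [seq h <- G | (hd h <= 3)%N] g.
  apply: ker_gen (kerG gG); first exact: two_sided_ideal_is_ideal.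
  move=> m f m3 fm f0; have fG : ideal G f by case: Gmin => _ /(_ f)[+ _] _; apply.
  apply: (two_sided_ideal_homog_ind fr (hd := hd) homog_hd _ _ fG fm).
    exact: lin_span_subspace.
  move=> s h t hG szE; have [_ IL IR] := two_sided_ideal_is_ideal [seq h <- G | (hd h <= 3)%N].
  apply/IR/IL/two_sided_ideal_gen; rewrite mem_filter hG andbT.
  by apply: leq_trans m3; rewrite -szE; lia.
apply: two_sided_ideal_min; first exact: two_sided_ideal_is_ideal.
move=> h; rewrite mem_filter => /andP[h3 hG]; apply: two_sided_ideal_gen.
by rewrite mem_filter hG andbT; apply: contraTneq h3 => ->; rewrite -ltnNge.
Qed.

Let G2 := [seq g <- G | hd g == 2%N].
Let G3 := [seq g <- G | hd g == 3%N].

Lemma span_G2 : <<map kappa2 G2>>%VS = R.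
Proof.
apply/eqP; rewrite eqEsubv; apply/andP; split.
  apply/span_subvP => _ /mapP[g + ->]; rewrite mem_filter => /andP[/eqP g2 gG].
  by rewrite memR (kappa2K fr) ?(kerG gG) //; have := homog_hd gG; rewrite g2.
apply/subvP => t tR; case: Gmin => _ /(_ (tau2 t))[+ _] _.
move=> /(_ (pi_tau2 tR)) tG.
suff key : forall f, ideal G f -> homog 2 f -> kappa2 f \in <<map kappa2 G2>>%VS.
  by have := key _ tG (@homog_tau2 _ _ _ _ fr t); rewrite (tau2K fr).
apply: (two_sided_ideal_homog_ind fr (hd := hd) (Q := fun f => kappa2 f \in <<map kappa2 G2>>%VS)
  homog_hd).
  split=> [|c f g hf hg]; first by rewrite (_ : kappa2 0 = 0) ?mem0v //; apply/matrixP => i j; rewrite !mxE (wcoef0 fr).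
  by rewrite (kappa2_linear fr); apply: memvD => //; apply: memvZ.
move=> s g u gG szE.
have g2 : (2 <= hd g)%N by case/orP: (hd_bounds gG) => /eqP->.
have [s0 [u0 hg]] : s = [::] /\ u = [::] /\ hd g = 2%N.
  case: s szE => [|x s]; last by move=> /= szE; exfalso; lia.
  case: u => [|x u] /= szE; last by exfalso; lia.
  by do !split; lia.
rewrite s0 u0 word_nil mul1r mulr1; apply/memv_span/map_f.
by rewrite mem_filter hg gG.
Qed.

Lemma size_G2 : size G2 = 5%N.
Proof.
have [uG _ _] := Gmin.
have := @dim_irredundant K _ F kappa2 0%VS G2; rewrite add0v span_G2 dimR dimv0 add0n.
move=> <- //; first exact: filter_uniq.
move=> g; rewrite mem_filter => /andP[/eqP g2 gG].
apply/negP => gs; apply: (irredundantG gG); set H := [seq h <- G | h != g].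
rewrite add0v in gs.
have g2h : homog 2 g by have := homog_hd gG; rewrite g2.
rewrite -(kappa2K fr g2h).
move: (kappa2 g) gs => {g2h}; apply: span_ind.
  have [sI _ _] := two_sided_ideal_is_ideal H.
  exact: (@subspace_preim _ _ _ tau2 _ sI).
move=> _ /mapP[h + ->]; rewrite !mem_filter => /andP[hg /andP[/eqP h2 hG]].
have h2h : homog 2 h by have := homog_hd hG; rewrite h2.
by rewrite (kappa2K fr h2h); apply: two_sided_ideal_gen; rewrite mem_filter hg.
Qed.

Lemma ideal_tau2 H t : {subset G2 <= H} -> t \in R -> ideal H (tau2 t).
Proof.
move=> GH; rewrite -span_G2; move: t; apply: span_ind.
  have [sI _ _] := two_sided_ideal_is_ideal H.
  exact: (@subspace_preim _ _ _ tau2 _ sI).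
move=> _ /mapP[h hG2 ->]; have := hG2; rewrite mem_filter => /andP[/eqP h2 hG].
have h2h : homog 2 h by have := homog_hd hG; rewrite h2.
by rewrite (kappa2K fr h2h); apply/two_sided_ideal_gen/GH.
Qed.

Lemma ideal_var_mul_rel H T : {subset G2 <= H} -> T \in var_mul_rel R -> ideal H (tau3 T).
Proof.
move=> GH; rewrite mem_var_mul_rel => /forallP TR.
have [sI IL _] := two_sided_ideal_is_ideal H.
by apply: subspace_sum => // i _; apply/IL/ideal_tau2.
Qed.

Lemma ideal_rel_mul_var H T : {subset G2 <= H} -> T \in rel_mul_var R -> ideal H (tau3 T).
Proof.
move=> GH; rewrite mem_rel_mul_var => /forallP TR.
have [sI _ IR] := two_sided_ideal_is_ideal H.
by rewrite (tau3_slice3 fr); apply: subspace_sum => // i _; apply/IR/ideal_tau2.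
Qed.

Let Q3 := (var_mul_rel R + rel_mul_var R)%VS.

Lemma span_G3 : (Q3 + <<map kappa3 G3>>)%VS = Ker3.
Proof.
apply/eqP; rewrite eqEsubv; apply/andP; split.
  rewrite !subv_add; apply/andP; split; first (apply/andP; split).
  - by apply/subvP => T /var_mul_rel_ker T0; rewrite memKer3 T0.
  - by apply/subvP => T /rel_mul_var_ker T0; rewrite memKer3 T0.
  apply/span_subvP => _ /mapP[g + ->]; rewrite mem_filter => /andP[/eqP g3 gG].
  by rewrite memKer3 (kappa3K fr) ?(kerG gG) //; have := homog_hd gG; rewrite g3.
apply/subvP => T; rewrite memKer3 => /eqP T0; case: Gmin => _ /(_ (tau3 T))[+ _] _.
move=> /(_ T0) TG.
suff key : forall f, ideal G f -> homog 3 f -> kappa3 f \in (Q3 + <<map kappa3 G3>>)%VS.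
  by have := key _ TG (@homog_tau3 _ _ _ _ fr T); rewrite (tau3K fr).
apply: (two_sided_ideal_homog_ind fr (hd := hd)
  (Q := fun f => kappa3 f \in (Q3 + <<map kappa3 G3>>)%VS) homog_hd).
  split=> [|c f g hf hg]; last by rewrite (kappa3_linear fr); apply: memvD => //; apply: memvZ.
  rewrite (_ : kappa3 0 = 0) ?mem0v //; apply/ffunP => i; apply/matrixP => j k.
  by rewrite !ffunE !mxE (wcoef0 fr).
have kap2 g : g \in G -> hd g = 2%N -> kappa2 g \in R.
  move=> gG g2; rewrite -span_G2; apply/memv_span/map_f.
  by rewrite mem_filter g2 eqxx.
move=> s g u gG szE; case/orP: (hd_bounds gG) => /eqP hg.
  have [[x [sE uE]]|[x [sE uE]]] :
      (exists x, s = [:: x] /\ u = [::]) \/ (exists x, s = [::] /\ u = [:: x]).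
    case: s szE => [|x [|y s]]; last by move=> /= szE; exfalso; lia.
      case: u => [|x [|y u]] /= szE; try by exfalso; lia.
      by right; exists x.
    case: u => [|z u] /= szE; last by exfalso; lia.
    by left; exists x.
  - rewrite sE uE word1 word_nil mulr1; apply: (subvP (addvSl _ _)); apply: (subvP (addvSl _ _)).
    rewrite mem_var_mul_rel; apply/forallP => i; rewrite (kappa3_var_mul fr).
    by apply: memvZ; apply: kap2.
  rewrite sE uE word1 word_nil mul1r; apply: (subvP (addvSl _ _)); apply: (subvP (addvSr _ _)).
  rewrite mem_rel_mul_var; apply/forallP => i; rewrite (kappa3_mul_var fr).
  by apply: memvZ; apply: kap2.
have [s0 u0] : s = [::] /\ u = [::].
  by case: s szE => [|x s]; case: u => [|y u] //= szE; exfalso; lia.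
rewrite s0 u0 word_nil mul1r mulr1; apply: (subvP (addvSr _ _)); apply/memv_span/map_f.
by rewrite mem_filter hg gG.
Qed.

(** The cubic generators form a basis of the cubic part of the kernel modulo
    VR + RV. Their number is 40 - dim (VR + RV), where VR and RV both have
    dimension 20. *)
Lemma size_G3 : size G3 = \dim (var_mul_rel R :&: rel_mul_var R)%VS.
Proof.
have [uG _ _] := Gmin.
have := @dim_irredundant K _ F kappa3 Q3 G3; rewrite span_G3 dimKer3.
move=> dimE; have := dimv_sum_cap (var_mul_rel R) (rel_mul_var R).
rewrite dim_var_mul_rel dim_rel_mul_var -/Q3.
suff : 40%N = (\dim Q3 + size G3)%N by lia.
apply: dimE => [|g]; first exact: filter_uniq.
rewrite mem_filter => /andP[/eqP g3 gG].
apply/negP => gs; apply: (irredundantG gG); set H := [seq h <- G | h != g].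
have g3h : homog 3 g by have := homog_hd gG; rewrite g3.
have G2H : {subset G2 <= H}.
  move=> h; rewrite !mem_filter => /andP[/eqP h2 ->]; rewrite andbT.
  by apply: contraTneq isT => hg; move: g3; rewrite -hg h2.
have [sI _ _] := two_sided_ideal_is_ideal H.
rewrite -(kappa3K fr g3h).
case/memv_addP: gs => q /memv_addP[r rR [s sR ->]] [w + ->].
move=> wS; rewrite !linearD; apply: (subspaceD sI).
  by apply: (subspaceD sI); [apply: ideal_var_mul_rel | apply: ideal_rel_mul_var].
move: w wS; apply: span_ind.
  exact: (@subspace_preim _ _ _ tau3 _ sI).
move=> _ /mapP[h + ->]; rewrite !mem_filter => /andP[hg /andP[/eqP h3 hG]].
have h3h : homog 3 h by have := homog_hd hG; rewrite h3.
by rewrite /= (kappa3K fr h3h); apply: two_sided_ideal_gen; rewrite mem_filter hg.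
Qed.

Lemma relation_count : sorted leq l ->
  l = nseq 5 2%N ++ nseq (\dim (var_mul_rel R :&: rel_mul_var R)%VS) 3%N.
Proof.
move=> sl; have l23 : all (fun m => (m == 2) || (m == 3))%N l.
  by rewrite degrees_hd; apply/allP => _ /mapP[g gG ->]; apply: hd_bounds.
rewrite {1}(sorted_two_three sl l23) -size_G3 -size_G2 !size_filter degrees_hd !count_map.
by congr (nseq _ _ ++ nseq _ _); apply: eq_count => g /=.
Qed.
End RelationCount.

(** Four of the degrees are one and the fifth is two; its position does not
    influence the Hilbert function. *)
Lemma degree_list (ds : seq nat) : size ds = 5%N -> count_mem 1%N ds = 4%N -> 2%N \in ds ->
  [/\ hilb (rev ds) 2 = 11%N, hilb (rev ds) 3 = 24%N
    & pairwise (fun d e => d + e <= 3)%N ds].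
Proof.
case: ds => [|a [|b [|c [|d [|e []]]]]] //= _.
rewrite !inE.
case: (eqVneq a 1%N) => [->|na]; case: (eqVneq b 1%N) => [->|nb]; case: (eqVneq c 1%N) => [->|nc];
  case: (eqVneq d 1%N) => [->|nd]; case: (eqVneq e 1%N) => [->|ne] //= _;
  rewrite ?orbF ?orFb => /eqP <-; split; by vm_compute.
Qed.

Lemma free_lrmorphism_ext (K : fieldType) (b : nat) (F : algType K) (y : 'I_b -> F) wcoef :
  free_on y wcoef -> forall (B : algType K) (g h : {lrmorphism F -> B}),
  (forall i, g (y i) = h (y i)) -> g =1 h.
Proof.
move=> fr B g h gh; apply: (free_ind fr) => [|s].
  exact: (@subspace_eq _ _ _ g h : is_subspace (fun u => g u = h u)).
by rewrite /word !rmorph_prod /=; apply: eq_bigr => i _; apply: gh.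
Qed.

Lemma ideal_image (K : fieldType) (F F' : algType K) (f : {lrmorphism F -> F'}) (G : seq F) u :
  two_sided_ideal G u -> two_sided_ideal (map f G) (f u).
Proof.
apply: lin_span_map => _ [a [g [c [gG ->]]]]; rewrite !rmorphM.
by apply: lin_span_id; exists (f a), (f g), (f c); rewrite map_f.
Qed.

Lemma minimal_generating_set_iso (K : fieldType) (F F' : algType K)
    (f : {lrmorphism F -> F'}) (g : {lrmorphism F' -> F}) (G : seq F) (I : F -> Prop) (I' : F' -> Prop) :
  cancel f g -> cancel g f -> (forall u, I u <-> I' (f u)) ->
  minimal_generating_set G I -> minimal_generating_set (map f G) I'.
Proof.
move=> fK gK II' [uG Ggen Gmin]; split.
- by rewrite map_inj_uniq //; apply: can_inj fK.
- move=> u; rewrite -{1}[u]gK -II' Ggen; split=> [/(ideal_image f)|/(ideal_image g)].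
    by rewrite gK.
  by rewrite mapK.
move=> H HG Hgen.
have HG' : {subset map g H <= G}.
  by move=> _ /mapP[h /HG /mapP[k kG ->] ->]; rewrite fK.
have Hgen' : generates_ideal (map g H) I.
  move=> u; rewrite II' Hgen; split=> [/(ideal_image g)|/(ideal_image f)].
    by rewrite fK.
  by rewrite mapK.
by move=> _ /mapP[k /(Gmin _ HG' Hgen') /mapP[h hH ->] ->]; rewrite gK.
Qed.

Lemma homog_eval (K : fieldType) (b : nat) (F : algType K) (y : 'I_b -> F) wcoef :
  free_on y wcoef -> forall f : {lrmorphism F -> F}, (forall i, homog wcoef 1 (f (y i))) ->
  forall m u, homog wcoef m u -> homog wcoef m (f u).
Proof.
move=> fr f fy m; apply: (homog_ind fr) => [|s <-].
  exact: (@subspace_preim _ _ _ f _ (homog_subspace fr m)).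
elim: s => [|i s IH]; first by rewrite word_nil rmorph1; apply: (homog1 fr).
rewrite -cat1s word_cat rmorphM word1; exact: (homogM fr (fy i) IH).
Qed.

Section Presentation.
Variables (K : fieldType) (A : algType K) (xs : seq (A * nat)).
Hypothesis tow : graded_iterated_ore_inj xs.
Hypothesis dim1 : has_dim (gr xs 1) 4.
Variables (F : algType K) (y : 'I_4 -> F) (wcoef : seq 'I_4 -> F -> K).
Hypothesis fr : free_on y wcoef.
Variable pi : {lrmorphism F -> A}.
Hypothesis pi1 : forall i, gr xs 1 (pi (y i)).
Hypothesis pi_surj : forall a, exists f, pi f = a.
Local Notation homog := (homog wcoef).

Lemma homog_gr m f : homog m f -> gr xs m (pi f).
Proof.
move: f; apply: (homog_ind fr) => [|s <-].
  exact: (@subspace_preim _ _ _ pi _ (gr_subspace xs m)).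
elim: s => [|i s IH]; first by rewrite word_nil rmorph1; apply: gr1.
rewrite -cat1s word_cat rmorphM word1; exact: (grM (pi1 i) IH).
Qed.

(** The component of degree [m] of any preimage is a preimage, by
    [tower_indep]. *)
Lemma graded_lift m a : gr xs m a -> exists2 f, homog m f & pi f = a.
Proof.
move=> ga; have [f fa] := pi_surj a; exists (component fr m f); first exact: homog_component.
have [N fE] := component_sum fr f.
pose n := maxn N m.+1; have {}fE := fE n (leq_maxl _ _).
(* the differences of the homogeneous components of [pi f] and [a], whose sum
   is zero *)
pose c i := pi (component fr i f) - (if i == m then a else 0).
have mn : (m < n)%N by rewrite leq_maxr.
suff : c m = 0 by rewrite /c eqxx => /eqP; rewrite subr_eq0 => /eqP.
apply: (tower_indep tow (N := n) (a := c)) => //.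
  move=> i; apply: subspaceB; first exact: gr_subspace.
    by apply/homog_gr/homog_component.
  by case: eqP => [->//|_]; apply: lin_span0.
rewrite sumrB -linear_sum /= -fE fa (bigD1 (Ordinal mn)) //= eqxx big1 ?addr0 ?subrr //.
by move=> i; rewrite -val_eqE /= => /negbTE->.
Qed.

(** In degree one [pi] maps a space of dimension at most four onto a space of
    dimension four. *)
Lemma kernel_deg01 m f : (m <= 1)%N -> homog m f -> pi f = 0 -> f = 0.
Proof.
case: m => [|[|//]] _ fm f0.
  have : exists c, f = c%:A.
    move: f fm {f0}; apply: (homog_ind fr) => [|s /size0nil ->].
      split=> [|c u v [d ->] [e ->]]; first by exists 0; rewrite scale0r.
      by exists (c * d + e); rewrite scalerDl scalerA.
    by exists 1; rewrite word_nil scale1r.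
  move=> [c cE]; move: f0; rewrite cE linearZ rmorph1 => /eqP.
  by rewrite scaler_eq0 oner_eq0 orbF => /eqP->; rewrite scale0r.
have gsurj h : homog 1 h -> exists r, lincomb y r = h.
  move: h; apply: (homog_ind fr) => [|[|i []] // _]; first exact: (@subspace_image _ _ _ (lincomb y)).
  by exists (delta_mx 0 i); rewrite word1 lincomb_delta.
have ghomog r : homog 1 (lincomb y r).
  apply: (subspace_sum _ (homog_subspace fr 1)) => i _.
  exact: (subspaceZ _ (homog_subspace fr 1) (homog_var fr (i := i))).
pose pg := [the {linear 'rV[K]_4 -> A} of pi \o lincomb y].
have [||Kf [memK dimK]] := ker_dim (f := pg) (gr_subspace xs 1) dim1.
- by move=> r; exact: (homog_gr (ghomog r)).
- move=> a /graded_lift[h /gsurj[r <-] <-]; by exists r.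
have K0 : Kf = 0%VS.
  by apply/eqP; rewrite -dimv_eq0; move: dimK; rewrite /dim /=; lia.
have [r rE] := gsurj f fm.
have pgr : pg r = pi f by rewrite -rE.
have : r \in Kf by rewrite memK pgr f0.
by rewrite K0 memv0 -rE => /eqP->; rewrite linear0.
Qed.

Lemma quadratic_kernel h : has_dim (gr xs 2) h -> exists R : {vspace 'M[K]_4},
  (forall t, (t \in R) = (pi (tau2 y t) == 0)) /\ (\dim R + h = 16)%N.
Proof.
move=> dim2; pose pt := [the {linear 'M[K]_4 -> A} of pi \o tau2 y].
have [||R [memR dimR]] := ker_dim (f := pt) (gr_subspace xs 2) dim2.
- by move=> t; apply/homog_gr/homog_tau2.
- move=> a /graded_lift[f f2 <-]; exists (kappa2 wcoef f).
  by rewrite /= (kappa2K fr f2).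
by exists R; split.
Qed.

Lemma cubic_kernel h : has_dim (gr xs 3) h -> exists R : {vspace tensor3 K},
  (forall t, (t \in R) = (pi (tau3 y t) == 0)) /\ (\dim R + h = 64)%N.
Proof.
move=> dim3; pose pt := [the {linear tensor3 K -> A} of pi \o tau3 y].
have [||R [memR dimR]] := ker_dim (f := pt) (gr_subspace xs 3) dim3.
- by move=> t; apply/homog_gr/homog_tau3.
- move=> a /graded_lift[f f3 <-]; exists (kappa3 wcoef f).
  by rewrite /= (kappa3K fr f3).
by exists R; split=> //; rewrite dimR /dim /= card_ord.
Qed.

(** Let [s] be the section given by [tower_section]. The congruence of [u] and
    [s (pi u)] modulo [I] holds for the generators, whose difference is a
    relation of degree one, and passes to products; for [u] in the kernel it
    says that [u] lies in [I]. *)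
Lemma kernel_generated : pairwise (fun d e => d + e <= 3)%N (unzip2 xs) ->
  forall I : F -> Prop, is_ideal I ->
  (forall m f, (m <= 3)%N -> homog m f -> pi f = 0 -> I f) -> forall f, pi f = 0 -> I f.
Proof.
move=> pw I idI I3 f f0.
have [|s [s1 sM pis sH]] := tower_section (homog_subspace fr) (homog1 fr) (homogM fr) idI I3 tow
  (phi := [the {lrmorphism A -> A} of idfun]) pw.
  by move=> z e /gr_gen /graded_lift.
have sub : is_subalgebra (fun u => eqI I u (s (pi u))).
  split; first split.
  - by rewrite !linear0; apply: eqI_refl.
  - by move=> c u v hu hv; rewrite !linearP; apply: eqID => //; apply: eqIZ.
  - by rewrite rmorph1 s1; apply: eqI_refl.
  move=> u v hu hv; rewrite rmorphM; apply: (eqI_trans idI (v := s (pi u) * s (pi v))).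
    exact: eqIM.
  by apply: eqI_sym.
have key u : eqI I u (s (pi u)).
  case: sub => subS sub1 subM; move: u; apply: (free_ind fr) => // t.
  elim: t => [|i t IH]; first by rewrite word_nil.
  rewrite -cat1s word_cat; apply: subM => //; rewrite word1.
  apply: (I3 1%N) => //.
    apply: (subspaceB (homog_subspace fr 1)); first exact: (homog_var fr).
    exact/sH/pi1.
  by rewrite linearB /= pis subrr.
by have := key f; rewrite f0 linear0 /eqI subr0.
Qed.

End Presentation.

Lemma deg1_vars_count (K : fieldType) (A : algType K) (xs : seq (A * nat)) :
  size (deg1_vars xs) = count_mem 1%N (unzip2 xs).
Proof. by rewrite size_map size_filter count_map. Qed.

Section CoreTheorem.
Variables (K : fieldType) (A : algType K) (xs : seq (A * nat)).
Hypothesis ore : as_ore_extension xs.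
Hypothesis size5 : size xs = 5%N.
Hypothesis dim1 : has_dim (gr xs 1) 4.

Let tow : graded_iterated_ore_inj xs. Proof. by case: ore. Qed.
Let gen1 a : deg1_span xs a. Proof. by case: ore => _; apply. Qed.

Let sz4 : size (deg1_vars xs) = 4%N.
Proof. exact: has_dim_unique (gr_subspace xs 1) (tower_deg1_dim tow) dim1. Qed.

Lemma as_ore_degrees : [/\ has_dim (gr xs 2) 11, has_dim (gr xs 3) 24
  & pairwise (fun d e => d + e <= 3)%N (unzip2 xs)].
Proof.
have [|||<- <- pw] := @degree_list (unzip2 xs).
- by rewrite size_map.
- by rewrite -deg1_vars_count sz4.
- apply: contraT => no2; suff : count_mem 1%N (unzip2 xs) = 5%N by rewrite -deg1_vars_count sz4.
  have all1 : all (pred1 1%N) (unzip2 xs).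
    apply/allP => _ /mapP[z zxs ->] /=; apply/eqP; apply: (tower_no_degree_2 tow) zxs => //.
    by move=> w wxs; apply: contraNneq no2 => <-; apply: map_f.
  by move: all1; rewrite all_count size_map size5 => /eqP.
by split=> //; apply: tower_has_dim.
Qed.

Variables (F : algType K) (y : 'I_4 -> F) (wcoef : seq 'I_4 -> F -> K).
Hypothesis fr : free_on y wcoef.

Let v (i : 'I_4) : A := (deg1_vars xs)`_i.

Let v1 i : gr xs 1 (v i).
Proof. by apply/deg1_vars_gr/mem_nth; rewrite sz4. Qed.

Lemma ordered_eval : exists pi : {lrmorphism F -> A},
  (forall i, pi (y i) = v i) /\ forall a, exists f, pi f = a.
Proof.
have [pi piE] := free_eval fr v; exists pi; split=> // a.
have sub := @subspace_image _ _ _ pi.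
move: a (gen1 a); apply: (deg1_span_ind sub); first by exists 1; rewrite rmorph1.
move=> a b ga _ [g <-]; suff [f <-] : exists f, pi f = a by exists (f * g); rewrite rmorphM.
move: a ga; apply: (gr_1_ind (tower_pos tow) sub) => z zxs.
have zv : z \in deg1_vars xs by apply/mapP; exists (z, 1%N) => //; rewrite mem_filter.
have iv : (index z (deg1_vars xs) < 4)%N by rewrite -sz4 index_mem.
by exists (y (Ordinal iv)); rewrite /= piE /v nth_index.
Qed.

(** The presentation sends the generators to the degree one variables in the
    order of adjunction; this is what makes [tower_flag] applicable to its
    quadratic relations. *)
Lemma ordered_overlap (pi : {lrmorphism F -> A}) (R : {vspace 'M[K]_4}) :
  (forall i, pi (y i) = v i) -> (forall t, (t \in R) = (pi (tau2 y t) == 0)) ->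
  \dim R = 5%N -> (\dim (var_mul_rel R :&: rel_mul_var R)%VS <= 2)%N.
Proof.
move=> piE memR dimR.
have [_ flag] := tower_flag tow; rewrite sz4 in flag.
pose c (t : 'M[K]_4) i k := t (inord i) (inord k).
have cE (t : 'M[K]_4) (i k : 'I_4) : c t i k = t i k by rewrite /c !inord_val.
have rel t : t \in R -> \sum_(i < 4) \sum_(k < 4) c t i k *: ((deg1_vars xs)`_i * (deg1_vars xs)`_k) = 0.
  rewrite memR => /eqP t0; rewrite -[RHS]t0 /tau2 linear_sum; apply: eq_bigr => i _.
  rewrite linear_sum; apply: eq_bigr => k _.
  by rewrite linearZ rmorphM /= !piE cE.
have cI t i k : (i < 4)%N -> (k < 4)%N -> c t i k = t (inord i) (inord k) by [].
have inv i : (i < 4)%N -> (@inord 3 i : nat) = i by move=> i4; rewrite inordK.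
apply: dim_cubic_overlap => //.
- move=> t tR j tj i k jk; have [fA _ _] := flag (c t) (rel t tR).
  rewrite -cE; apply: (fA j) => //; last by rewrite jk ltn_ord.
  by move=> i' k' /andP[ji' i4] k4; apply: tj; rewrite inv.
- move=> t tR j tj; have [_ fB _] := flag (c t) (rel t tR).
  rewrite -cE; apply: fB => // i' k' /andP[ji' i4] k4.
  by apply: tj; rewrite inv.
- move=> t tR j tj tij k; have [_ _ fC] := flag (c t) (rel t tR).
  rewrite -cE; apply: fC => // [i' k' /andP[ji' i4] k4|i' ij'].
    by apply: tj; rewrite inv.
  have i4 : (i' < 4)%N by apply: ltn_trans ij' _.
  by rewrite /c inord_val; apply: tij; rewrite inv.
move=> u w; rewrite memR => /eqP uw0.
have E : (\sum_i u 0 i *: v i) * (\sum_k w 0 k *: v k) = 0.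
  rewrite -[RHS]uw0 /tau2 linear_sum mulr_suml; apply: eq_bigr => i _.
  rewrite mulr_sumr linear_sum; apply: eq_bigr => k _.
  by rewrite -scalerAl -scalerAr scalerA linearZ rmorphM /= !piE !mxE big_ord1 mxE.
have [indep _] := tower_flag tow; rewrite sz4 in indep.
have zero (r : 'rV[K]_4) : \sum_i r 0 i *: v i = 0 -> r = 0.
  move=> r0; apply/rowP => i; rewrite mxE.
  have := indep (fun i => r 0 (inord i)) _ i (ltn_ord i); rewrite inord_val; apply.
  by rewrite -[RHS]r0; apply: eq_bigr => k _; rewrite inord_val.
by case: (tower_domain tow E) => /zero ->; [left | right].
Qed.

(** Two presentations by degree one generators differ by an invertible linear
    change of generators, which carries minimal generating sets to minimal
    generating sets and preserves degrees. So the generators may be assumed to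
    map to the variables in the order of adjunction. *)
Lemma relation_type_normal_form (R : {vspace 'M[K]_4}) (pi0 : {lrmorphism F -> A}) :
  (forall i, pi0 (y i) = v i) -> (forall t, (t \in R) = (pi0 (tau2 y t) == 0)) ->
  forall (pi : {lrmorphism F -> A}) (G : seq F) l,
  (forall i, gr xs 1 (pi (y i))) -> (forall a, exists f, pi f = a) ->
  minimal_generating_set G (fun f => pi f = 0) ->
  size l = size G -> (forall i, (i < size G)%N -> homog wcoef (nth 0%N l i) G`_i) ->
  sorted leq l ->
  l = nseq 5 2%N ++ nseq (\dim (var_mul_rel R :&: rel_mul_var R)%VS) 3%N.
Proof.
move=> pi0E memR pi G l pi1 pis Gmin szG homG sl.
have [dim2 dim3 pw] := as_ore_degrees.
have [p [pE ps]] := ordered_eval.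
have pi0p : pi0 =1 p by apply: (free_lrmorphism_ext fr) => i; rewrite pi0E pE.
have pi01 i : gr xs 1 (pi0 (y i)) by rewrite pi0E.
have pi0s a : exists f, pi0 f = a by have [f <-] := ps a; exists f.
(* The generators are changed by [alpha] and back by [beta], which are
   mutually inverse because [pi0] and [pi] are injective in degree one. *)
have [fa fa1] : exists fa : 'I_4 -> F, forall i, homog wcoef 1 (fa i) /\ pi (fa i) = v i.
  have lift i : exists f, homog wcoef 1 f /\ pi f = v i.
    by have [f f1 fv] := graded_lift tow fr pi1 pis (v1 i); exists f.
  by exists (fun i => projT1 (cid (lift i))) => i; case: cid.
have [fb fb1] : exists fb : 'I_4 -> F, forall i, homog wcoef 1 (fb i) /\ pi0 (fb i) = pi (y i).
  have lift i : exists f, homog wcoef 1 f /\ pi0 f = pi (y i).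
    by have [f f1 fv] := graded_lift tow fr pi01 pi0s (pi1 i); exists f.
  by exists (fun i => projT1 (cid (lift i))) => i; case: cid.
have [alpha aE] := free_eval fr fa; have [beta bE] := free_eval fr fb.
have piA u : pi (alpha u) = pi0 u.
  apply: (free_lrmorphism_ext fr (g := [the {lrmorphism F -> A} of pi \o alpha])) => i /=.
  by rewrite aE pi0E; case: (fa1 i).
have pi0B u : pi0 (beta u) = pi u.
  apply: (free_lrmorphism_ext fr (g := [the {lrmorphism F -> A} of pi0 \o beta])) => i /=.
  by rewrite bE; case: (fb1 i).
have ha m u : homog wcoef m u -> homog wcoef m (alpha u).
  by apply: (homog_eval fr) => i; rewrite aE; case: (fa1 i).
have hb m u : homog wcoef m u -> homog wcoef m (beta u).
  by apply: (homog_eval fr) => i; rewrite bE; case: (fb1 i).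
have same1 (q : {lrmorphism F -> A}) u w : (forall i, gr xs 1 (q (y i))) ->
    (forall a, exists f, q f = a) -> homog wcoef 1 u -> homog wcoef 1 w -> q u = q w -> u = w.
  move=> q1 qs hu hw quw; apply/eqP; rewrite -subr_eq0; apply/eqP.
  apply: (kernel_deg01 tow dim1 fr q1 qs (m := 1)) => //.
    exact: (subspaceB (homog_subspace fr 1)).
  by rewrite linearB /= quw subrr.
have alphaK : cancel alpha beta.
  apply: (free_lrmorphism_ext fr (g := [the {lrmorphism F -> F} of beta \o alpha])
    (h := [the {lrmorphism F -> F} of idfun])) => i /=.
  apply: (same1 pi0) => //; first by apply/hb/ha/(homog_var fr).
    exact: (homog_var fr).
  by rewrite pi0B piA.
have betaK : cancel beta alpha.
  apply: (free_lrmorphism_ext fr (g := [the {lrmorphism F -> F} of alpha \o beta])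
    (h := [the {lrmorphism F -> F} of idfun])) => i /=.
  apply: (same1 pi) => //; first by apply/ha/hb/(homog_var fr).
    exact: (homog_var fr).
  by rewrite piA pi0B.
have Gmin' : minimal_generating_set (map beta G) (fun f => pi0 f = 0).
  by apply: minimal_generating_set_iso betaK alphaK _ Gmin => u; rewrite pi0B.
have [R' [memR' dimR']] := quadratic_kernel tow fr pi01 pi0s dim2.
have RR' : R' = R by apply/vspaceP => t; rewrite memR memR'.
have [K3 [memK3 dimK3]] := cubic_kernel tow fr pi01 pi0s dim3.
rewrite -RR'.
apply: (relation_count fr _ memR' _ memK3 _ _ Gmin' _ _ sl).
- by move=> m f; apply: (kernel_deg01 tow dim1 fr pi01 pi0s).
- by lia.
- by lia.
- exact: (kernel_generated tow fr pi01 pi0s pw).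
- by rewrite size_map.
by move=> i; rewrite size_map => iG; rewrite (nth_map 0) //; apply/hb/homG.
Qed.

End CoreTheorem.

Theorem as_ore_relation_type_bound (K : fieldType) (A : algType K) (xs : seq (A * nat)) :
  as_ore_extension xs -> size xs = 5%N -> has_dim (gr xs 1) 4 ->
  exists2 k, (k <= 2)%N & forall l, has_relation_type xs l -> l = nseq 5 2%N ++ nseq k 3%N.
Proof.
move=> ore size5 dim1; have fr := free_alg_free_on K 4.
have [pi0 [pi0E pi0s]] := ordered_eval ore dim1 fr.
have [tow _] := ore; have [dim2 _ _] := as_ore_degrees ore size5 dim1.
have pi01 i : gr xs 1 (pi0 (free_var K i)).
  rewrite pi0E; apply/deg1_vars_gr/mem_nth.
  by rewrite (has_dim_unique (gr_subspace xs 1) (tower_deg1_dim tow) dim1).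
have [R [memR dimR]] := quadratic_kernel tow fr pi01 pi0s dim2.
exists (\dim (var_mul_rel R :&: rel_mul_var R)%VS).
  by apply: (ordered_overlap ore dim1 pi0E memR); lia.
move=> l [b [pi [G [dimb pi1 pis Gmin /andP[hom sl]]]]].
have b4 : b = 4%N := has_dim_unique (gr_subspace xs 1) dimb dim1.
move: b4 pi G pi1 pis Gmin hom {dimb} => -> pi G pi1 pis Gmin hom.
have szG : size l = size G.
  elim: l G hom {sl Gmin} => [|m l IH] [|g G] //= /andP[_ /IH ->].
  by [].
apply: (relation_type_normal_form ore size5 dim1 fr pi0E memR (pi := pi) (G := G)) => //.
elim: l G hom {sl Gmin szG} => [|m l IH] [|g G] //= /andP[hg hG] [|i] /= iG.
  exact/free_homogE.
exact: IH hG i iG.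
Qed.

(** * Construction of Ore extensions *)

Section OrePoly.
Variables (K : fieldType) (R : algType K).
Variables (sigma : {lrmorphism R -> R}) (delta : {linear R -> R}).
Hypothesis skew : skew_derivation sigma delta.

(** The type mentions the skew derivation so that it can carry the skew
    product, while its elements are added like ordinary polynomials. *)
Definition ore_poly of skew_derivation sigma delta : Type := {poly R}.
Local Notation S := (ore_poly skew).
Local Notation shift := (ore_shift sigma delta).
Implicit Types (p q r : {poly R}).

Lemma ore_shiftD p q : shift (p + q) = shift p + shift q.
Proof. by rewrite /ore_shift !raddfD mulrDl addrACA. Qed.

Lemma ore_shiftZ a p : shift (a *: p) = sigma a *: shift p + delta a *: p.
Proof.
apply/polyP => i; rewrite [RHS]coefD !coefZ !coef_ore_shift coefZ skew mulrDr addrA; congr (_ + _ + _).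
by case: i => [|i]; rewrite ?mulr0 // coefZ rmorphM.
Qed.

Lemma ore_shift0 : shift 0 = 0.
Proof. by rewrite /ore_shift !raddf0 mul0r addr0. Qed.

Lemma iter_ore_shiftD n p q : iter n shift (p + q) = iter n shift p + iter n shift q.
Proof. by elim: n => //= n ->; rewrite ore_shiftD. Qed.

Lemma skew_delta1 : delta 1 = 0.
Proof.
have := skew 1 1; rewrite rmorph1 !mulr1 mul1r => /eqP.
by rewrite -subr_eq0 opprD addrA subrr sub0r oppr_eq0 => /eqP.
Qed.

Lemma iter_ore_shift1 n : iter n shift 1 = 'X^n.
Proof.
elim: n => [|n IH] //=; rewrite IH; apply/polyP => i.
rewrite coef_ore_shift !coefXn.
case: i => [|i]; rewrite ?coefXn ?eqSS; last first.
  by case: eqP => [->|_]; case: eqP => _; rewrite ?rmorph1 ?rmorph0 ?skew_delta1 ?linear0 addr0.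
by case: eqP => _; rewrite ?skew_delta1 ?linear0 addr0.
Qed.

Definition ore_mul p q : {poly R} := \sum_(i < size p) p`_i *: iter i shift q.

Lemma ore_mul_wide n p q : (size p <= n)%N ->
  ore_mul p q = \sum_(i < n) p`_i *: iter i shift q.
Proof.
move=> pn; rewrite /ore_mul -!(big_mkord xpredT (fun i => p`_i *: iter i shift q)).
rewrite [RHS](big_cat_nat (n := size p)) //= [X in _ + X]big_nat_cond.
rewrite [X in _ + X]big1 ?addr0 // => i /andP[/andP[pi _] _].
by rewrite nth_default // scale0r.
Qed.

Lemma ore_mulDl p q r : ore_mul (p + q) r = ore_mul p r + ore_mul q r.
Proof.
rewrite (ore_mul_wide r (leq_maxl (size p) (size q))) (ore_mul_wide r (leq_maxr (size p) (size q))).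
rewrite (ore_mul_wide _ (size_polyD p q)) -big_split; apply: eq_bigr => i _.
by rewrite coefD scalerDl.
Qed.

Lemma ore_mulZl a p q : ore_mul (a *: p) q = a *: ore_mul p q.
Proof.
rewrite (ore_mul_wide _ (size_scale_leq a p)) scaler_sumr; apply: eq_bigr => i _.
by rewrite coefZ scalerA.
Qed.

Lemma ore_mul_sum (J : Type) (s : seq J) (f : J -> {poly R}) q :
  ore_mul (\sum_(j <- s) f j) q = \sum_(j <- s) ore_mul (f j) q.
Proof.
elim: s => [|j s IH]; first by rewrite !big_nil /ore_mul size_poly0 big_ord0.
by rewrite !big_cons ore_mulDl IH.
Qed.

Lemma ore_mulDr p q r : ore_mul p (q + r) = ore_mul p q + ore_mul p r.
Proof.
rewrite /ore_mul -big_split; apply: eq_bigr => i _.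
by rewrite iter_ore_shiftD scalerDr.
Qed.

Lemma ore_mul1p p : ore_mul 1 p = p.
Proof. by rewrite /ore_mul size_poly1 big_ord1 coefC eqxx scale1r. Qed.

Lemma ore_mulp1 p : ore_mul p 1 = p.
Proof.
rewrite /ore_mul -[RHS]coefK poly_def; apply: eq_bigr => i _.
by rewrite iter_ore_shift1.
Qed.

(** Associativity with left factor [x], from which [ore_mulA] follows by
    iteration and linearity. *)
Lemma ore_mul_shift p q : ore_mul (shift p) q = shift (ore_mul p q).
Proof.
have shift_sum (J : Type) (s : seq J) (f : J -> {poly R}) :
    shift (\sum_(j <- s) f j) = \sum_(j <- s) shift (f j).
  exact: (big_morph shift ore_shiftD ore_shift0).
rewrite [in RHS]/ore_mul shift_sum.
have sz : (size (shift p) <= (size p).+1)%N.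
  apply/leq_sizeP => -[|j] //; rewrite ltnS => pj; rewrite coef_ore_shift.
  by rewrite !nth_default ?rmorph0 ?linear0 ?addr0 // ltnW.
rewrite (ore_mul_wide _ sz).
rewrite (eq_bigr (fun i : 'I_(size p).+1 =>
  (if i : nat is j.+1 then sigma p`_j else 0) *: iter i shift q
    + delta p`_i *: iter i shift q)); last first.
  by move=> i _; rewrite coef_ore_shift scalerDl.
rewrite big_split /= big_ord_recl /= scale0r add0r big_ord_recr /=.
rewrite (nth_default _ (leqnn _)) linear0 scale0r addr0 -big_split; apply: eq_bigr => i _.
by rewrite ore_shiftZ.
Qed.

Lemma ore_mulA p q r : ore_mul p (ore_mul q r) = ore_mul (ore_mul p q) r.
Proof.
rewrite [ore_mul p q]/ore_mul ore_mul_sum; apply: eq_bigr => i _; rewrite ore_mulZl; congr (_ *: _).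
by elim: (i : nat) => //= n ->; rewrite ore_mul_shift.
Qed.

HB.instance Definition _ := GRing.Zmodule.copy S {poly R}.

Lemma ore_one_neq0 : (1 : {poly R}) != 0 :> S.
Proof. exact: oner_neq0. Qed.

HB.instance Definition _ := GRing.Zmodule_isNzRing.Build S
  ore_mulA ore_mul1p ore_mulp1 ore_mulDl ore_mulDr ore_one_neq0.

Definition ore_scale (c : K) (p : S) : S := (c%:A : R) *: (p : {poly R}).

Lemma ore_scaleA c d p : ore_scale c (ore_scale d p) = ore_scale (c * d) p.
Proof. by rewrite /ore_scale scalerA mulr_algl scalerA. Qed.
Lemma ore_scale1 : left_id 1 ore_scale.
Proof. by move=> p; rewrite /ore_scale scale1r scale1r. Qed.
Lemma ore_scaleDr : right_distributive ore_scale +%R.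
Proof. by move=> c p q; rewrite /ore_scale; apply: (scalerDr (c%:A : R) (p : {poly R})). Qed.
Lemma ore_scaleDl p : {morph ore_scale^~ p : c d / c + d}.
Proof. by move=> c d; rewrite /ore_scale scalerDl; apply: (scalerDl (p : {poly R})). Qed.

HB.instance Definition _ := GRing.Zmodule_isLmodule.Build K S
  ore_scaleA ore_scale1 ore_scaleDr ore_scaleDl.

Lemma ore_scaleAl (c : K) (p q : S) : c *: (p * q) = (c *: p) * q.
Proof. by rewrite [RHS](ore_mulZl (c%:A) p q). Qed.

HB.instance Definition _ := GRing.Lmodule_isLalgebra.Build K S ore_scaleAl.

Lemma ore_shift_alg (c : K) p : shift (c%:A *: p) = c%:A *: shift p.
Proof.
rewrite ore_shiftZ linearZ rmorph1 [delta _]linearZ /= skew_delta1.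
by rewrite scaler0 scale0r addr0.
Qed.

Lemma ore_scaleAr (c : K) (p q : S) : c *: (p * q) = p * (c *: q).
Proof.
change (c%:A *: ore_mul p q = ore_mul p (c%:A *: (q : {poly R}))).
rewrite /ore_mul scaler_sumr; apply: eq_bigr => i _.
have -> : iter i shift (c%:A *: (q : {poly R})) = c%:A *: iter i shift q.
  by elim: (i : nat) => //= n ->; rewrite ore_shift_alg.
by rewrite !scalerA mulr_algl mulr_algr.
Qed.

HB.instance Definition _ := GRing.Lalgebra_isAlgebra.Build K S ore_scaleAr.

Definition ore_const (a : R) : S := a%:P.
Definition ore_var : S := ('X : {poly R}).

Lemma ore_const_linear : linear ore_const.
Proof.
move=> c a b; change ((c *: a + b)%:P = c%:A *: a%:P + b%:P).
by rewrite polyCD -mul_polyC -polyCM mulr_algl.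
Qed.
Lemma ore_const_monoid : monoid_morphism ore_const.
Proof.
split=> // a b; change ((a * b)%:P = ore_mul a%:P b%:P).
have [->|a0] := eqVneq a 0; first by rewrite mul0r /ore_mul size_poly0 big_ord0.
by rewrite /ore_mul size_polyC a0 big_ord1 coefC eqxx polyCM mul_polyC.
Qed.
HB.instance Definition _ := GRing.isLinear.Build K R S *:%R ore_const ore_const_linear.
HB.instance Definition _ := GRing.isMonoidMorphism.Build R S ore_const ore_const_monoid.

Lemma ore_poly_extension : ore_extension sigma delta
  [the {lrmorphism R -> S} of ore_const] ore_var.
Proof.
have xn n : ore_var ^+ n = 'X^n :> {poly R}.
  elim: n => [|n IH]; first by rewrite expr0.
  rewrite exprS; change (ore_mul 'X (ore_var ^+ n : {poly R}) = 'X^(n.+1)); rewrite IH.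
  by rewrite /ore_mul size_polyX !big_ord_recr big_ord0 /= !coefX /= scale0r scale1r !add0r
     -(iter_ore_shift1 n) -iterS iter_ore_shift1.
have cm a (p : {poly R}) : ore_const a * (p : S) = a *: p :> {poly R}.
  change (ore_mul a%:P p = a *: p).
  have [->|a0] := eqVneq a 0; first by rewrite /ore_mul size_poly0 big_ord0 scale0r.
  by rewrite /ore_mul size_polyC a0 big_ord1 coefC eqxx.
have sE (p : {poly R}) : \sum_(i < size p) ore_const p`_i * ore_var ^+ i = p :> S.
  rewrite -[RHS]coefK poly_def.
  rewrite [LHS](eq_bigr (fun i : 'I_(size p) => (p`_i *: 'X^i : S))) // => i _.
  by rewrite -xn -cm.
split=> // [s|a].
  exists (s : {poly R}); split=> [|p ->]; first by rewrite sE.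
  by rewrite sE.
change (ore_mul 'X a%:P = ore_const (sigma a) * ore_var + ore_const (delta a)).
transitivity ((sigma a *: 'X + (delta a)%:P : {poly R}) : S); last by rewrite -cm.
rewrite /ore_mul size_polyX !big_ord_recr big_ord0 /= !coefX /= scale0r scale1r !add0r.
rewrite -[a%:P]alg_polyC ore_shiftZ -[1]/(iter 0 shift 1) -iterS iter_ore_shift1 /=.
by rewrite alg_polyC expr1.
Qed.

End OrePoly.

Section Triangular.
Variables (K : fieldType) (B : algType K).

(** Upper triangular two by two matrices, with entries listed as upper left,
    upper right, lower right. An algebra map into them with lower right entry
    the identity is the same as an algebra map [sigma], in the upper left
    corner, together with a [sigma]-derivation, in the upper right one. *)
Definition triangular : Type := (B * B * B)%type.
Local Notation T := triangular.
HB.instance Definition _ := GRing.Lmodule.copy T (B * B * B)%type.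

Definition tri (a m d : B) : T := (a, m, d).
Definition tri_mul (u v : T) : T :=
  tri (u.1.1 * v.1.1) (u.1.1 * v.1.2 + u.1.2 * v.2) (u.2 * v.2).

Lemma tri_mulA : associative tri_mul.
Proof.
move=> [[a m] d] [[a' m'] d'] [[a'' m''] d'']; rewrite /tri_mul /tri /=; congr (_, _, _).
- exact: mulrA.
- by rewrite mulrDr mulrDl !mulrA addrA.
- exact: mulrA.
Qed.
Lemma tri_mul1 : left_id (tri 1 0 1) tri_mul.
Proof. by move=> [[a m] d]; rewrite /tri_mul /tri /= !mul1r mul0r addr0. Qed.
Lemma tri_mulr1 : right_id (tri 1 0 1) tri_mul.
Proof. by move=> [[a m] d]; rewrite /tri_mul /tri /= !mulr1 mulr0 add0r. Qed.
Lemma tri_mulDl : left_distributive tri_mul +%R.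
Proof.
move=> [[a m] d] [[a' m'] d'] [[a'' m''] d'']; rewrite /tri_mul /tri /=; congr (_, _, _).
- exact: mulrDl.
- by rewrite /= !mulrDl addrACA.
- exact: mulrDl.
Qed.
Lemma tri_mulDr : right_distributive tri_mul +%R.
Proof.
move=> [[a m] d] [[a' m'] d'] [[a'' m''] d'']; rewrite /tri_mul /tri /=; congr (_, _, _).
- exact: mulrDr.
- by rewrite /= !mulrDr addrACA.
- exact: mulrDr.
Qed.
Lemma tri1_neq0 : tri 1 0 1 != 0.
Proof. by apply/eqP => /(congr1 (fun u : T => u.2)) /= /eqP; rewrite oner_eq0. Qed.

HB.instance Definition _ := GRing.Zmodule_isNzRing.Build T
  tri_mulA tri_mul1 tri_mulr1 tri_mulDl tri_mulDr tri1_neq0.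

Lemma tri_scaleAl (c : K) (u v : T) : c *: (u * v) = (c *: u : T) * v.
Proof.
case: u v => [[a m] d] [[a' m'] d']; congr (_, _, _) => /=; rewrite -?scalerAl //.
by rewrite scalerDr.
Qed.
HB.instance Definition _ := GRing.Lmodule_isLalgebra.Build K T tri_scaleAl.
Lemma tri_scaleAr (c : K) (u v : T) : c *: (u * v) = u * (c *: v : T).
Proof.
case: u v => [[a m] d] [[a' m'] d']; congr (_, _, _) => /=; rewrite -?scalerAr //.
by rewrite scalerDr.
Qed.
HB.instance Definition _ := GRing.Lalgebra_isAlgebra.Build K T tri_scaleAr.

End Triangular.

Lemma idfun_skew (K : fieldType) (B : algType K) :
  skew_derivation [the {lrmorphism B -> B} of idfun] [the {linear B -> B} of \0].
Proof. by move=> a b /=; rewrite mulr0 mul0r addr0. Qed.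

Section PolySkew.
Variables (K : fieldType) (B R : algType K) (iota : {lrmorphism B -> R}) (x : R).
Hypothesis ore : ore_extension [the {lrmorphism B -> B} of idfun] [the {linear B -> B} of \0] iota x.
Variables (s : K) (w : B).
Hypothesis w_central : forall b, w * b = b * w.

Lemma poly_var_comm b : x * iota b = iota b * x.
Proof. by case: ore => _ _ /(_ b) ->; rewrite /= rmorph0 addr0. Qed.

(** A skew derivation of the polynomial ring R over B is an algebra map from R
    to triangular matrices, hence given by the image of [x], a matrix that has
    to commute with the scalar matrices over B. This is where centrality of
    [w] enters. *)
Lemma poly_skew : exists (sigma : {lrmorphism R -> R}) (delta : {linear R -> R}),
  [/\ skew_derivation sigma delta,
      (forall b, sigma (iota b) = iota b) /\ sigma x = s *: x
    & (forall b, delta (iota b) = 0) /\ delta x = iota w].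
Proof.
pose f (b : B) : triangular R := tri (iota b) 0 (iota b).
have fl : linear f.
  move=> c a b; rewrite /f /tri; congr (_, _, _) => /=; rewrite ?linearP //.
  by rewrite scaler0 addr0.
pose fL : {linear B -> triangular R} := HB.pack f (GRing.isLinear.Build _ _ _ _ f fl).
have f0 : f 0 = 0 by exact: (linear0 fL).
have f1 : fL 1 = 1 by rewrite /fL /= /f rmorph1.
have fM a b : eqI (fun u => u = 0) (fL (a * b)) (fL a * fL b).
  rewrite /eqI; apply/eqP; rewrite subr_eq0; apply/eqP.
  by rewrite /fL /= /f /tri; congr (_, _, _); rewrite /= ?rmorphM // mulr0 mul0r addr0.
(* the image of [x] *)
pose y : triangular R := tri (s *: x) (iota w) x.
have comp r : ore_compatible [the {lrmorphism B -> B} of idfun] [the {linear B -> B} of \0]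
    (fun u => u = 0) fL y r.
  rewrite /ore_compatible /eqI /= f0 addr0; apply/eqP; rewrite subr_eq0; apply/eqP.
  rewrite /f /y /tri; congr (_, _, _) => /=.
  - by rewrite -scalerAl poly_var_comm scalerAr.
  - by rewrite mulr0 mul0r add0r addr0 -!rmorphM w_central.
  - exact: poly_var_comm.
have [g [_ gi gx gM]] := ore_lift ore (zero_ideal _) f1 fM comp.
have {}gM a b : g (a * b) = g a * g b.
  by have := gM a b; rewrite /eqI => /eqP; rewrite subr_eq0 => /eqP.
have g1 : g 1 = 1 by rewrite -(rmorph1 iota) gi f1.
have g3 r : (g r).2 = r.
  move: r; apply: (ore_subalgebra_ind ore) => [|b|].
  - split; first split.
    + by rewrite linear0.
    + by move=> c u v hu hv; rewrite linearP /= hu hv.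
    + by rewrite g1.
    by move=> a b ha hb; rewrite gM /= ha hb.
  - by rewrite gi.
  by rewrite gx.
have sl : linear (fun r => (g r).1.1) by move=> c a b; rewrite linearP.
have dl : linear (fun r => (g r).1.2) by move=> c a b; rewrite linearP.
have s1 : (g 1).1.1 = 1 by rewrite g1.
have sM : {morph (fun r => (g r).1.1) : a b / a * b} by move=> a b /=; rewrite gM.
have [sigma sigmaE] := lrmorphism_of sl s1 sM.
pose delta : {linear R -> R} := HB.pack (fun r => (g r).1.2)
  (GRing.isLinear.Build _ _ _ _ (fun r => (g r).1.2) dl).
exists sigma, delta; split.
- by move=> a b; rewrite sigmaE /delta /= gM /= g3.
- by split=> [b|]; rewrite sigmaE ?gi ?gx.
- by split=> [b|]; rewrite /delta /= ?gi ?gx.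
Qed.

End PolySkew.

Section Steps.
Variable K : fieldType.

(** The last clause is the universal property of the polynomial ring, for maps
    that are multiplicative modulo an ideal. *)
Lemma poly_step (B : algType K) (xs : seq (B * nat)) (d : nat) : (0 < d)%N ->
  graded_iterated_ore_inj xs ->
  exists (S : algType K) (iota : {lrmorphism B -> S}) (x : S),
  [/\ graded_iterated_ore_inj (rcons [seq (iota v.1, v.2) | v <- xs] (x, d)),
      ore_extension [the {lrmorphism B -> B} of idfun] [the {linear B -> B} of \0] iota x
    & forall (F : algType K) (I : F -> Prop), is_ideal I ->
      forall (f : {linear B -> F}) (X : F), f 1 = 1 ->
      (forall a b : B, eqI I (f (a * b)) (f a * f b)) ->
      (forall y e, (y, e) \in xs -> eqI I (X * f y) (f y * X)) ->
      exists g : {linear S -> F}, [/\ forall b, g (iota b) = f b, g x = X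
        & forall a b : S, eqI I (g (a * b)) (g a * g b)]].
Proof.
move=> d0 tow; pose S := ore_poly (@idfun_skew K B).
pose iota := [the {lrmorphism B -> S} of @ore_const _ _ _ _ (@idfun_skew K B)].
pose x : S := ore_var (@idfun_skew K B).
have ore := ore_poly_extension (@idfun_skew K B); rewrite -/iota -/x in ore.
exists S, iota, x; split=> //.
  apply: (graded_iterated_ore_injS tow ore) => // y e yxs /=.
  by split; [exact: gr_gen | exact: lin_span0].
move=> F I idI f X f1 fM fX.
have comp r : ore_compatible [the {lrmorphism B -> B} of idfun] [the {linear B -> B} of \0] I f X r.
  move: r; apply: (tower_subalgebra_ind tow); first exact: (ore_compatible_subalgebra ore).
  by move=> y e yxs; rewrite /ore_compatible /= linear0 addr0; apply: fX yxs.
have [g [_ gi gx gM]] := ore_lift ore idI f1 fM comp.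
by exists g; split.
Qed.

(** First a polynomial variable [x] is adjoined, then [y] by the skew
    derivation of [poly_skew]. Since [s * s = 1], the map [sigma] is its own
    inverse and in particular injective. *)
Lemma weyl_step (B : algType K) (xs : seq (B * nat)) (s : K) (w : B) : s * s = 1 ->
  graded_iterated_ore_inj xs -> (forall b, w * b = b * w) -> gr xs 2 w ->
  exists (S : algType K) (iota : {lrmorphism B -> S}) (x y : S),
  [/\ graded_iterated_ore_inj ([seq (iota v.1, v.2) | v <- xs] ++ [:: (x, 1%N); (y, 1%N)]),
      forall b, x * iota b = iota b * x /\ y * iota b = iota b * y,
      y * x = s *: (x * y) + iota w
    & forall (F : algType K) (I : F -> Prop), is_ideal I ->
      forall (f : {linear B -> F}) (X Y : F), f 1 = 1 ->
      (forall a b : B, eqI I (f (a * b)) (f a * f b)) ->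
      (forall z e, (z, e) \in xs -> eqI I (X * f z) (f z * X) /\ eqI I (Y * f z) (f z * Y)) ->
      eqI I (Y * X) (s *: (X * Y) + f w) ->
      exists g : {linear S -> F}, [/\ forall b, g (iota b) = f b, g x = X, g y = Y
        & forall a b : S, eqI I (g (a * b)) (g a * g b)]].
Proof.
move=> s1 tow wc w2.
have [R [iota1 [x1 [towR oreR liftR]]]] := poly_step (d := 1) isT tow.
set ys := rcons _ _ in towR.
have [sigma [delta [skew [sigmab sigmax] [deltab deltax]]]] := poly_skew oreR s wc.
pose S := ore_poly skew.
pose iota2 := [the {lrmorphism R -> S} of @ore_const _ _ _ _ skew].
pose y : S := ore_var skew.
have oreS := ore_poly_extension skew; rewrite -/iota2 -/y in oreS.
have sinj : injective sigma.
  apply: (can_inj (g := sigma)) => r; move: r; apply: (ore_subalgebra_ind oreR) => [|b|].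
  - exact: (subalgebra_equalizer [the {lrmorphism R -> R} of sigma \o sigma]
      [the {lrmorphism R -> R} of idfun]).
  - by rewrite !sigmab.
  by rewrite sigmax linearZ /= sigmax scalerA s1 scale1r.
have xs_ys z e : (z, e) \in xs -> (iota1 z, e) \in ys.
  by move=> zxs; rewrite mem_rcons inE; apply/orP; right; apply/mapP; exists (z, e).
have x1ys : (x1, 1%N) \in ys by rewrite mem_rcons mem_head.
have towS : graded_iterated_ore_inj (rcons [seq (iota2 v.1, v.2) | v <- ys] (y, 1%N)).
  apply: (graded_iterated_ore_injS towR oreS) => // z e.
  rewrite mem_rcons inE => /orP[/eqP[-> ->]|/mapP[[u f] uxs [-> ->]]].
    rewrite sigmax deltax; split.
      by apply: subspaceZ; [apply: gr_subspace | apply: gr_gen].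
    by apply: gr_map w2 => z' e' zxs; apply/gr_gen/xs_ys.
  rewrite /= sigmab deltab; split; last exact: lin_span0.
  exact/gr_gen/xs_ys.
have yr r : y * iota2 r = iota2 (sigma r) * y + iota2 (delta r) by case: oreS.
exists S, [the {lrmorphism B -> S} of iota2 \o iota1], (iota2 x1), y; split.
- move: towS; rewrite /ys map_rcons -map_comp -cats1 -cats1 -catA /=.
  by congr (graded_iterated_ore_inj _).
- move=> b /=; split; first by rewrite -!rmorphM (poly_var_comm oreR).
  by rewrite yr sigmab deltab rmorph0 addr0.
- by rewrite yr sigmax deltax linearZ /= -scalerAl.
move=> F I idI f X Y f1 fM fXY YX.
have [|h [hi hx hM]] := liftR F I idI f X f1 fM.
  by move=> z e /fXY[].
have h1 : h 1 = 1 by rewrite -(rmorph1 iota1) hi.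
have comp r : ore_compatible sigma delta I h Y r.
  move: r; apply: (tower_subalgebra_ind towR).
    exact: (ore_compatible_subalgebra oreS).
  move=> z e; rewrite mem_rcons inE => /orP[/eqP[-> _]|/mapP[[u k] uxs [-> _]]].
    by rewrite /ore_compatible sigmax deltax linearZ /= hx hi -scalerAl.
  rewrite /ore_compatible /= sigmab deltab linear0 addr0 hi.
  by case: (fXY _ _ uxs).
have [g [_ gi gy gM]] := ore_lift oreS idI h1 hM comp.
exists g; split=> // [b|]; first by rewrite /= gi hi.
by rewrite gi hx.
Qed.

End Steps.

(** * A family with four degree one generators *)

Section ExampleFamily.
Variable K : fieldType.
Implicit Types (s a b : K).

Definition example_relations (F : algType K) (I : F -> Prop) s a b (z x1 x2 x3 x4 : F) :=
  [/\ [/\ eqI I (x1 * z) (z * x1), eqI I (x2 * z) (z * x2), eqI I (x3 * z) (z * x3)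
        & eqI I (x4 * z) (z * x4)],
      eqI I (x2 * x1) (s *: (x1 * x2) + z),
      [/\ eqI I (x3 * x1) (x1 * x3), eqI I (x3 * x2) (x2 * x3),
          eqI I (x4 * x1) (x1 * x4) & eqI I (x4 * x2) (x2 * x4)]
    & eqI I (x4 * x3) (x3 * x4 + (a *: z + b *: (x1 * x1)))].

Definition example_vars (A : Type) (z x1 x2 x3 x4 : A) : seq (A * nat) :=
  [:: (z, 2%N); (x1, 1%N); (x2, 1%N); (x3, 1%N); (x4, 1%N)].

(** The universal property of the algebra with these relations, again for maps
    that are multiplicative modulo an ideal. *)
Definition lifts_example (A : algType K) s a b (z x1 x2 x3 x4 : A) :=
  forall (F : algType K) (I : F -> Prop), is_ideal I -> forall Z X1 X2 X3 X4 : F,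
      example_relations I s a b Z X1 X2 X3 X4 -> exists g : {linear A -> F},
      [/\ g 1 = 1, [/\ g z = Z, g x1 = X1, g x2 = X2, g x3 = X3 & g x4 = X4]
        & forall u v : A, eqI I (g (u * v)) (g u * g v)].

Definition is_example (A : algType K) s a b (z x1 x2 x3 x4 : A) :=
  [/\ graded_iterated_ore_inj (example_vars z x1 x2 x3 x4),
      example_relations (fun u => u = 0) s a b z x1 x2 x3 x4
    & lifts_example s a b z x1 x2 x3 x4].

Lemma eq0I (F : algType K) (u v : F) : eqI (fun u => u = 0) u v <-> u = v.
Proof. by rewrite /eqI; split=> [/eqP|->]; rewrite ?subrr // subr_eq0 => /eqP. Qed.

Lemma commutant_subalgebra (A : algType K) (w : A) : is_subalgebra (fun u => w * u = u * w).
Proof.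
split; first split.
- by rewrite mulr0 mul0r.
- by move=> c u v hu hv; rewrite mulrDr mulrDl -scalerAl -scalerAr hu hv.
- by rewrite mulr1 mul1r.
by move=> u v hu hv; rewrite mulrA hu -mulrA hv mulrA.
Qed.

(** Two applications of [weyl_step] over K[z]: with w = z for x1 and x2, then
    with w = a z + b x1^2 for x3 and x4. The second w is central because x2
    x1^2 - x1^2 x2 = (1 + s) x1 z and b (1 + s) = 0. *)
Lemma example_family s a b : s * s = 1 -> b * (1 + s) = 0 ->
  exists (A : algType K) (z x1 x2 x3 x4 : A),
  is_example s a b z x1 x2 x3 x4.
Proof.
move=> s1 bs.
have [S1 [i1 [z [tow1 _ lift1]]]] := poly_step (d := 2) isT (graded_iterated_ore_inj0 K).
rewrite /= in tow1.
have zc u : z * u = u * z.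
  move: u; apply: (tower_subalgebra_ind tow1); first exact: commutant_subalgebra.
  by move=> u e; rewrite inE => /eqP[-> _].
have [|S2 [i2 [x1 [x2 [tow2 comm2 rel2 lift2]]]]] := weyl_step s1 tow1 zc.
  by apply: gr_gen; rewrite mem_head.
rewrite /= in tow2.
pose w := a *: i2 z + b *: (x1 * x1).
have [x1z x2z] := comm2 z.
have x2w : w * x2 = x2 * w.
  rewrite /w mulrDl mulrDr -!scalerAl -!scalerAr x2z; congr (_ + _).
  rewrite [x2 * (x1 * x1)]mulrA rel2 mulrDl -scalerAl -[x1 * x2 * x1]mulrA rel2.
  rewrite mulrDr -scalerAr -x1z [s *: (_ + _)]scalerDr (scalerA s s) s1 scale1r mulrA -addrA.
  by rewrite -{2}[x1 * i2 z]scale1r -scalerDl [s + 1]addrC scalerDr scalerA bs scale0r addr0.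
have wc u : w * u = u * w.
  move: u; apply: (tower_subalgebra_ind tow2); first exact: commutant_subalgebra.
  move=> u e; rewrite !inE => /or3P[] /eqP[-> _] //.
    by rewrite /w mulrDl mulrDr -!scalerAl -!scalerAr -mulrA x1z !mulrA x1z.
  by rewrite /w mulrDl mulrDr -!scalerAl -!scalerAr x1z mulrA.
have w2 : gr [:: (i2 z, 2%N); (x1, 1%N); (x2, 1%N)] 2 w.
  apply: (subspaceD (gr_subspace _ _)); apply: (subspaceZ _ (gr_subspace _ _)).
    by apply: gr_gen; rewrite mem_head.
  by apply: (grM (m := 1) (n := 1)); apply: gr_gen; rewrite !inE eqxx orbT.
have [S3 [i3 [x3 [x4 [tow3 comm3 rel3 lift3]]]]] := weyl_step (mulr1 (1 : K)) tow2 wc w2.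
exists S3, (i3 (i2 z)), (i3 x1), (i3 x2), x3, x4; split=> //.
  have c3 u := (comm3 u).1; have c4 u := (comm3 u).2.
  split; first split; try exact/eq0I.
  - by apply/eq0I; rewrite -!rmorphM x1z.
  - by apply/eq0I; rewrite -!rmorphM x2z.
  - by apply/eq0I; rewrite -rmorphM /= rel2 linearD linearZ /= rmorphM.
  - by split; apply/eq0I.
  by apply/eq0I; rewrite rel3 scale1r /w linearD !linearZ /= rmorphM.
move=> F I idI Z X1 X2 X3 X4 [[e1 e2 e3 e4] e21 [e31 e32 e41 e42] e43].
have [f [_ f1 fM]] := scalar_section idI.
have [//|g1 [g1i g1z g1M]] := lift1 F I idI f Z f1 fM.
have g11 : g1 1 = 1 by rewrite -(rmorph1 i1) g1i.
have [||g2 [g2i g2x1 g2x2 g2M]] := lift2 F I idI g1 X1 X2 g11 g1M.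
- by move=> u e; rewrite inE => /eqP[-> _]; rewrite g1z.
- by rewrite g1z.
have g21 : g2 1 = 1 by rewrite -(rmorph1 i2) g2i.
have [||g3 [g3i g3x3 g3x4 g3M]] := lift3 F I idI g2 X3 X4 g21 g2M.
- by move=> u e; rewrite !inE => /or3P[] /eqP[-> _]; rewrite ?g2i ?g1z ?g2x1 ?g2x2.
- rewrite scale1r; apply: (eqI_trans idI e43); apply: (eqID idI (eqI_refl idI _)).
  rewrite /w linearD !linearZ g2i g1z; apply: (eqID idI (eqI_refl idI _)).
  by apply: (eqIZ idI); apply: (eqI_sym idI); rewrite -g2x1; apply: g2M.
exists g3; split=> //; first by rewrite -(rmorph1 i3) g3i.
by rewrite !g3i g2i g2x1 g2x2.
Qed.

Lemma deg1_span_mul (A : algType K) (xs : seq (A * nat)) u v :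
  deg1_span xs u -> deg1_span xs v -> deg1_span xs (u * v).
Proof.
move=> hu hv; move: u hu; apply: deg1_span_ind => [||u w hu _].
- exact/subspace_mulr/lin_span_subspace.
- by rewrite mul1r.
by rewrite -mulrA; apply: deg1_spanM.
Qed.

(** The only variable of degree two is z = x2 x1 - s x1 x2. *)
Lemma example_as_ore (A : algType K) s a b (z x1 x2 x3 x4 : A) :
  is_example s a b z x1 x2 x3 x4 ->
  as_ore_extension (example_vars z x1 x2 x3 x4) /\ has_dim (gr (example_vars z x1 x2 x3 x4) 1) 4.
Proof.
move=> [tow [_ /eq0I rel _ _] _]; split; last exact: (tower_deg1_dim tow).
split=> // u; change (deg1_span (example_vars z x1 x2 x3 x4) u).
have one y : (y, 1%N) \in example_vars z x1 x2 x3 x4 -> deg1_span (example_vars z x1 x2 x3 x4) y.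
  by move=> yxs; rewrite -[y]mulr1; apply: deg1_spanM (deg1_span1 _); apply: gr_gen.
move: u; apply: (tower_subalgebra_ind tow).
  by split; [exact: lin_span_subspace | exact: deg1_span1 | exact: deg1_span_mul].
move=> y e; rewrite inE => /orP[/eqP[-> _]|ye]; last first.
  apply: one; move: ye; rewrite !inE.
  by case/or4P => /eqP[-> _]; rewrite eqxx ?orbT.
have zE : z = x2 * x1 - s *: (x1 * x2) by rewrite rel addrC addKr.
rewrite [X in deg1_span _ X]zE.
apply: (subspaceB (lin_span_subspace _)).
  by apply: deg1_span_mul; apply: one; rewrite !inE eqxx ?orbT.
apply: (subspaceZ _ (lin_span_subspace _)).
by apply: deg1_span_mul; apply: one; rewrite !inE eqxx ?orbT.
Qed.

End ExampleFamily.

(** * Relation types of the family *)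

Section MarkedRelations.
Variables (K : fieldType) (b : nat) (F : algType K) (y : 'I_b -> F) (wcoef : seq 'I_b -> F -> K).
Hypothesis fr : free_on y wcoef.

(** Relations are lists of terms, each a coefficient and a word, so that the
    conditions on words that follow are decided by computation. *)
Definition relation := seq (K * seq 'I_b).
Definition rel_val (p : relation) : F := \sum_(cs <- p) cs.1 *: word y cs.2.
Definition rel_words (p : relation) : seq (seq 'I_b) := unzip2 p.
Definition marker (p : relation) : seq 'I_b := head [::] (rel_words p).

Lemma rel_val_support p u : wcoef u (rel_val p) != 0 -> u \in rel_words p.
Proof.
apply: contraR => up; rewrite /rel_val (wcoef_sum fr) big_seq big1 // => -[c s] csp /=.
rewrite (wcoefZ fr) (wcoef_word fr); case: eqP => [su|_]; last by rewrite mulr0.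
by case/negP: up; apply/mapP; exists (c, s).
Qed.

Lemma rel_val_marker c m p : m \notin rel_words p -> wcoef m (rel_val ((c, m) :: p)) = c.
Proof.
move=> mp; rewrite /rel_val big_cons (wcoefD fr) (wcoefZ fr) (wcoef_word fr) eqxx mulr1.
have /eqP -> : wcoef m (rel_val p) == 0 by apply: contraNT mp; apply: rel_val_support.
by rewrite addr0.
Qed.

Lemma rel_val_homog n p : all (fun s => size s == n) (rel_words p) -> homog wcoef n (rel_val p).
Proof. by move=> /allP pn u /rel_val_support /pn /eqP. Qed.

Definition separated (p q : relation) : bool := all (fun u => ~~ infix u (marker p)) (rel_words q).

Definition well_marked (P : seq relation) : bool :=
  all (fun p => marker p \notin behead (rel_words p)) P &&
  all (fun i => all (fun j => (i == j) || separated (nth [::] P i) (nth [::] P j)) (iota 0 (size P)))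
    (iota 0 (size P)).

(** The coefficient of the marker of a relation is a linear functional that
    vanishes on the ideal generated by the other relations, none of whose
    words is a factor of the marker, and takes the value 1 on the relation
    itself. *)
Lemma marked_minimal (P : seq relation) (I : F -> Prop) :
  all (fun p => if p is (c, _) :: _ then c == 1 else false) P -> well_marked P ->
  generates_ideal (map rel_val P) I -> minimal_generating_set (map rel_val P) I.
Proof.
move=> /allP lead1 /andP[/allP mark /allP sep] gen.
have mark1 p : p \in P -> wcoef (marker p) (rel_val p) = 1.
  move=> pP; have := lead1 p pP; have := mark p pP; case: p {pP} => [//|[c m] p] /= mp /eqP ->.
  exact: rel_val_marker.
have coef0 i j : (i < size P)%N -> (j < size P)%N -> i != j -> forall s t,
    wcoef (marker (nth [::] P i)) (word y s * rel_val (nth [::] P j) * word y t) = 0.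
  move=> iP jP ij s t; apply/eqP; apply: contraT => /(wcoef_two_sided fr)[u mE /rel_val_support uj].
  have iI : i \in iota 0 (size P) by rewrite mem_iota.
  have jI : j \in iota 0 (size P) by rewrite mem_iota.
  have := allP (sep i iI) j jI; rewrite (negPf ij) /= => /allP/(_ u uj).
  by rewrite mE; case/negP; apply/infixP; exists s, t.
have neq i j : (i < size P)%N -> (j < size P)%N -> rel_val (nth [::] P i) = rel_val (nth [::] P j) -> i = j.
  move=> iP jP ijE; apply/eqP; apply: contraT => ij.
  have := coef0 i j iP jP ij [::] [::]; rewrite word_nil mul1r mulr1 -ijE mark1 ?mem_nth //.
  by move/eqP; rewrite oner_eq0.
split=> //.
  apply/(uniqP 0) => i j; rewrite !inE size_map => iP jP.
  by rewrite !(nth_map [::]) //; apply: neq.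
move=> H HG Hgen g /(nthP 0)[i]; rewrite size_map => iP; rewrite (nth_map [::]) // => <-.
apply: contraT => gH.
set p := nth [::] P i in gH *.
have gI : two_sided_ideal H (rel_val p).
  apply/Hgen/gen/two_sided_ideal_gen/mapP; exists p => //; exact: mem_nth.
suff : wcoef (marker p) (rel_val p) = 0 by rewrite mark1 ?mem_nth // => /eqP; rewrite oner_eq0.
move: (rel_val p) gI => f; move: f.
apply: lin_span_min => [|_ [u [h [w [hH ->]]]]].
  split=> [|c f f' hf hf']; first by rewrite (wcoef0 fr).
  by rewrite (wcoef_linear fr) hf hf' mulr0 addr0.
have /(nthP 0)[j] := HG h hH; rewrite size_map => jP; rewrite (nth_map [::]) // => hE.
have ij : i != j by apply: contraNneq gH => ijE; rewrite /p ijE hE.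
rewrite -hE.
move: u; apply: (free_ind fr) => [|s].
  split=> [|c f f' hf hf']; first by rewrite !mul0r (wcoef0 fr).
  by rewrite !mulrDl -!scalerAl (wcoef_linear fr) hf hf' mulr0 addr0.
move: w; apply: (free_ind fr) => [|t].
  split=> [|c f f' hf hf']; first by rewrite !mulr0 (wcoef0 fr).
  by rewrite !mulrDr -!scalerAr (wcoef_linear fr) hf hf' mulr0 addr0.
exact: coef0.
Qed.
End MarkedRelations.

Lemma commutant_mod (K : fieldType) (F : algType K) (I : F -> Prop) (w : F) : is_ideal I ->
  is_subalgebra (fun u => eqI I (w * u) (u * w)).
Proof.
move=> idI; split; first split.
- by rewrite mulr0 mul0r; apply: eqI_refl.
- move=> c u v hu hv; rewrite mulrDr mulrDl -scalerAl -scalerAr.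
  by apply: eqID => //; apply: eqIZ.
- by rewrite mulr1 mul1r; apply: eqI_refl.
move=> u v hu hv; rewrite mulrA; apply: (eqI_trans idI (v := u * w * v)); first exact: eqIMr.
by rewrite -!mulrA; apply: eqIMl.
Qed.

Section ExampleRelations.
Variable K : fieldType.

Definition o0 : 'I_4 := @Ordinal 4 0 isT.
Definition o1 : 'I_4 := @Ordinal 4 1 isT.
Definition o2 : 'I_4 := @Ordinal 4 2 isT.
Definition o3 : 'I_4 := @Ordinal 4 3 isT.

(** The first two generators commute with the last two, and [tail] is the
    further part of the relation between the last two, in which z has been
    replaced by a polynomial in the first two. *)
Definition quadratic_relations (tail : relation K 4) : seq (relation K 4) :=
  [:: [:: (1, [:: o2; o0]); (-1, [:: o0; o2])]; [:: (1, [:: o3; o0]); (-1, [:: o0; o3])];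
      [:: (1, [:: o2; o1]); (-1, [:: o1; o2])]; [:: (1, [:: o3; o1]); (-1, [:: o1; o3])];
      [:: (1, [:: o3; o2]), (-1, [:: o2; o3]) & tail]].

Section Val.
Variables (F : algType K) (y : 'I_4 -> F) (wcoef : seq 'I_4 -> F -> K).
Hypothesis fr : free_on y wcoef.

Variables (A : algType K) (s a b : K) (z x1 x2 x3 x4 : A).
Hypothesis relA : example_relations (fun u => u = 0) s a b z x1 x2 x3 x4.
Hypothesis liftA : lifts_example s a b z x1 x2 x3 x4.
Variable pi : {lrmorphism F -> A}.
Hypothesis piE : [/\ pi (y o0) = x1, pi (y o1) = x2, pi (y o2) = x3 & pi (y o3) = x4].

Let Z : F := y o1 * y o0 - s *: (y o0 * y o1).

Lemma pi_Z : pi Z = z.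
Proof.
case: piE relA => p0 p1 _ _ [_ /eq0I r _ _].
by rewrite /Z linearB linearZ !rmorphM /= p0 p1 r addrC addKr.
Qed.

Lemma word2 i j : word y [:: i; j] = y i * y j.
Proof. by rewrite /word !big_cons big_nil mulr1. Qed.
Lemma word3 i j k : word y [:: i; j; k] = y i * y j * y k.
Proof. by rewrite /word !big_cons big_nil mulr1 mulrA. Qed.

(** The algebra [A] satisfies the relations in [P]. Conversely its defining
    relations hold modulo [P], so that its universal property provides a map
    [g] back to [F] with [g (pi u)] congruent to [u]. *)
Lemma presentation (P : seq (relation K 4)) :
  (forall p, p \in P -> pi (rel_val y p) = 0) ->
  example_relations (two_sided_ideal (map (rel_val y) P)) s a b Z (y o0) (y o1) (y o2) (y o3) ->
  generates_ideal (map (rel_val y) P) (fun f => pi f = 0).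
Proof.
move=> P0 relF f; set G := map _ P; have idI := two_sided_ideal_is_ideal G.
split; last first.
  by move: f; apply: two_sided_ideal_min (kernel_ideal pi) _ => _ /mapP[p /P0 p0 ->].
have [g [g1 [_ gx1 gx2 gx3 gx4] gM]] := liftA idI relF.
have key u : eqI (two_sided_ideal G) u (g (pi u)).
  move: u; apply: (free_ind fr) => [|t].
    split=> [|c u v hu hv]; first by rewrite !linear0; apply: eqI_refl.
    by rewrite !linearP; apply: eqID => //; apply: eqIZ.
  elim: t => [|i t IH]; first by rewrite word_nil rmorph1 g1; apply: eqI_refl.
  rewrite -cat1s word_cat word1 rmorphM.
  apply: (eqI_trans idI (v := g (pi (y i)) * g (pi (word y t)))); last first.
    by apply: eqI_sym.
  apply: (eqIM idI) => //.
  have [p0 p1 p2 p3] := piE.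
  have -> : g (pi (y i)) = y i; last exact: eqI_refl.
  case: i => [[|[|[|[|i]]]] lt_i] //=.
  - by rewrite (_ : Ordinal lt_i = o0) ?p0 //; apply: val_inj.
  - by rewrite (_ : Ordinal lt_i = o1) ?p1 //; apply: val_inj.
  - by rewrite (_ : Ordinal lt_i = o2) ?p2 //; apply: val_inj.
  by rewrite (_ : Ordinal lt_i = o3) ?p3 //; apply: val_inj.
by move=> f0; have := key f; rewrite f0 linear0 /eqI subr0.
Qed.

Lemma commutator_val i j : rel_val y [:: (1, [:: i; j]); (-1, [:: j; i])] = y i * y j - y j * y i.
Proof. by rewrite /rel_val !big_cons big_nil !word2 /= scale1r scaleN1r addr0. Qed.

Lemma last_val tail : rel_val y [:: (1, [:: o3; o2]), (-1, [:: o2; o3]) & tail] =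
  y o3 * y o2 - y o2 * y o3 + rel_val y tail.
Proof. by rewrite /rel_val !big_cons !word2 /= scale1r scaleN1r addrA. Qed.

Lemma quadratic_relations_hold tail : pi (rel_val y tail) = - (a *: z + b *: (x1 * x1)) ->
  forall p, p \in quadratic_relations tail -> pi (rel_val y p) = 0.
Proof.
move=> tE p; case: piE relA => p0 p1 p2 p3 [_ _ [/eq0I r1 /eq0I r2 /eq0I r3 /eq0I r4] /eq0I r5].
have comm i j : pi (y i) * pi (y j) = pi (y j) * pi (y i) ->
    pi (rel_val y [:: (1, [:: i; j]); (-1, [:: j; i])]) = 0.
  by move=> cij; rewrite commutator_val linearB /= !rmorphM /= cij subrr.
rewrite !inE => /or4P[/eqP->|/eqP->|/eqP->|/orP[/eqP->|/eqP->]].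
- by apply: comm; rewrite p0 p2.
- by apply: comm; rewrite p0 p3.
- by apply: comm; rewrite p1 p2.
- by apply: comm; rewrite p1 p3.
rewrite last_val linearD linearB /= !rmorphM /= tE p2 p3 r5.
by rewrite [x3 * x4 + _]addrC addrK subrr.
Qed.

(** That [Z] commutes with the last two generators follows from the quadratic
    relations, as [Z] is a polynomial in the first two. *)
Lemma quadratic_relations_mod I tail : is_ideal I ->
  (forall p, p \in quadratic_relations tail -> I (rel_val y p)) ->
  rel_val y tail = - (a *: Z + b *: (y o0 * y o0)) ->
  eqI I (y o0 * Z) (Z * y o0) -> eqI I (y o1 * Z) (Z * y o1) ->
  example_relations I s a b Z (y o0) (y o1) (y o2) (y o3).
Proof.
move=> idI IP tE c0 c1.
have I1 : eqI I (y o2 * y o0) (y o0 * y o2).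
  by rewrite /eqI -commutator_val; apply: IP; rewrite !inE eqxx ?orbT.
have I2 : eqI I (y o3 * y o0) (y o0 * y o3).
  by rewrite /eqI -commutator_val; apply: IP; rewrite !inE eqxx ?orbT.
have I3 : eqI I (y o2 * y o1) (y o1 * y o2).
  by rewrite /eqI -commutator_val; apply: IP; rewrite !inE eqxx ?orbT.
have I4 : eqI I (y o3 * y o1) (y o1 * y o3).
  by rewrite /eqI -commutator_val; apply: IP; rewrite !inE eqxx ?orbT.
have I5 : eqI I (y o3 * y o2) (y o2 * y o3 + (a *: Z + b *: (y o0 * y o0))).
  rewrite /eqI opprD addrA -tE -last_val; apply: IP; rewrite !inE eqxx ?orbT //.
have cZ w : eqI I (w * y o0) (y o0 * w) -> eqI I (w * y o1) (y o1 * w) -> eqI I (w * Z) (Z * w).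
  case: (commutant_mod w idI) => sC _ CM C0 C1.
  exact: (subspaceB sC (CM _ _ C1 C0) (subspaceZ s sC (CM _ _ C0 C1))).
split=> //; last by rewrite /Z addrC subrK; apply: eqI_refl.
by split=> //; apply: cZ.
Qed.

End Val.
End ExampleRelations.

Section ExampleTypes.
Variable K : fieldType.
Local Notation quadratic_relations := (@quadratic_relations K).

Definition skew_commutator (F : algType K) (s : K) (u v : F) := v * u - s *: (u * v).

Section Mod.
Variables (F : algType K) (y : 'I_4 -> F) (I : F -> Prop).
Hypothesis idI : is_ideal I.
Variables (s a b : K) (tail : relation K 4).
Let Z := skew_commutator s (y o0) (y o1).
Hypothesis tE : rel_val y tail = - (a *: Z + b *: (y o0 * y o0)).
Hypothesis IP : forall p, p \in quadratic_relations tail -> I (rel_val y p).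

(** The commutator of the last two generators commutes with the first two, and
    it is equal to this expression modulo [I]. *)
Lemma tail_commutes i : i \in [:: o0; o1] -> 
  eqI I (y i * (a *: Z + b *: (y o0 * y o0))) ((a *: Z + b *: (y o0 * y o0)) * y i).
Proof.
move=> i01; set W := _ + _.
have comm j : j \in [:: o2; o3] -> eqI I (y i * y j) (y j * y i).
  move=> j23; apply: eqI_sym => //; rewrite /eqI -commutator_val; apply: IP.
  by move: i01 j23; rewrite !inE => /orP[] /eqP-> /orP[] /eqP->; rewrite eqxx ?orbT.
have TW : eqI I (y o3 * y o2 - y o2 * y o3) W.
  by rewrite /eqI -tE -last_val; apply: IP; rewrite !inE eqxx !orbT.
have [sC _ CM] := commutant_mod (y i) idI.
have CT : eqI I (y i * (y o3 * y o2 - y o2 * y o3)) ((y o3 * y o2 - y o2 * y o3) * y i).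
  have c2 : eqI I (y i * y o2) (y o2 * y i) by apply: comm; rewrite !inE eqxx.
  have c3 : eqI I (y i * y o3) (y o3 * y i) by apply: comm; rewrite !inE eqxx.
  exact: (subspaceB sC (CM _ _ c3 c2) (CM _ _ c2 c3)).
apply: (eqI_trans idI (v := y i * (y o3 * y o2 - y o2 * y o3))).
  by apply: eqIMl => //; apply: eqI_sym.
by apply: (eqI_trans idI CT); apply: eqIMr.
Qed.
End Mod.

Lemma all2_nseq (T : Type) (r : nat -> T -> bool) m (t : seq T) :
  all2 r (nseq (size t) m) t = all (r m) t.
Proof. by elim: t => //= x t ->. Qed.

Lemma all2_cat_nseq (T : Type) (r : nat -> T -> bool) m l (t u : seq T) :
  all2 r (nseq (size t) m ++ l) (t ++ u) = all (r m) t && all2 r l u.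
Proof. by elim: t => //= x t ->; rewrite andbA. Qed.

Lemma sorted_two_three_nseq i j : sorted leq (nseq i 2%N ++ nseq j 3%N).
Proof.
have p3 m n : (n <= 3)%N -> path leq n (nseq m 3%N) by elim: m n => //= m IH n ->; apply: IH.
have p2 m n : (n <= 2)%N -> path leq n (nseq m 2%N ++ nseq j 3%N).
  elim: m n => [|m IH] n n2 /=; first by apply/p3/leqW.
  by rewrite n2; apply: IH.
by case: i => [|i] /=; [case: j {p2} => [|j] //=; apply: p3 | apply: p2].
Qed.

Section Presentation.
Variables (A : algType K) (s a b : K) (z x1 x2 x3 x4 : A).
Variables (tail : relation K 4) (cubics : seq (relation K 4)).
Let P := quadratic_relations tail ++ cubics.
Let xs := example_vars z x1 x2 x3 x4.
Hypothesis ex : is_example s a b z x1 x2 x3 x4.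
Hypothesis tE : forall (F : algType K) (y : 'I_4 -> F), rel_val y tail =
  - (a *: skew_commutator s (y o0) (y o1) + b *: (y o0 * y o0)).
Hypothesis cub : forall (F : algType K) (y : 'I_4 -> F) (I : F -> Prop), is_ideal I ->
  let Z := skew_commutator s (y o0) (y o1) in
  eqI I (y o0 * Z) (Z * y o0) -> eqI I (y o1 * Z) (Z * y o1) ->
  forall p, p \in cubics -> I (rel_val y p).
Hypothesis comm : forall (F : algType K) (y : 'I_4 -> F) (I : F -> Prop), is_ideal I ->
  let Z := skew_commutator s (y o0) (y o1) in
  (forall p, p \in P -> I (rel_val y p)) ->
  eqI I (y o0 * Z) (Z * y o0) /\ eqI I (y o1 * Z) (Z * y o1).
Hypothesis lead : all (fun p : relation K 4 => if p is (c, _) :: _ then c == 1 else false) P.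
Hypothesis marked : well_marked P.
Hypothesis hom2 : all (fun p : relation K 4 => all (fun u => size u == 2%N) (rel_words p))
  (quadratic_relations tail).
Hypothesis hom3 : all (fun p : relation K 4 => all (fun u => size u == 3%N) (rel_words p)) cubics.

Lemma example_presentation (F : algType K) (y : 'I_4 -> F) wcoef : free_on y wcoef ->
  exists pi : {lrmorphism F -> A}, [/\ forall i, gr xs 1 (pi (y i)),
    forall u, exists f, pi f = u,
    minimal_generating_set (map (rel_val y) P) (fun f => pi f = 0),
    forall p, p \in quadratic_relations tail -> homog wcoef 2 (rel_val y p)
    & forall p, p \in cubics -> homog wcoef 3 (rel_val y p)].
Proof.
move=> fr; have [tow relA liftA] := ex.
pose v (i : 'I_4) : A := nth 0 [:: x1; x2; x3; x4] i.
have [pi piE] := free_eval fr v.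
have p0 : [/\ pi (y o0) = x1, pi (y o1) = x2, pi (y o2) = x3
    & pi (y o3) = x4] by split; rewrite piE.
have piZ : pi (skew_commutator s (y o0) (y o1)) = z := pi_Z relA p0.
have [pE0 pE1 pE2 pE3] := p0.
have ptail : pi (rel_val y tail) = - (a *: z + b *: (x1 * x1)).
  by rewrite tE linearN linearD !linearZ /= piZ rmorphM /= pE0.
have piP p : p \in P -> pi (rel_val y p) = 0.
  rewrite mem_cat => /orP[|pc]; first exact: (quadratic_relations_hold relA p0 ptail).
  have [[/eq0I e1 /eq0I e2 _ _] _ _ _] := relA.
  apply: (cub (kernel_ideal pi) _ _ pc); rewrite /eqI linearB /= !rmorphM /= piZ.
    by rewrite pE0 e1 subrr.
  by rewrite pE1 e2 subrr.
have idG := two_sided_ideal_is_ideal (map (rel_val y) P).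
have inG p : p \in P -> two_sided_ideal (map (rel_val y) P) (rel_val y p).
  by move=> pP; apply/two_sided_ideal_gen/map_f.
have [c0 c1] := comm idG inG.
have relF : example_relations (two_sided_ideal (map (rel_val y) P)) s a b
    (skew_commutator s (y o0) (y o1)) (y o0) (y o1) (y o2) (y o3).
  apply: (quadratic_relations_mod idG (tail := tail)) => // p pq.
  by apply: inG; rewrite mem_cat pq.
have gen := presentation fr liftA p0 piP relF.
exists pi; split.
- move=> i; rewrite piE; apply: gr_gen; case: i => [[|[|[|[|i]]]] lt_i] //=;
  by rewrite !inE /v /= eqxx ?orbT.
- apply: (tower_subalgebra_ind tow (subalgebra_image pi)) => u e.
  rewrite !inE => /or4P[/eqP[-> _]|/eqP[-> _]|/eqP[-> _]|/orP[/eqP[-> _]|/eqP[-> _]]].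
  + by exists (skew_commutator s (y o0) (y o1)).
  + by exists (y o0).
  + by exists (y o1).
  + by exists (y o2).
  by exists (y o3).
- exact: (marked_minimal fr lead marked gen).
- by move=> p pq; apply: (rel_val_homog fr); apply: (allP hom2).
by move=> p pq; apply: (rel_val_homog fr); apply: (allP hom3).
Qed.

Lemma example_has_relation_type :
  has_relation_type xs (nseq 5 2%N ++ nseq (size cubics) 3%N).
Proof.
have [pi [pi1 pis min h2 h3]] := example_presentation (free_alg_free_on K 4).
exists 4%N, pi, (map (rel_val (F := free_algebra K 4) (@free_var K 4)) P); split=> //.
  by case: (example_as_ore ex).
rewrite sorted_two_three_nseq andbT /P map_cat.
rewrite -[5%N]/(size (map (rel_val (F := free_algebra K 4) (@free_var K 4)) (quadratic_relations tail))).
rewrite all2_cat_nseq.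
rewrite -(size_map (rel_val (F := free_algebra K 4) (@free_var K 4))) all2_nseq; apply/andP; split.
  by apply/allP => _ /mapP[p pq ->]; apply/free_homogE/h2.
by apply/allP => _ /mapP[p pq ->]; apply/free_homogE/h3.
Qed.
End Presentation.

(** Tail and cubic relations for the parameters (s, a, b) = (1, 1, 0), (-1, 0,
    1) and (1, 0, 0). The cubic relations express that z commutes with x1 and
    x2, as far as this does not follow from the quadratic ones. By
    [tail_commutes] it follows entirely if the tail is -z, and for x1 alone if
    s = -1 and the tail is -x1^2, because then z x1 - x1 z = x2 x1^2 - x1^2
    x2. If the tail vanishes, nothing follows. A coefficient -2 is written as
    two terms, which keeps the data the same in every characteristic. *)
Definition relations0 : relation K 4 * seq (relation K 4) :=
  ([:: (-1, [:: o1; o0]); (1, [:: o0; o1])], [::]).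
Definition relations1 : relation K 4 * seq (relation K 4) :=
  ([:: (-1, [:: o0; o0])], [:: [:: (1, [:: o0; o1; o1]); (-1, [:: o1; o1; o0])]]).
Definition relations2 : relation K 4 * seq (relation K 4) :=
  ([::], [:: [:: (1, [:: o1; o0; o0]); (-1, [:: o0; o1; o0]); (-1, [:: o0; o1; o0]); (1, [:: o0; o0; o1])];
             [:: (1, [:: o1; o1; o0]); (-1, [:: o1; o0; o1]); (-1, [:: o1; o0; o1]); (1, [:: o0; o1; o1])]]).

Lemma example0_type (A : algType K) (z x1 x2 x3 x4 : A) : is_example 1 1 0 z x1 x2 x3 x4 ->
  has_relation_type (example_vars z x1 x2 x3 x4) [:: 2; 2; 2; 2; 2]%N.
Proof.
move=> ex; apply: (@example_has_relation_type _ 1 1 0 _ _ _ _ _ relations0.1 relations0.2) => //.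
- move=> F y; rewrite /rel_val !big_cons big_nil !word2 /skew_commutator /=.
  by rewrite scale0r !addr0 !scale1r scaleN1r opprB addrC.
- move=> F y I idI Z IP.
  have tE : rel_val y relations0.1 = - (1 *: Z + 0 *: (y o0 * y o0)).
    rewrite /rel_val !big_cons big_nil !word2 /Z /skew_commutator /=.
    by rewrite scale0r !addr0 !scale1r scaleN1r opprB addrC.
  have IPq p : p \in quadratic_relations relations0.1 -> I (rel_val y p).
    by move=> pq; apply: IP; rewrite mem_cat pq.
  have := tail_commutes idI tE IPq; rewrite scale1r scale0r addr0 => c.
  by split; apply: c; rewrite !inE eqxx ?orbT.
- by rewrite /= !eqxx.
Qed.

Lemma example1_type (A : algType K) (z x1 x2 x3 x4 : A) : is_example (-1) 0 1 z x1 x2 x3 x4 ->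
  has_relation_type (example_vars z x1 x2 x3 x4) [:: 2; 2; 2; 2; 2; 3]%N.
Proof.
have cE (F : algType K) (y : 'I_4 -> F) : let Z := skew_commutator (-1) (y o0) (y o1) in
    rel_val y [:: (1, [:: o0; o1; o1]); (-1, [:: o1; o1; o0])] = Z * y o1 - y o1 * Z.
  rewrite /rel_val !big_cons big_nil !word3 /skew_commutator /= scale1r !scaleN1r opprK addr0.
  rewrite mulrDl mulrDr !mulrA [y o1 * y o1 * y o0 + _]addrC opprD addrA.
  by rewrite [_ + y o0 * y o1 * y o1]addrC addrK.
move=> ex; apply: (@example_has_relation_type _ (-1) 0 1 _ _ _ _ _ relations1.1 relations1.2) => //.
- move=> F y; rewrite /rel_val !big_cons big_nil !word2 /=.
  by rewrite scale0r add0r addr0 !scale1r scaleN1r.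
- move=> F y I idI Z _ c1 p; rewrite inE => /eqP->; rewrite cE.
  by have := eqI_sym idI c1.
- move=> F y I idI Z IP.
  have tE : rel_val y relations1.1 = - (0 *: Z + 1 *: (y o0 * y o0)).
    rewrite /rel_val !big_cons big_nil !word2 /=.
    by rewrite scale0r add0r addr0 !scale1r scaleN1r.
  have IPq p : p \in quadratic_relations relations1.1 -> I (rel_val y p).
    by move=> pq; apply: IP; rewrite mem_cat pq.
  have := tail_commutes idI tE IPq; rewrite scale1r scale0r add0r => c.
  split; last first.
    apply: eqI_sym => //; rewrite /eqI -cE; apply: IP.
    by rewrite mem_cat !inE eqxx !orbT.
  apply: eqI_sym => //; rewrite /eqI.
  have -> : Z * y o0 - y o0 * Z = y o1 * (y o0 * y o0) - y o0 * y o0 * y o1.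
    rewrite /Z /skew_commutator scaleN1r opprK mulrDl mulrDr !mulrA opprD.
    by rewrite addrA addrK.
  by apply: c; rewrite !inE eqxx orbT.
- by rewrite /= !eqxx.
Qed.

Lemma example2_type (A : algType K) (z x1 x2 x3 x4 : A) : is_example 1 0 0 z x1 x2 x3 x4 ->
  has_relation_type (example_vars z x1 x2 x3 x4) [:: 2; 2; 2; 2; 2; 3; 3]%N.
Proof.
have cE0 (F : algType K) (y : 'I_4 -> F) : let Z := skew_commutator 1 (y o0) (y o1) in
    rel_val y (nth [::] relations2.2 0) = Z * y o0 - y o0 * Z.
  rewrite /rel_val !big_cons big_nil !word3 /skew_commutator /= !scale1r !scaleN1r addr0.
  by rewrite mulrBl mulrBr !mulrA opprB -!addrA; congr (_ + (_ + _)); rewrite addrC.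
have cE1 (F : algType K) (y : 'I_4 -> F) : let Z := skew_commutator 1 (y o0) (y o1) in
    rel_val y (nth [::] relations2.2 1) = y o1 * Z - Z * y o1.
  rewrite /rel_val !big_cons big_nil !word3 /skew_commutator /= !scale1r !scaleN1r addr0.
  by rewrite mulrBl mulrBr !mulrA opprB -!addrA; congr (_ + (_ + _)); rewrite addrC.
move=> ex; apply: (@example_has_relation_type _ 1 0 0 _ _ _ _ _ relations2.1 relations2.2) => //.
- by move=> F y; rewrite /rel_val big_nil !scale0r addr0 oppr0.
- move=> F y I idI Z c0 c1 p; rewrite !inE => /orP[] /eqP->.
    by have := eqI_sym idI c0; rewrite /eqI -cE0.
  by move: c1; rewrite /eqI -cE1.
- move=> F y I idI Z IP; split.
    apply: eqI_sym => //; rewrite /eqI -cE0; apply: IP.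
    by rewrite mem_cat !inE eqxx !orbT.
  rewrite /eqI -cE1; apply: IP.
  by rewrite mem_cat !inE eqxx !orbT.
- by rewrite /= !eqxx.
Qed.
End ExampleTypes.

(** * Graded Lie algebras *)

Section LieBasics.
Variables (K : fieldType) (L : vectType K) (br : L -> L -> L).
Hypothesis lie : is_lie_bracket br.

Lemma br_linr x c u v : br x (c *: u + v) = c *: br x u + br x v.
Proof. by case: lie => l _ _ _; apply: l. Qed.
Lemma br_linl x c u v : br (c *: u + v) x = c *: br u x + br v x.
Proof. by case: lie => _ l _ _; apply: (l x). Qed.
Lemma brxx x : br x x = 0.
Proof. by case: lie. Qed.
Lemma br0r x : br x 0 = 0.
Proof. by have := br_linr x (-1) 0 0; rewrite scaler0 addr0 scaleN1r addNr. Qed.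
Lemma br0l x : br 0 x = 0.
Proof. by have := br_linl x (-1) 0 0; rewrite scaler0 addr0 scaleN1r addNr. Qed.
Lemma brDr x u v : br x (u + v) = br x u + br x v.
Proof. by rewrite -[u]scale1r br_linr !scale1r. Qed.
Lemma brDl x u v : br (u + v) x = br u x + br v x.
Proof. by rewrite -[u]scale1r br_linl !scale1r. Qed.
Lemma brZr x c u : br x (c *: u) = c *: br x u.
Proof. by rewrite -[c *: u]addr0 br_linr br0r addr0. Qed.
Lemma brZl x c u : br (c *: u) x = c *: br u x.
Proof. by rewrite -[c *: u]addr0 br_linl br0l addr0. Qed.
Lemma brC x y : br x y = - br y x.
Proof.
have := brxx (x + y); rewrite brDl !brDr !brxx add0r addr0 => /eqP.
by rewrite addr_eq0 => /eqP.
Qed.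

(** By bilinearity and antisymmetry it suffices to treat each pair of vectors
    of a spanning list in one order. *)
Lemma lie_to_assoc_basis (B : algType K) (f : {linear L -> B}) (X : seq L) :
  <<X>>%VS = fullv ->
  pairwise (fun y x => f (br x y) == f x * f y - f y * f x) X -> lie_to_assoc br f.
Proof.
move=> spX pw.
have key x y : x \in X -> y \in X -> f (br x y) = f x * f y - f y * f x.
  elim: X {spX} pw => [|w X IH] //= /andP[/allP aw pw]; rewrite !inE.
  case/orP => [/eqP->|xX]; case/orP => [/eqP->|yX].
  - by rewrite brxx linear0 subrr.
  - by rewrite brC linearN /= (eqP (aw _ yX)) opprB.
  - exact/eqP/aw.
  - exact: IH.
move=> x y; have := memvf y; rewrite -spX; move: y; apply: span_ind.
  split=> [|c u v hu hv]; first by rewrite br0r linear0 mulr0 mul0r subrr.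
  rewrite br_linr linearP hu hv linearP mulrDr mulrDl -scalerAr -scalerAl scalerBr.
  by rewrite opprD addrACA.
move=> y yX; have := memvf x; rewrite -spX; move: x; apply: span_ind.
  split=> [|c u v hu hv]; first by rewrite br0l linear0 mulr0 mul0r subrr.
  rewrite br_linl linearP hu hv linearP mulrDr mulrDl -scalerAr -scalerAl scalerBr.
  by rewrite opprD addrACA.
by move=> x xX; apply: key.
Qed.
End LieBasics.

Section StandardLie.
Variables (K : fieldType) (a : K).
Local Notation L := ('rV[K]_5 : vectType K).

Definition i0 : 'I_5 := @Ordinal 5 0 isT.
Definition i1 : 'I_5 := @Ordinal 5 1 isT.
Definition i2 : 'I_5 := @Ordinal 5 2 isT.
Definition i3 : 'I_5 := @Ordinal 5 3 isT.
Definition i4 : 'I_5 := @Ordinal 5 4 isT.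

Definition std_vec (i : 'I_5) : 'rV[K]_5 := delta_mx 0 i.

Definition std_form (u v : 'rV[K]_5) : K :=
  (u 0 i2 * v 0 i1 - u 0 i1 * v 0 i2) + a * (u 0 i4 * v 0 i3 - u 0 i3 * v 0 i4).
(** In the basis z, x1, x2, x3, x4 the nonzero brackets are [x2, x1] = z and
    [x4, x3] = a z. *)
Definition std_br (u v : 'rV[K]_5) : 'rV[K]_5 := std_form u v *: std_vec i0.

Lemma std_form_linr u c v w : std_form u (c *: v + w) = c * std_form u v + std_form u w.
Proof. by rewrite /std_form !mxE; ring. Qed.
Lemma std_form_linl u c v w : std_form (c *: v + w) u = c * std_form v u + std_form w u.
Proof. by rewrite /std_form !mxE; ring. Qed.
Lemma std_form_vec0 u : std_form u (std_vec i0) = 0.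
Proof. by rewrite /std_form /std_vec !mxE /= !mulr0 subrr mulr0 addr0. Qed.

Lemma std_lie : is_lie_bracket std_br.
Proof.
split=> [x c u v|x c u v|x|x y z].
- by rewrite /std_br std_form_linr scalerDl scalerA.
- by rewrite /std_br std_form_linl scalerDl scalerA.
- by rewrite /std_br (_ : std_form x x = 0) ?scale0r // /std_form; ring.
have brev u c : std_br u (c *: std_vec i0) = 0.
  have := std_form_linr u c (std_vec i0) 0; rewrite addr0 std_form_vec0 mulr0 add0r /std_br => ->.
  by rewrite /std_form !mxE !mulr0 subrr mulr0 addr0 scale0r.
by rewrite !brev !addr0.
Qed.

Definition std_basis : 5.-tuple 'rV[K]_5 := [tuple std_vec i0; std_vec i1; std_vec i2; std_vec i3; std_vec i4].
Definition std_degrees : 5.-tuple nat := [tuple 2; 1; 1; 1; 1]%N.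

Lemma std_decomp (u : 'rV[K]_5) :
  u = u 0 i0 *: std_vec i0 + u 0 i1 *: std_vec i1 + u 0 i2 *: std_vec i2 + u 0 i3 *: std_vec i3 + u 0 i4 *: std_vec i4.
Proof.
rewrite [LHS]row_sum_delta !big_ord_recr big_ord0 /= add0r.
by do !congr (_ + _); congr (u 0 _ *: delta_mx 0 _); apply: val_inj.
Qed.

Lemma std_span : <<std_basis>>%VS = fullv.
Proof.
apply/eqP; rewrite eqEsubv subvf; apply/subvP => u _; rewrite (std_decomp u).
by do 4?[apply: memvD]; apply/memvZ/memv_span; rewrite !inE eqxx ?orbT.
Qed.

Lemma std_graded : is_graded_lie std_br std_basis std_degrees.
Proof.
split.
- exact: std_lie.
- by rewrite basisEdim std_span subvv /= dimvf.
- by case=> [[|[|[|[|[|i]]]]] lt_i].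
move=> i j; rewrite /std_br.
case: (eqVneq (tnth std_degrees j + tnth std_degrees i)%N 2%N) => [->|dij].
  apply/memvZ/memv_span/mapP; exists i0 => //.
  by rewrite mem_filter mem_enum eqxx.
suff -> : std_form (tnth std_basis j) (tnth std_basis i) = 0 by rewrite scale0r mem0v.
have tE k : tnth std_basis k = std_vec k.
  by case: k => [[|[|[|[|[|k]]]]] lt_k] //; rewrite /tnth /=; congr (delta_mx 0 _); apply: val_inj.
rewrite !tE.
have dE k : k != i0 -> tnth std_degrees k = 1%N.
  by case: k => [[|[|[|[|[|k]]]]] lt_k].
have [->|ni] := eqVneq i i0; first exact: std_form_vec0.
have [->|nj] := eqVneq j i0; last by rewrite !dE in dij.
by rewrite /std_form /std_vec !mxE /= !mul0r subrr mulr0 addr0.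
Qed.

Section Enveloping.
Variables (A : algType K) (z x1 x2 x3 x4 : A).
Hypothesis ex : is_example 1 a 0 z x1 x2 x3 x4.

Definition std_vals : seq A := [:: z; x1; x2; x3; x4].
Definition std_iota : {linear 'rV[K]_5 -> A} := lincomb (fun i : 'I_5 => std_vals`_i).

Lemma std_iota_vec i : std_iota (std_vec i) = std_vals`_i.
Proof. exact: lincomb_delta. Qed.

Lemma std_br_vec i j : std_br (std_vec i) (std_vec j) =
  (((i == i2) && (j == i1))%:R - ((i == i1) && (j == i2))%:R
   + a * (((i == i4) && (j == i3))%:R - ((i == i3) && (j == i4))%:R)) *: std_vec i0.
Proof.
rewrite /std_br /std_form /std_vec !mxE /= -!natrM !mulnb.
by do !congr (_ *: _); rewrite ![i == _]eq_sym ![j == _]eq_sym.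
Qed.

Lemma std_lie_to_assoc (B : algType K) (f : {linear 'rV[K]_5 -> B}) :
  example_relations (fun u => u = 0) 1 a 0 (f (std_vec i0)) (f (std_vec i1)) (f (std_vec i2)) (f (std_vec i3)) (f (std_vec i4)) ->
  lie_to_assoc std_br f.
Proof.
move=> [[/eq0I e1 /eq0I e2 /eq0I e3 /eq0I e4] /eq0I e21 [/eq0I e31 /eq0I e32 /eq0I e41 /eq0I e42]].
move=> /eq0I e43.
apply: (lie_to_assoc_basis std_lie std_span).
rewrite /= !std_br_vec /= !subr0 !mulr0 !addr0 !scale0r !linear0.
rewrite e1 e2 e3 e4 e31 e32 e41 e42 e21 e43 !subrr !eqxx /=.
by rewrite !add0r mulr1 !scale1r scale0r addr0 linearZ /= ![_ + f _]addrC ![_ + a *: _]addrC !addrK !eqxx.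
Qed.

Lemma lie_to_assoc_std (B : algType K) (f : {linear 'rV[K]_5 -> B}) :
  lie_to_assoc std_br f ->
  example_relations (fun u => u = 0) 1 a 0 (f (std_vec i0)) (f (std_vec i1)) (f (std_vec i2)) (f (std_vec i3)) (f (std_vec i4)).
Proof.
move=> fl.
have rel i j c : std_br (std_vec i) (std_vec j) = c *: std_vec i0 ->
    f (std_vec i) * f (std_vec j) = f (std_vec j) * f (std_vec i) + c *: f (std_vec i0).
  by move=> brE; have := fl (std_vec i) (std_vec j); rewrite brE linearZ /= => ->; rewrite addrC subrK.
have rel0 i j : std_br (std_vec i) (std_vec j) = 0 *: std_vec i0 -> f (std_vec i) * f (std_vec j) = f (std_vec j) * f (std_vec i).
  by move/rel; rewrite scale0r addr0.
have E i j c : (((i == i2) && (j == i1))%:R - ((i == i1) && (j == i2))%:R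
   + a * (((i == i4) && (j == i3))%:R - ((i == i3) && (j == i4))%:R)) = c ->
   std_br (std_vec i) (std_vec j) = c *: std_vec i0 by move=> <-; apply: std_br_vec.
split; first split; try (apply/eq0I/rel0/E => /=; by rewrite !subr0 mulr0 addr0).
- apply/eq0I; rewrite scale1r -[f (std_vec i0)]scale1r; apply/rel/E => /=.
  by rewrite !subr0 mulr0 addr0.
- by split; apply/eq0I/rel0/E => /=; rewrite !subr0 mulr0 addr0.
apply/eq0I; rewrite scale0r addr0; apply/rel/E => /=.
by rewrite !subr0 mulr1 add0r.
Qed.

(** A Lie algebra map to [B] is a choice of images of the basis that satisfies
    the relations of the example, and these are the algebra maps from the
    example to [B]. *)
Lemma std_enveloping : is_enveloping_algebra std_br std_iota.
Proof.
have [tow rel lift] := ex; split.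
  by apply: std_lie_to_assoc; rewrite /= !std_iota_vec.
move=> B f /lie_to_assoc_std relB.
have [g [g1 [gz gx1 gx2 gx3 gx4] gM]] := lift B _ (zero_ideal B) _ _ _ _ _ relB.
have {}gM : {morph g : u v / u * v} by move=> u v; apply/eq0I.
have gl : linear g by move=> c u v; rewrite linearP.
have [h hE] := lrmorphism_of gl g1 gM.
have hf u : h (std_iota u) = f u.
  have := memvf u; rewrite -std_span; move: u; apply: span_ind.
    exact: (@subspace_eq _ _ _ [the {linear _ -> _} of h \o std_iota] f).
  move=> u; rewrite !inE => /or4P[/eqP->|/eqP->|/eqP->|/orP[/eqP->|/eqP->]];
  by rewrite hE std_iota_vec.
exists h; split=> // k kf.
apply: (tower_subalgebra_ind tow (subalgebra_equalizer k h)).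
have kh i : k (std_vals`_i) = h (std_vals`_i).
  have [i5|i5] := ltnP i 5; last by rewrite nth_default ?linear0.
  have := kf (std_vec (Ordinal i5)); rewrite /= std_iota_vec => ->.
  by rewrite -hf /= std_iota_vec.
move=> y e ye; have /(nthP 0)[i _ <-] : y \in std_vals.
  by have := map_f fst ye.
exact: kh.
Qed.

Lemma std_enveloping_type l : has_relation_type (example_vars z x1 x2 x3 x4) l ->
  enveloping_relation_type K 5 4 l.
Proof.
move=> rel; have [[tow gen] dim1] := example_as_ore ex.
exists 'rV[K]_5, std_br, std_basis, std_degrees, A, std_iota => xs.
have -> : xs = example_vars z x1 x2 x3 x4.
  by rewrite /xs /= !std_iota_vec.
split=> //; [exact: std_graded | exact: std_enveloping].
Qed.
End Enveloping.

End StandardLie.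

Lemma has_relation_type_iso (K : fieldType) (U A : algType K) (xs : seq (U * nat)) (ys : seq (A * nat))
    (h : {lrmorphism U -> A}) (g : {lrmorphism A -> U}) l :
  cancel g h -> cancel h g -> (forall b, has_dim (gr xs 1) b -> has_dim (gr ys 1) b) ->
  (forall u, gr xs 1 u -> gr ys 1 (h u)) ->
  has_relation_type xs l -> has_relation_type ys l.
Proof.
move=> gK hK hdim hgr [b [pi [G [dimb pi1 pis [uG Ggen Gmin] hl]]]].
exists b, [the {lrmorphism free_alg K b -> A} of h \o pi], G; split=> //.
- exact: hdim.
- by move=> i; apply/hgr/pi1.
- by move=> a; have [f fE] := pis (g a); exists f; rewrite /= fE gK.
have kerE f : h (pi f) = 0 <-> pi f = 0.
  by split=> [h0|->]; [rewrite -[pi f]hK h0 linear0 | rewrite linear0].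
split=> // [f|H HG Hgen].
  by split=> [/kerE/Ggen //|/Ggen/kerE].
by apply: Gmin => // f; split=> [/kerE/Hgen //|/Hgen/kerE].
Qed.

Section GradedLie.
Variables (K : fieldType) (L : vectType K) (br : L -> L -> L).
Variables (e : 5.-tuple L) (d : 5.-tuple nat).
Hypothesis graded : is_graded_lie br e d.
Variables (U : algType K) (iota : {linear L -> U}).
Hypothesis env : is_enveloping_algebra br iota.
Let xs := zip (map iota e) d.
Hypothesis gen1 : generated_in_degree_one xs.
Hypothesis dim1 : has_dim (gr xs 1) 4.

Let lie : is_lie_bracket br. Proof. by case: graded. Qed.
Let basis : basis_of fullv e. Proof. by case: graded. Qed.
Let dpos i : (0 < tnth d i)%N. Proof. by case: graded. Qed.

Lemma mem_lie_gens w n : reflect (exists2 i, w = iota (tnth e i) & n = tnth d i) ((w, n) \in xs).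
Proof.
have sz : size (map iota e) = size d by rewrite size_map !size_tuple.
apply: (iffP (nthP (0, 0%N))) => [[j]|[i -> ->]].
  rewrite size_zip -sz minnn size_map size_tuple => j5; rewrite nth_zip // => -[<- <-].
  exists (Ordinal j5); last by rewrite (tnth_nth 0%N).
  by rewrite (nth_map 0) ?size_tuple // (tnth_nth 0).
exists i; first by rewrite size_zip -sz minnn size_map size_tuple.
by rewrite nth_zip // (nth_map 0) ?size_tuple // -!tnth_nth.
Qed.

Lemma lie_gens_pos y : y \in xs -> (0 < y.2)%N.
Proof. by case: y => w n /mem_lie_gens[i _ ->]; apply: dpos. Qed.

Lemma lie_gr1_ind (Q : U -> Prop) : is_subspace Q ->
  (forall i, tnth d i = 1%N -> Q (iota (tnth e i))) -> forall u, gr xs 1 u -> Q u.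
Proof.
move=> sQ Qe; apply: (gr_1_ind lie_gens_pos sQ) => y /mem_lie_gens[i -> di].
by apply: Qe.
Qed.

Lemma lie_gr_gen i : tnth d i = 1%N -> gr xs 1 (iota (tnth e i)).
Proof. by move=> di; apply/gr_gen/mem_lie_gens; exists i. Qed.

(** The degree one piece has dimension four and is spanned by the images of
    the basis vectors of degree one. *)
Lemma lie_deg1_card : (4 <= #|[pred i : 'I_5 | tnth d i == 1%N]|)%N.
Proof.
pose J := enum [pred i : 'I_5 | tnth d i == 1%N].
have mJ i : (i \in J) = (tnth d i == 1%N) by rewrite mem_enum.
rewrite cardE -/J.
pose X j := iota (tnth e (nth i0 J j)).
have [||Kf [_ dimK]] := ker_dim (f := lincomb (fun j : 'I_(size J) => X j)) (gr_subspace xs 1) dim1.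
- move=> r; apply: (subspace_sum _ (gr_subspace xs 1)) => j _.
  apply: (subspaceZ _ (gr_subspace xs 1)); apply: lie_gr_gen; apply/eqP.
  by rewrite -mJ mem_nth.
- apply: lie_gr1_ind => [|i /eqP].
    exact: subspace_image.
  rewrite -mJ => iJ; have jJ : (index i J < size J)%N by rewrite index_mem.
  by exists (delta_mx 0 (Ordinal jJ)); rewrite /= lincomb_delta /X nth_index.
by move: dimK; rewrite /dim /=; lia.
Qed.

Lemma lie_exceptional : exists p : 'I_5, forall i, i != p -> tnth d i = 1%N.
Proof.
pose D := [pred i : 'I_5 | tnth d i == 1%N].
have c4 : (4 <= #|D|)%N by apply: lie_deg1_card.
have /card_le1_eqP c1 : (#|[predC D]| <= 1)%N.
  by rewrite -(leq_add2l #|D|) cardC card_ord; apply: leq_add c4 _.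
case: (pickP [predC D]) => [p dp|d1]; last first.
  by exists i0 => i _; apply/eqP; have := d1 i; rewrite /= => /negbFE.
exists p => i; apply: contraNeq => di.
by apply/eqP/c1; rewrite ?inE.
Qed.

Lemma coord_basis_e q i : coord e q (tnth e i) = (i == q)%:R.
Proof. by rewrite (tnth_nth 0) coord_free ?(basis_free basis) // eq_sym. Qed.

(** If the bracket vanished, each basis vector would have a homomorphism from
    U to the polynomial ring sending it to the variable and the other basis
    vectors to 0. If all degrees were one, these homomorphisms would show that
    five elements of degree one are independent. Otherwise the homomorphism of
    the vector of higher degree would kill all elements of degree one, and
    with them the linear coefficients of everything that they generate. *)
Lemma lie_nonabelian : ~ (forall x y, br x y = 0).
Proof.
move=> ab; have [p dp] := lie_exceptional.
have char q : exists g : {lrmorphism U -> {poly K}}, forall v, g (iota v) = coord e q v *: 'X.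
  have fl : linear (fun v => coord e q v *: 'X : {poly K}).
    by move=> c u v; rewrite linearP scalerDl scalerA.
  pose f : {linear L -> {poly K}} := HB.pack (fun v => coord e q v *: 'X : {poly K})
    (GRing.isLinear.Build _ _ _ _ _ fl).
  have [|g [gE _]] := env.2 [the algType K of {poly K}] f.
    by move=> x y; rewrite ab linear0 mulrC subrr.
  by exists g.
have [dp1|dp1] := eqVneq (tnth d p) 1%N.
  have d1 i : tnth d i = 1%N by have [->//|/dp] := eqVneq i p.
  have [||Kf [memK dimK]] := ker_dim (f := lincomb (fun j => iota (tnth e j))) (gr_subspace xs 1) dim1.
  - move=> r; apply: (subspace_sum _ (gr_subspace xs 1)) => j _.
    by apply: (subspaceZ _ (gr_subspace xs 1)); apply: lie_gr_gen.
  - apply: lie_gr1_ind => [|i _].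
      exact: subspace_image.
    by exists (delta_mx 0 i); rewrite /= lincomb_delta.
  suff K0 : Kf = 0%VS by move: dimK; rewrite K0 dimv0 /dim /=; lia.
  apply/eqP; rewrite -subv0; apply/subvP => r; rewrite memK memv0 => /eqP r0.
  apply/eqP/rowP => q; rewrite mxE; have [g gE] := char q.
  have := congr1 g r0; rewrite /= /lincomb linear0 linear_sum (bigD1 q) //= big1 => [|j jq].
    rewrite addr0 linearZ /= gE coord_basis_e eqxx scale1r => /(congr1 (coefp 1)) /=.
    by rewrite coefZ coefX coef0 mulr1.
  by rewrite linearZ /= gE coord_basis_e (negPf jq) scale0r scaler0.
have [g gE] := char p.
have g1 u : gr xs 1 u -> g u = 0.
  move: u; apply: lie_gr1_ind => [|i di].
    by split=> [|c u v hu hv]; rewrite ?linear0 // linearP /= hu hv scaler0 addr0.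
  rewrite gE coord_basis_e; have [ip|_] := eqVneq i p; last by rewrite scale0r.
  by rewrite -ip di eqxx in dp1.
have all0 u : (g u)`_1 = 0.
  move: u (gen1 u); apply: deg1_span_ind => [||u v gu _ _].
  - by split=> [|c u v hu hv]; rewrite ?linear0 ?coef0 // linearP coefD coefZ hu hv mulr0 addr0.
  - by rewrite rmorph1 coefC.
  by rewrite rmorphM /= g1 // mul0r coef0.
have := all0 (iota (tnth e p)); rewrite gE coord_basis_e eqxx scale1r coefX => /eqP.
by rewrite oner_eq0.
Qed.

Lemma lie_zero_on_basis : (forall i j, br (tnth e j) (tnth e i) = 0) -> forall u v, br u v = 0.
Proof.
move=> br0 u v.
have := memvf u; rewrite -(span_basis basis); move: u; apply: span_ind => [|u /tnthP[j ->]].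
  split=> [|c u w hu hw]; first by rewrite (br0l lie).
  by rewrite (br_linl lie) hu hw scaler0 addr0.
have := memvf v; rewrite -(span_basis basis); move: v; apply: span_ind => [|v /tnthP[i ->]].
  split=> [|c w w' hu hw]; first by rewrite (br0r lie).
  by rewrite (br_linr lie) hu hw scaler0 addr0.
exact: br0.
Qed.

(** A bracket of basis vectors has degree at least two, so it is a multiple of
    the only basis vector that is not of degree one; since some bracket is
    nonzero this vector has degree two, and then its own brackets vanish for
    reasons of degree. *)
Lemma lie_form : exists p : 'I_5,
  [/\ forall i, i != p -> tnth d i = 1%N, tnth d p = 2%N,
      forall v, br v (tnth e p) = 0
    & forall u v, br u v = coord e p (br u v) *: tnth e p].
Proof.
have [p dp] := lie_exceptional.
have [_ _ _ brd] := graded.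
have big k : (1 < tnth d k)%N -> k = p.
  by move=> dk; apply/eqP; apply: contraTT dk => /dp ->.
have brp i j : br (tnth e j) (tnth e i) \in <[tnth e p]>%VS.
  have := brd i j; apply: subvP; apply/span_subvP => _ /mapP[k + ->].
  rewrite mem_filter => /andP[/eqP dk _]; have := dpos i; have := dpos j => pj pi.
  by rewrite (big k) ?memv_line // dk; lia.
have brline u v : br u v \in <[tnth e p]>%VS.
  have := memvf u; rewrite -(span_basis basis); move: u; apply: span_ind => [|u /tnthP[j ->]].
    split=> [|c u w hu hw]; first by rewrite (br0l lie) mem0v.
    by rewrite (br_linl lie); apply: memvD => //; apply: memvZ.
  have := memvf v; rewrite -(span_basis basis); move: v; apply: span_ind => [|v /tnthP[i ->]].
    split=> [|c w w' hu hw]; first by rewrite (br0r lie) mem0v.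
    by rewrite (br_linr lie); apply: memvD => //; apply: memvZ.
  exact: brp.
have vanish i j : (tnth d j + tnth d i != tnth d p)%N -> br (tnth e j) (tnth e i) = 0.
  move=> dij; have := brd i j; suff -> : [seq tnth e k | k <- enum 'I_5 & tnth d k == (tnth d j + tnth d i)%N] = [::].
    by rewrite span_nil memv0 => /eqP.
  rewrite (_ : [seq k <- _ | _] = [::]) //; apply/eqP; rewrite -[_ == _]negbK -has_filter.
  apply/hasPn => k _; apply: contra dij => /eqP dk; rewrite -dk (big k) //.
  by rewrite dk; have := dpos i; have := dpos j; lia.
have dp2 : tnth d p = 2%N.
  apply/eqP; apply: contraT => dp2; case: lie_nonabelian; apply: lie_zero_on_basis => i j.
  apply: vanish; have := dpos p; have := dpos i; have := dpos j.
  have [->|/dp->] := eqVneq i p; have [->|/dp->] := eqVneq j p; lia.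
exists p; split=> // [v|u v].
  have := memvf v; rewrite -(span_basis basis); move: v; apply: span_ind => [|v /tnthP[i ->]].
    split=> [|c u w hu hw]; first by rewrite (br0l lie).
    by rewrite (br_linl lie) hu hw scaler0 addr0.
  by apply: vanish; rewrite dp2; have := dpos i; lia.
have /vlineP[c ->] := brline u v.
by rewrite linearZ /= coord_basis_e eqxx mulr1.
Qed.

(** The bracket is a nonzero alternating form on the span of the four vectors
    of degree one. A hyperbolic pair [u1], [u2] splits off, and rescaling the
    last vector makes the value of the form on the remaining pair 0 or 1. *)
Lemma lie_normal_form : exists z u1 u2 u3 u4 a,
  [/\ a = 0 \/ a = 1,
      [/\ <<[:: z; u1; u2; u3; u4]>>%VS = fullv
        & forall i, tnth d i = 1%N -> tnth e i \in <<[:: u1; u2; u3; u4]>>%VS],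
      [/\ br u1 z = 0, br u2 z = 0, br u3 z = 0 & br u4 z = 0],
      [/\ br u3 u1 = 0, br u3 u2 = 0, br u4 u1 = 0 & br u4 u2 = 0]
    & br u2 u1 = z /\ br u4 u3 = a *: z].
Proof.
have [p [dp dp2 brz brE]] := lie_form.
set z := tnth e p in brz brE.
pose om u v : K := coord e p (br u v).
have {}brE u v : br u v = om u v *: z := brE u v.
have [i [j omij]] : exists i j, om (tnth e j) (tnth e i) != 0.
  case: (boolP [exists i, exists j, om (tnth e j) (tnth e i) != 0]) => [/existsP[i /existsP[j ij]]|].
    by exists i, j.
  move=> no; case: lie_nonabelian; apply: lie_zero_on_basis => i j.
  rewrite brE; have := no; rewrite negb_exists => /forallP/(_ i).
  by rewrite negb_exists => /forallP/(_ j); rewrite negbK => /eqP->; rewrite scale0r.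
have omp v : om v z = 0 by rewrite /om brz linear0.
have ip : i != p by apply: contraNneq omij => ->; rewrite omp.
have jp : j != p.
  by apply: contraNneq omij => ->; rewrite /om (brC lie) linearN /= -/(om _ _) omp oppr0.
have ij : i != j by apply: contraNneq omij => ->; rewrite /om (brxx lie) linear0.
have [k [l kl]] : exists k l, forall x, x \in [:: p; i; j; k; l].
  pose s := enum [predC [:: p; i; j]].
  have szs : size s = 2%N.
    rewrite -cardE; have := cardC (mem [:: p; i; j]); rewrite card_ord.
    by rewrite (card_uniqP _) /= ?inE ?negb_or ?[p == _]eq_sym ?ip ?jp ?ij //= => -[].
  case sE : s szs => [|k [|l [|]]] // _; exists k, l => x.
  have [x3|x3] := boolP (x \in [:: p; i; j]).
    by move: x3; rewrite !inE => /or3P[] ->; rewrite ?orbT.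
  have : x \in s by rewrite mem_enum.
  by rewrite sE !inE => /orP[] ->; rewrite !orbT.
pose c := om (tnth e j) (tnth e i); pose u1 := tnth e i.
have [u2 b21 u2E] : exists2 u2, br u2 u1 = z & tnth e j = c *: u2.
  exists (c^-1 *: tnth e j); last by rewrite scalerA mulfV // scale1r.
  by rewrite (brZl lie) brE -/c scalerA mulVf // scale1r.
have b12 : br u1 u2 = - z by rewrite (brC lie) b21.
(* projection to the orthogonal complement of the hyperbolic pair *)
pose proj w := w - om u2 w *: u1 + om u1 w *: u2.
have p1 w : br u1 (proj w) = 0.
  rewrite /proj !(brDr lie) -scaleNr !(brZr lie) (brxx lie) b12 scaler0 addr0 brE.
  by rewrite scalerN subrr.
have p2 w : br u2 (proj w) = 0.
  by rewrite /proj !(brDr lie) -scaleNr !(brZr lie) (brxx lie) b21 scaler0 addr0 brE scaleNr subrr.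
pose u3 := proj (tnth e k); pose w4 := proj (tnth e l).
(* If the form vanishes on [u3] and [w4] then no rescaling is needed. *)
pose a' := om w4 u3; pose t := if a' == 0 then 1 else a'^-1.
have t0 : t != 0 by rewrite /t; case: (eqVneq a' 0) => h; rewrite ?oner_eq0 ?invr_eq0.
pose u4 := t *: w4.
have spj : forall w (V : {vspace L}), u1 \in V -> u2 \in V -> proj w \in V -> w \in V.
  move=> w V h1 h2 hw.
  have -> : w = proj w + om u2 w *: u1 - om u1 w *: u2 by rewrite /proj addrAC addrK subrK.
  by apply: memvB; [apply: memvD => //|]; apply: memvZ.
have inV x : x != p -> tnth e x \in <<[:: u1; u2; u3; u4]>>%VS.
  have h1 : u1 \in <<[:: u1; u2; u3; u4]>>%VS by apply: memv_span; rewrite !inE eqxx.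
  have h2 : u2 \in <<[:: u1; u2; u3; u4]>>%VS by apply: memv_span; rewrite !inE eqxx orbT.
  have h3 : u3 \in <<[:: u1; u2; u3; u4]>>%VS by apply: memv_span; rewrite !inE eqxx !orbT.
  have h4 : w4 \in <<[:: u1; u2; u3; u4]>>%VS.
    by rewrite -[w4](scalerK t0); apply/memvZ/memv_span; rewrite !inE eqxx !orbT.
  have := kl x; rewrite inE => /orP[->//|]; rewrite !inE => /or4P[] /eqP-> _ //.
  - by rewrite u2E; apply: memvZ.
  - exact: spj h1 h2 h3.
  - exact: spj h1 h2 h4.
exists z, u1, u2, u3, u4, (t * a'); split.
- by rewrite /t; case: (eqVneq a' 0) => [->|h]; [left; rewrite mulr0 | right; rewrite mulVf].
- split=> [|x dx]; last by apply: inV; apply: contra_eqN dx => /eqP->; rewrite dp2.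
  apply/eqP; rewrite eqEsubv subvf -(span_basis basis); apply/span_subvP => _ /tnthP[x ->].
  rewrite span_cons; have [->|xp] := eqVneq x p; first by apply: (subvP (addvSl _ _)); apply: memv_line.
  by apply: (subvP (addvSr _ _)); apply: inV.
- by split; apply: brz.
- by split; rewrite (brC lie) ?(brZr lie) ?p1 ?p2 ?scaler0 oppr0.
by split=> //; rewrite (brZl lie) brE scalerA.
Qed.

(** The universal property of U and that of the example give maps in both
    directions, inverse to each other on generators. *)
Lemma lie_type_of_example : exists (a : K) (A : algType K) (z x1 x2 x3 x4 : A),
  [/\ a = 0 \/ a = 1, is_example 1 a 0 z x1 x2 x3 x4
    & forall l, has_relation_type xs l -> has_relation_type (example_vars z x1 x2 x3 x4) l].
Proof.
have [Z [u1 [u2 [u3 [u4 [a [a01 [spB d1B] [bz1 bz2 bz3 bz4] [b31 b32 b41 b42] [b21 b43]]]]]]]] := lie_normal_form.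
have [A [z [x1 [x2 [x3 [x4 ex]]]]]] : exists (A : algType K) (z x1 x2 x3 x4 : A), is_example 1 a 0 z x1 x2 x3 x4.
  by apply: example_family; rewrite ?mulr1 ?mul0r.
exists a, A, z, x1, x2, x3, x4; split=> //.
have [tow [[/eq0I e1 /eq0I e2 /eq0I e3 /eq0I e4] /eq0I e21
  [/eq0I e31 /eq0I e32 /eq0I e41 /eq0I e42] /eq0I e43] lift] := ex.
pose B : 5.-tuple L := [tuple Z; u1; u2; u3; u4].
have basisB : basis_of fullv B.
  by rewrite basisEdim spB subvv (size_basis basis).
have freeB := basis_free basisB.
pose X := [:: z; x1; x2; x3; x4].
have [phi phiB] : exists phi : {linear L -> A}, forall m : 'I_5, phi B`_m = X`_m.
  have [|f fE] := @linear_of _ _ _ (fun v => \sum_(m < 5) coord B m v *: X`_m : A).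
    move=> c u v; rewrite scaler_sumr -big_split; apply: eq_bigr => m _.
    by rewrite linearP scalerDl scalerA.
  exists f => m; rewrite fE (bigD1 m) //= big1 ?addr0 => [|n nm]; rewrite coord_free //.
    by rewrite eqxx scale1r.
  by rewrite eq_sym (negPf nm) scale0r.
have [pz p1 p2 p3 p4] : [/\ phi Z = z, phi u1 = x1, phi u2 = x2, phi u3 = x3 & phi u4 = x4].
  by split; [have := phiB i0 | have := phiB i1 | have := phiB i2 | have := phiB i3 | have := phiB i4].
have phi_assoc : lie_to_assoc br phi.
  apply: (lie_to_assoc_basis lie spB); rewrite [pairwise _ _]/=.
  rewrite bz1 bz2 bz3 bz4 b31 b32 b41 b42 b21 b43 !linear0 [phi (_ *: _)]linearZ.
  rewrite pz p1 p2 p3 p4 e1 e2 e3 e4 e31 e32 e41 e42 e21 e43 !subrr !eqxx /=.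
  by rewrite scale0r addr0 scale1r ![_ + z]addrC ![_ + a *: _]addrC !addrK !eqxx.
have [h [hE _]] := env.2 A phi phi_assoc.
have rel u v : iota u * iota v = iota v * iota u + iota (br u v).
  by rewrite (env.1 u v) addrC subrK.
have relU : example_relations (fun u => u = 0) 1 a 0 (iota Z) (iota u1) (iota u2) (iota u3) (iota u4).
  split; first split; try (apply/eq0I; rewrite rel ?bz1 ?bz2 ?bz3 ?bz4 linear0 addr0 //).
  - by apply/eq0I; rewrite rel b21 scale1r.
  - by split; apply/eq0I; rewrite rel ?b31 ?b32 ?b41 ?b42 linear0 addr0.
  by apply/eq0I; rewrite rel b43 linearZ scale0r addr0.
have [g0 [g1 [gz gx1 gx2 gx3 gx4] gM]] := lift U _ (zero_ideal U) _ _ _ _ _ relU.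
have {}gM : {morph g0 : u v / u * v} by move=> u v; apply/eq0I.
have gl : linear g0 by move=> c u v; rewrite linearP.
have [g gE] := lrmorphism_of gl g1 gM.
have hx : [/\ h (iota Z) = z, h (iota u1) = x1, h (iota u2) = x2, h (iota u3) = x3 & h (iota u4) = x4].
  by split; rewrite hE.
have [hz h1 h2 h3 h4] := hx.
have gK : cancel g h.
  move=> u; move: u; apply: (tower_subalgebra_ind tow).
    exact: (subalgebra_equalizer [the {lrmorphism A -> A} of h \o g] [the {lrmorphism A -> A} of idfun]).
  move=> u n; rewrite !inE => /or4P[/eqP[-> _]|/eqP[-> _]|/eqP[-> _]|/orP[/eqP[-> _]|/eqP[-> _]]];
  by rewrite gE ?gz ?gx1 ?gx2 ?gx3 ?gx4.
have giota v : g (phi v) = iota v.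
  have := memvf v; rewrite -spB; move: v; apply: span_ind.
    exact: (@subspace_eq _ _ _ [the {linear _ -> _} of g \o phi] iota).
  move=> u; rewrite !inE => /or4P[/eqP->|/eqP->|/eqP->|/orP[/eqP->|/eqP->]];
  by rewrite ?pz ?p1 ?p2 ?p3 ?p4 gE.
have hK : cancel h g.
  have [k [_ ku]] := env.2 U iota env.1.
  move=> u; rewrite -[LHS]/([the {lrmorphism U -> U} of g \o h] u).
  rewrite ku; last by move=> v; rewrite /= hE giota.
  by rewrite -(ku [the {lrmorphism U -> U} of idfun]).
have [_ dimA] := example_as_ore ex.
move=> l; apply: (has_relation_type_iso gK hK).
  by move=> b dimb; rewrite (has_dim_unique (gr_subspace xs 1) dimb dim1).
apply: lie_gr1_ind; first exact: (@subspace_preim _ _ _ h _ (gr_subspace _ 1)).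
move=> i /d1B; rewrite hE; move: (tnth e i).
apply: span_ind; first exact: (@subspace_preim _ _ _ phi _ (gr_subspace _ 1)).
move=> u; rewrite !inE => /or4P[] /eqP->; rewrite ?p1 ?p2 ?p3 ?p4;
by apply: gr_gen; rewrite !inE eqxx ?orbT.
Qed.

End GradedLie.

(** * The relation types that occur *)

Lemma example_realizes (K : fieldType) (s a b : K) l : s * s = 1 -> b * (1 + s) = 0 ->
  (forall (A : algType K) (z x1 x2 x3 x4 : A), is_example s a b z x1 x2 x3 x4 ->
     has_relation_type (example_vars z x1 x2 x3 x4) l) ->
  as_ore_relation_type K 5 4 l.
Proof.
move=> s1 bs typ; have [A [z [x1 [x2 [x3 [x4 ex]]]]]] := example_family a s1 bs.
have [ore dim1] := example_as_ore ex.
by exists A, (example_vars z x1 x2 x3 x4); split=> //; apply: typ.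
Qed.

Lemma example_realizes_enveloping (K : fieldType) (a : K) l :
  (forall (A : algType K) (z x1 x2 x3 x4 : A), is_example 1 a 0 z x1 x2 x3 x4 ->
     has_relation_type (example_vars z x1 x2 x3 x4) l) ->
  enveloping_relation_type K 5 4 l.
Proof.
move=> typ.
have [A [z [x1 [x2 [x3 [x4 ex]]]]]] := example_family a (mulr1 (1 : K)) (mul0r (1 + 1 : K)).
exact: (std_enveloping_type ex (typ _ _ _ _ _ _ ex)).
Qed.

Local Close Scope ring_scope.

Theorem theorem1p2 (K : fieldType) :
  (forall l : seq nat,
     as_ore_relation_type K 5 4 l <->
     (l = [:: 2; 2; 2; 2; 2] \/
      l = [:: 2; 2; 2; 2; 2; 3] \/
      l = [:: 2; 2; 2; 2; 2; 3; 3])) /\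
  ~ enveloping_relation_type K 5 4 [:: 2; 2; 2; 2; 2; 3] /\
  enveloping_relation_type K 5 4 [:: 2; 2; 2; 2; 2] /\
  enveloping_relation_type K 5 4 [:: 2; 2; 2; 2; 2; 3; 3].
Proof.
split; [|split; [|split]].
- move=> l; split=> [[A [xs [ore size5 dim1 rel]]]|].
    have [k k2 /(_ l rel) ->] := as_ore_relation_type_bound ore size5 dim1.
    by case: k k2 => [|[|[|k]]] //= _; [left | right; left | right; right].
  case=> [->|[->|->]].
  + apply: (@example_realizes K 1%R 1%R 0%R); rewrite ?mulr1 ?mul0r //; exact: example0_type.
  + apply: (@example_realizes K (-1)%R 0%R 1%R); rewrite ?mulrNN ?mul1r ?subrr //; exact: example1_type.
  + apply: (@example_realizes K 1%R 0%R 0%R); rewrite ?mulr1 ?mul0r //; exact: example2_type.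
- case=> L [br [e [d [U [iota]]]]] [graded env gen1 dim1 rel].
  have [a [A [z [x1 [x2 [x3 [x4 [a01 ex tr]]]]]]]] := lie_type_of_example graded env gen1 dim1.
  have [ore dimA] := example_as_ore ex.
  have [k _ kuniq] := as_ore_relation_type_bound ore (erefl _) dimA.
  have := kuniq _ (tr _ rel).
  case: a01 ex => -> ex.
    by rewrite -(kuniq _ (example2_type ex)).
  by rewrite -(kuniq _ (example0_type ex)).
- exact: (example_realizes_enveloping (@example0_type K)).
exact: (example_realizes_enveloping (@example2_type K)).
Qed.
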